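(* Let $f:\mathbb{R}^n\times\mathbb{R}^m\to\mathbb{R}^n$ be continuous with $\sup_{y\in\mathbb{R}^m}|f(x,y)|\le a+b|x|$ for all $x\in\mathbb{R}^n$, for some $a,b>0$. Let $g:\mathbb{R}^n\times\mathbb{R}^m\times\mathbb{R}\to\mathbb{R}^m$ be admissible (for every compact $K\subset\mathbb{R}^n\times\mathbb{R}^m$, $g$ is bounded and uniformly continuous on $K\times\mathbb{R}$) and uniformly Lipschitz in $y$ on compact sets (for all compact $K_0\subset\mathbb{R}^n$, $K\subset\mathbb{R}^m$ there is $L=L(K_0,K)$ with $|g(x,y_1,\tau)-g(x,y_2,\tau)|\le L|y_1-y_2|$ for all $y_1,y_2\in K$, $x\in K_0$, $\tau\in\mathbb{R}$). Let $\mathcal{O}(g)$ be the omega-limit set of $g$ in its hull. Assume that for each $h\in\{g\cdot\tau_0\mid\tau_0\ge0\}\cup\mathcal{O}(g)$, $x\in\mathbb{R}^n$, $y_0\in\mathbb{R}^m$ the solution $y(\tau,h,x,y_0)$ is defined for all $\tau\ge0$, and that for each compact $K_0\subset\mathbb{R}^n$ the solutions of the parametric family $y'=g(x,y,\tau)$, $x\in K_0$, are uniformly ultimately bounded on $[0,\infty)$. Fix $x_0\in\mathbb{R}^n$, $y_0\in\mathbb{R}^m$ and for each $\varepsilon>0$ let $(x_\varepsilon(t),y_\varepsilon(t))$ be a solution of $$\dot x=f(x,y),\qquad \varepsilon\dot y=g(x,y,t/\varepsilon),\qquad x(0)=x_0,\ y(0)=y_0,$$ and write $Y_\varepsilon(\tau):=y_\varepsilon(\varepsilon\tau)$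 for the fast component in the fast time $\tau=t/\varepsilon$. Then, given $t_0>0$, for $\varepsilon$ small enough $(x_\varepsilon(t),y_\varepsilon(t))$ can be extended to $t\in[0,t_0]$. Furthermore: (i) Every sequence of positive numbers $\varepsilon_j\to0$ has a subsequence, say $\varepsilon_k\downarrow 0$, such that $x_{\varepsilon_k}(t)$ converges uniformly for $t\in[0,t_0]$ to a solution $x_0(t)$, $t\in[0,t_0]$, of the differential inclusion $$\dot x\in\Big\{\int_{\mathbb{R}^m}f(x,y)\,d\mu(y)\ \Big|\ \mu\in M\big(\mathbb{A}^x_{\mathcal{O}(g)}\big)\Big\},\qquad x(0)=x_0 .$$ (ii) For such a sequence $\varepsilon_k$ and limit $x_0(\cdot)$, for a fixed small $r>0$ let $K_0:=\{x_0(t)+x\mid t\in[0,t_0],\ x\in\mathbb{R}^n,\ |x|\le r\}$ (compact) and let $\mathbb{A}\subset\mathcal{O}(g)\times K_0\times\mathbb{R}^m$ be the global attractor of the skew-product semiflow $\pi$ on $\mathcal{O}(g)\times K_0\times\mathbb{R}^m$, with sections $A_{(h,x)}$. Then, given $\delta>0$, there exist times $T>0$, $\tau_0>0$, a constant $0<\tilde\delta\le\delta$, and an integer $k_0>0$ with $\tau_0+2T<t_0/\varepsilon_{k_0}$ such that for every sequence of maps $\{h_i\}_{i\ge0}\subset\mathcal{O}(g)$ with $d\big(g\cdot(\tau_0+iT),h_i\big)<\tilde\delta$ for $i\ge0$, for every $k\ge k_0$ and (for every $i\geq 0$) for every $\tau\in[\tau_0+(i+1)T,\tau_0+(i+2)T]\cap[\tau_0+T,t_0/\varepsilon_k]$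 (if any), it holds that $$\mathrm{dist}\big(Y_{\varepsilon_k}(\tau),A_{(h_i\cdot(\tau-\tau_0-iT),\,x_0(\varepsilon_k\tau))}[\delta]\big)\le\delta .$$
   Context: Hull. $(g\cdot s)(x,y,\tau)=g(x,y,\tau+s)$; the hull $\mathcal{H}$ is the closure of $\{g\cdot s\mid s\in\mathbb{R}\}$ in the compact-open topology, a compact metric space with a fixed metric $d$, on which $(\tau,h)\mapsto h\cdot\tau$ (translation in the last variable) is a continuous flow. $\mathcal{O}(g)\subset\mathcal{H}$ is the omega-limit set of $g$, i.e. the set of limits of sequences $g\cdot\tau_k$ with $\tau_k\to\infty$; it is compact and invariant. Solutions. For $h\in\mathcal{H}$, $x\in\mathbb{R}^n$: $y(\tau,h,x,\tau_0,y_0)$ is the solution of $y'=h(x,y,\tau)$ ($x$ a fixed parameter) with $y(\tau_0)=y_0$, and $y(\tau,h,x,y_0):=y(\tau,h,x,0,y_0)$. Uniform ultimate boundedness on $[0,\infty)$ of $y'=g(x,y,\tau)$, $x\in K_0$: there is $c>0$ such that for every $\rho>0$ there is $T=T(\rho)$ with $|y(\tau+\tau_0,g,x,\tau_0,y_0)|\le c$ for all $x\in K_0$, $\tau_0\ge0$, $\tau\ge T$, $|y_0|\le \rho$. Semiflows. For compact $K_0\subset\mathbb{R}^n$, $\pi(\tau,h,x,y_0)=(h\cdot\tau,x,y(\tau,h,x,y_0))$, $\tau\ge0$, on $\mathcal{O}(g)\times K_0\times\mathbb{R}^m$. For fixed $x\in\mathbb{R}^n$, $\pi^x(\tau,h,y_0)=(h\cdot\tau,y(\tau,h,x,y_0))$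 on $\mathcal{O}(g)\times\mathbb{R}^m$. Under the stated assumptions both have global attractors $\mathbb{A}\subset\mathcal{O}(g)\times K_0\times\mathbb{R}^m$ and $\mathbb{A}^x\subset\mathcal{O}(g)\times\mathbb{R}^m$: the global attractor of a skew-product semiflow on $P\times\mathbb{R}^m$ ($P$ compact) is the nonempty compact invariant set ($\pi_\tau(\mathbb{A})=\mathbb{A}$ for $\tau\ge0$) with $\lim_{\tau\to\infty}\mathrm{dist}(\pi_\tau(P\times D),\mathbb{A})=0$ for every bounded $D\subset\mathbb{R}^m$. Sections: $A_{(h,x)}=\{y\mid(h,x,y)\in\mathbb{A}\}$ for $(h,x)\in\mathcal{O}(g)\times K_0$. Parametrically inflated pullback attractor: for $\delta>0$ and $(h,x)\in\mathcal{O}(g)\times K_0$, $A_{(h,x)}[\delta]=\bigcup A_{(\tilde h,\tilde x)}$, the union over $(\tilde h,\tilde x)\in\mathcal{O}(g)\times K_0$ with $\max\{d(h,\tilde h),|x-\tilde x|\}\le\delta$. $\mathrm{dist}(Y_1,Y_2)=\sup_{y_1\in Y_1}\inf_{y_2\in Y_2}d(y_1,y_2)$ is the Hausdorff semidistance (distance from a point to a set when $Y_1$ is a point). $\mathbb{A}^x_{\mathcal{O}(g)}:=\mathbb{A}^x\cap(\mathcal{O}(g)\times\mathbb{R}^m)$ (here equal to $\mathbb{A}^x$), and $M(\mathbb{A}^x_{\mathcal{O}(g)})$ is the set of marginals (projections) on $\mathbb{R}^m$ of the $\pi^x$-invariant normalized Borel measures supported on $\mathbb{A}^x_{\mathcal{O}(g)}$.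 A solution of a differential inclusion $\dot x\in F(x)$ on $[0,t_0]$ is an absolutely continuous function with $\dot x(t)\in F(x(t))$ for a.e. $t\in[0,t_0]$. *)

(* Defs.v *)
From HB Require Import structures.
From mathcomp Require Import all_boot all_order all_algebra.
From mathcomp Require Import all_classical all_reals all_analysis.

Set Implicit Arguments.
Unset Strict Implicit.
Unset Printing Implicit Defensive.

Import Order.TTheory GRing.Theory Num.Theory.
Import numFieldNormedType.Exports.

Local Open Scope classical_set_scope.
Local Open Scope ring_scope.

(* ['rV[R]_k] carries the library topology; the library norm on it is the
   sup norm, so the Euclidean norm is defined separately. *)
Definition enorm (R : realType) (k : nat) (v : 'rV[R]_k) : R :=
  Num.sqrt (\sum_(i < k) v ord0 i ^+ 2).

(* Derivative relative to [I], hence one-sided at an endpoint of [I]. *)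
Definition deriv_within (R : realType) (k : nat) (I : set R)
    (phi : R -> 'rV[R]_k) (t : R) (v : 'rV[R]_k) : Prop :=
  (s - t)^-1 *: (phi s - phi t) @[s --> within I t^'] --> v.

(* Functions of [(x, y, tau)] with the compact-open topology. *)
Definition vfield (R : realType) (n m : nat) : ptopologicalType :=
  {compact-open, ('rV[R]_n * 'rV[R]_m * R)%type -> 'rV[R]_m}.

Definition admissible (R : realType) (n m : nat)
    (g : 'rV[R]_n * 'rV[R]_m * R -> 'rV[R]_m) : Prop :=
  forall K : set ('rV[R]_n * 'rV[R]_m), compact K ->
    (exists C : R, forall p tau, K p -> enorm (g (p, tau)) <= C) /\
    (forall e : R, 0 < e -> exists2 del : R, 0 < del &
       forall p q tau sigma, K p -> K q ->
         enorm (p.1 - q.1) < del -> enorm (p.2 - q.2) < del ->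
         `|tau - sigma| < del -> enorm (g (p, tau) - g (q, sigma)) < e).

Definition lipschitz_in_y (R : realType) (n m : nat)
    (g : 'rV[R]_n * 'rV[R]_m * R -> 'rV[R]_m) : Prop :=
  forall (K0 : set 'rV[R]_n) (K : set 'rV[R]_m), compact K0 -> compact K ->
    exists L : R, forall x y1 y2 tau, K0 x -> K y1 -> K y2 ->
      enorm (g (x, y1, tau) - g (x, y2, tau)) <= L * enorm (y1 - y2).

Definition tshift (R : realType) (n m : nat) (h : vfield R n m) (s : R) :
    vfield R n m :=
  fun p => h (p.1, p.2 + s).

(* [vfield] also contains discontinuous functions, so the closure is cut down
   to the space of continuous ones. *)
Definition hull (R : realType) (n m : nat) (g : vfield R n m) :
    set (vfield R n m) :=
  [set h | continuous (h : 'rV[R]_n * 'rV[R]_m * R -> 'rV[R]_m)] `&`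
  closure (range (tshift g)).

Definition omega_limit (R : realType) (n m : nat) (g : vfield R n m) :
    set (vfield R n m) :=
  [set h | hull g h /\
     exists2 tau : nat -> R, tau @ \oo --> +oo &
       tshift g (tau k) @[k --> \oo] --> h].

(* The last clause says that [d] induces on [H] the subspace topology. *)
Definition metrizes (R : realType) (T : topologicalType) (H : set T)
    (d : T -> T -> R) : Prop :=
  [/\ forall h k, H h -> H k -> 0 <= d h k /\ (d h k = 0 <-> h = k),
      forall h k, H h -> H k -> d h k = d k h,
      forall h k l, H h -> H k -> H l -> d h l <= d h k + d k l &
      forall h, H h -> forall B : set T,
        within H (nbhs h) B <->
        exists2 e : R, 0 < e & forall k, H k -> d h k < e -> B k].

Definition fast_solution (R : realType) (n m : nat) (h : vfield R n m)
    (x : 'rV[R]_n) (tau0 : R) (y0 : 'rV[R]_m) (phi : R -> 'rV[R]_m) : Prop :=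
  phi tau0 = y0 /\
  forall tau, tau0 <= tau ->
    deriv_within [set s | tau0 <= s] phi tau (h (x, phi tau, tau)).

(* [fast_flow h x tau0 y0 tau] is y(tau, h, x, tau0, y0); it is meaningful for
   [tau0 <= tau], when a solution on the whole half-line exists. *)
Definition fast_flow (R : realType) (n m : nat) (h : vfield R n m)
    (x : 'rV[R]_n) (tau0 : R) (y0 : 'rV[R]_m) : R -> 'rV[R]_m :=
  xget (fun=> y0) [set phi | fast_solution h x tau0 y0 phi].

Definition ultimately_bounded (R : realType) (n m : nat) (g : vfield R n m)
    (K0 : set 'rV[R]_n) : Prop :=
  exists2 c : R, 0 < c &
    forall rho : R, 0 < rho -> exists2 T : R, 0 <= T &
      forall x tau0 tau y0, K0 x -> 0 <= tau0 -> T <= tau ->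
        enorm y0 <= rho -> enorm (fast_flow g x tau0 y0 (tau + tau0)) <= c.

(* The supremum is taken in [0, +oo], so that the empty set is at
   semidistance 0 from every set. *)
Definition semidist (R : realType) (T : Type) (dT : T -> T -> R)
    (A B : set T) : \bar R :=
  maxe 0%E
    (ereal_sup [set ereal_inf [set (dT p q)%:E | q in B] | p in A]).

Definition eudist (R : realType) (k : nat) (v w : 'rV[R]_k) : R :=
  enorm (v - w).

Definition prod_dist (R : realType) (S T : Type) (dS : S -> S -> R)
    (dT : T -> T -> R) (p q : S * T) : R :=
  Num.max (dS p.1 q.1) (dT p.2 q.2).

Definition is_global_attractor (R : realType) (B : topologicalType)
    (m : nat) (P : set B) (dB : B -> B -> R)
    (S : R -> B * 'rV[R]_m -> B * 'rV[R]_m) (A : set (B * 'rV[R]_m)) : Prop :=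
  [/\ A `<=` P `*` setT, A !=set0, compact A,
      forall tau, 0 <= tau -> S tau @` A = A &
      forall D : set 'rV[R]_m, bounded_set D ->
        semidist (prod_dist dB (@eudist R m)) (S tau @` (P `*` D)) A
          @[tau --> +oo] --> 0%E].

(* The conditions above determine the attractor uniquely; the value is the
   empty set if there is none. *)
Definition global_attractor (R : realType) (B : topologicalType)
    (m : nat) (P : set B) (dB : B -> B -> R)
    (S : R -> B * 'rV[R]_m -> B * 'rV[R]_m) : set (B * 'rV[R]_m) :=
  xget set0 [set A | is_global_attractor P dB S A].

Definition semiflow (R : realType) (n m : nat) (tau : R)
    (p : vfield R n m * 'rV[R]_n * 'rV[R]_m) :
    vfield R n m * 'rV[R]_n * 'rV[R]_m :=
  let: (h, x, y) := p in (tshift h tau, x, fast_flow h x 0 y tau).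

Definition semiflow_at (R : realType) (n m : nat) (x : 'rV[R]_n) (tau : R)
    (p : vfield R n m * 'rV[R]_m) : vfield R n m * 'rV[R]_m :=
  let: (h, y) := p in (tshift h tau, fast_flow h x 0 y tau).

Definition attractor (R : realType) (n m : nat) (g : vfield R n m)
    (d : vfield R n m -> vfield R n m -> R) (K0 : set 'rV[R]_n) :
    set (vfield R n m * 'rV[R]_n * 'rV[R]_m) :=
  global_attractor (omega_limit g `*` K0) (prod_dist d (@eudist R n))
    (@semiflow R n m).

Definition attractor_at (R : realType) (n m : nat) (g : vfield R n m)
    (d : vfield R n m -> vfield R n m -> R) (x : 'rV[R]_n) :
    set (vfield R n m * 'rV[R]_m) :=
  global_attractor (omega_limit g) d (@semiflow_at R n m x).

Definition fiber (R : realType) (n m : nat)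
    (A : set (vfield R n m * 'rV[R]_n * 'rV[R]_m)) (h : vfield R n m)
    (x : 'rV[R]_n) : set 'rV[R]_m :=
  [set y | A (h, x, y)].

Definition inflated_fiber (R : realType) (n m : nat) (g : vfield R n m)
    (d : vfield R n m -> vfield R n m -> R) (K0 : set 'rV[R]_n)
    (delta : R) (h : vfield R n m) (x : 'rV[R]_n) : set 'rV[R]_m :=
  \bigcup_(q in [set q : vfield R n m * 'rV[R]_n |
      (omega_limit g `*` K0) q /\ Num.max (d h q.1) (eudist x q.2) <= delta])
    fiber (attractor g d K0) q.1 q.2.

(* [g_sigma_algebraType] is a measurable type only over a pointed type. *)
HB.instance Definition _ (S T : ptopologicalType) :=
  Pointed.on (S * T)%type.

Definition borel (T : ptopologicalType) := g_sigma_algebraType (@open T).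

(* A Borel measure on [omega_limit g * R^m] is given as a Borel measure on the
   ambient product.  As [semiflow_at] is meaningful only over
   [omega_limit g], the preimages are taken in that phase space. *)
Definition invariant_measure_on (R : realType) (n m : nat) (g : vfield R n m)
    (x : 'rV[R]_n) (A : set (vfield R n m * 'rV[R]_m))
    (nu : probability (borel (vfield R n m * 'rV[R]_m)%type) R) : Prop :=
  nu A = 1%E /\
  forall tau (B : set (borel (vfield R n m * 'rV[R]_m)%type)),
    0 <= tau -> measurable B ->
    nu ((omega_limit g `*` setT) `&` semiflow_at x tau @^-1` B) = nu B.

Definition marginals (R : realType) (n m : nat) (g : vfield R n m)
    (x : 'rV[R]_n) (A : set (vfield R n m * 'rV[R]_m)) :
    set (probability (borel 'rV[R]_m) R) :=
  [set mu | exists2 nu : probability (borel (vfield R n m * 'rV[R]_m)%type) R,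
     invariant_measure_on g x A nu &
     forall B : set (borel 'rV[R]_m), measurable B ->
       mu B = nu (setT `*` B)].

Definition averaged_field (R : realType) (n m : nat)
    (f : 'rV[R]_n * 'rV[R]_m -> 'rV[R]_n) (g : vfield R n m)
    (d : vfield R n m -> vfield R n m -> R) (x : 'rV[R]_n) :
    set 'rV[R]_n :=
  [set v | exists2 mu : probability (borel 'rV[R]_m) R,
     marginals g x (attractor_at g d x) mu &
     v = \row_(i < n) \int[mu]_y (f (x, y) ord0 i)].

Definition absolutely_continuous (R : realType) (k : nat) (t0 : R)
    (u : R -> 'rV[R]_k) : Prop :=
  forall e : R, 0 < e -> exists2 del : R, 0 < del &
    forall (N : nat) (l r : 'I_N -> R),
      (forall i, 0 <= l i /\ l i <= r i /\ r i <= t0) ->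
      (forall i j, i != j -> r i <= l j \/ r j <= l i) ->
      \sum_(i < N) (r i - l i) < del ->
      \sum_(i < N) enorm (u (r i) - u (l i)) < e.

Definition inclusion_solution (R : realType) (k : nat)
    (F : 'rV[R]_k -> set 'rV[R]_k) (t0 : R) (u : R -> 'rV[R]_k) : Prop :=
  absolutely_continuous t0 u /\
  {ae @lebesgue_measure R, forall t : R, t \in `[0, t0] ->
     exists2 v, F (u t) v & deriv_within `[0, t0]%classic u t v}.

Definition slow_fast_solution (R : realType) (n m : nat)
    (f : 'rV[R]_n * 'rV[R]_m -> 'rV[R]_n) (g : vfield R n m)
    (x0 : 'rV[R]_n) (y0 : 'rV[R]_m) (eps : R) (I : set R)
    (X : R -> 'rV[R]_n) (Y : R -> 'rV[R]_m) : Prop :=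
  [/\ X 0 = x0, Y 0 = y0 &
      forall t, I t ->
        deriv_within I X t (f (X t, Y t)) /\
        exists2 v, deriv_within I Y t v &
          eps *: v = g (X t, Y t, t / eps)].

(* [(X', Y')] is an extension to [0, t0] of the solution [(X, Y)], which is
   defined on [I]. *)
Definition extends_to (R : realType) (n m : nat)
    (f : 'rV[R]_n * 'rV[R]_m -> 'rV[R]_n) (g : vfield R n m)
    (x0 : 'rV[R]_n) (y0 : 'rV[R]_m) (t0 eps : R) (I : set R)
    (X : R -> 'rV[R]_n) (Y : R -> 'rV[R]_m)
    (X' : R -> 'rV[R]_n) (Y' : R -> 'rV[R]_m) : Prop :=
  slow_fast_solution f g x0 y0 eps `[0, t0]%classic X' Y' /\
  forall t, I t -> t <= t0 -> X' t = X t /\ Y' t = Y t.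

Definition slow_limit (R : realType) (n m : nat)
    (f : 'rV[R]_n * 'rV[R]_m -> 'rV[R]_n) (g : vfield R n m)
    (d : vfield R n m -> vfield R n m -> R) (x0 : 'rV[R]_n) (t0 : R)
    (X : R -> R -> 'rV[R]_n) (eps : nat -> R) (xlim : R -> 'rV[R]_n) : Prop :=
  [/\ (forall k, 0 < eps k), decreasing_seq eps, eps @ \oo --> 0,
      {uniform `[0, t0]%classic, X (eps k) @[k --> \oo] --> xlim} &
      xlim 0 = x0 /\ inclusion_solution (averaged_field f g d) t0 xlim].

(* Main.v *)
(* In the fast time tau = t / eps the slow variable is nearly constant on bounded
   intervals, so the fast component stays close to the flow of y' = h(x, y, tau)
   with x frozen and h a translate of g.  Ultimate boundedness of that flow bounds
   the fast components uniformly in eps; with Peano's theorem this extends the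
   solutions to [0, t0].

   For the differential inclusion, the slow components are equi-Lipschitz, and they
   converge uniformly along an ultrafilter to a Lipschitz curve xlim, which is
   derivable almost everywhere.  At a point t of derivability, xlim'(t) is the limit
   of averages of f(xlim(t), y) over the points (g . tau, Y(tau)) of a fine grid in
   a window that is short in slow time and long in fast time.  A limit of the
   empirical measures of these grids exists on the hull times R^m: coding points by
   finer and finer covers and arranging the codes in increasing order turns the
   empirical measures into step functions on [0, 1], whose limit phi carries the
   limit measure as the law of a uniform variable.  This measure sits over the
   omega-limit set, because t / eps tends to infinity; it is invariant, because a
   shift by a fixed fast time changes a negligible part of the average; and an
   invariant measure with bounded support is carried by the global attractor.

   For the tracking statement, T is the time after which the skew-product semiflow
   over K_0 is delta/2-close to its attractor, uniformly for the bounded set that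
   contains the fast components; a fast component restarted at tau_0 + i T follows
   the flow of h_i for the time 2 T with error delta/2. *)
Require Import Defs.
From HB Require Import structures.
From mathcomp Require Import all_boot all_order all_algebra.
From mathcomp Require Import all_classical all_reals all_analysis.
From mathcomp Require Import measurable_realfun ring lra.

Set Implicit Arguments.
Unset Strict Implicit.
Unset Printing Implicit Defensive.

Import Order.TTheory GRing.Theory Num.Theory.
Import numFieldNormedType.Exports.

Local Open Scope classical_set_scope.
Local Open Scope ring_scope.

(** The flow exists only over forward translates of [g] and their limits, so the work takes place on
    the compact set [Hplus], which consists of exactly these.

    Limits are taken along an ultrafilter, where bounded families indexed by a continuum of times or
    of test functions converge at once; a true subsequence is extracted only at the end. The
    differential inclusion is obtained pointwise: each derivative of the limit curve comes with its
    own invariant measure.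

    Carrying that measure by a map [phi] on the unit interval turns integrals into limits of
    integrals of step functions. Invariance and support are then checked on uniformly continuous
    functions along [phi] and transferred to Borel sets by approximating indicators of closed
    sets. *)

Lemma cvg_sumr (R : realType) (T : Type) (F : set_system T) {FF : Filter F}
    (I : Type) (r : seq I) (f : I -> T -> R) (l : I -> R) :
  (forall i, true -> f i x @[x --> F] --> l i) ->
  \sum_(i <- r) f i x @[x --> F] --> \sum_(i <- r) l i.
Proof.
move=> H; elim: r => [|i r IH].
  by under eq_fun do rewrite big_nil; rewrite big_nil; exact: cvg_cst.
under eq_fun do rewrite big_cons; rewrite big_cons.
by apply: cvgD IH; exact: H.
Qed.

(** * Euclidean norm and inner product on row vectors *)

Section EuclideanNorm.
Context {R : realType} {k : nat}.
Implicit Types v w : 'rV[R]_k.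

Definition dotv v w : R := \sum_(i < k) v ord0 i * w ord0 i.

Lemma dotvC v w : dotv v w = dotv w v.
Proof. by apply: eq_bigr => i _; rewrite mulrC. Qed.

Lemma dotvDl u v w : dotv (u + v) w = dotv u w + dotv v w.
Proof. by rewrite -big_split; apply: eq_bigr => i _; rewrite mxE mulrDl. Qed.

Lemma dotvZl c v w : dotv (c *: v) w = c * dotv v w.
Proof. by rewrite mulr_sumr; apply: eq_bigr => i _; rewrite mxE mulrA. Qed.

Lemma dotvNl v w : dotv (- v) w = - dotv v w.
Proof. by rewrite -scaleN1r dotvZl mulN1r. Qed.

Lemma dotvv_ge0 v : 0 <= dotv v v.
Proof. by apply: sumr_ge0 => i _; rewrite -expr2 sqr_ge0. Qed.

Lemma enorm_ge0 v : 0 <= enorm v.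
Proof. exact: sqrtr_ge0. Qed.

Lemma enorm_sqr v : enorm v ^+ 2 = dotv v v.
Proof.
rewrite sqr_sqrtr; last by apply: sumr_ge0 => i _; exact: sqr_ge0.
by apply: eq_bigr => i _; rewrite expr2.
Qed.

(** Cauchy-Schwarz, from the nonnegativity of the square of [enorm w *: v - enorm v *: w]. The
    argument divides by both norms, so the zero cases are treated apart. *)
Lemma dotv_le v w : dotv v w <= enorm v * enorm w.
Proof.
have [w0|w0] := eqVneq (enorm w) 0.
  have wi i : w ord0 i = 0.
    have := enorm_sqr w; rewrite w0 expr0n/= => /esym/eqP.
    rewrite psumr_eq0 => [/allP/(_ i)|j _]; last by rewrite -expr2 sqr_ge0.
    by rewrite mem_index_enum => /(_ isT); rewrite /= mulf_eq0 orbb => /eqP.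
  by rewrite w0 mulr0 /dotv big1// => i _; rewrite wi mulr0.
have wp : 0 < enorm w by rewrite lt_def w0 enorm_ge0.
have := dotvv_ge0 (enorm w *: v - enorm v *: w).
rewrite !(dotvDl, dotvNl, dotvZl) !(dotvC _ (_ - _)) !(dotvDl, dotvNl, dotvZl).
rewrite -!enorm_sqr (dotvC w v) => H.
have [v0|v0] := eqVneq (enorm v) 0.
  move: H; rewrite v0 !(mul0r, mulr0, subr0) expr0n/= !(mulr0, sub0r, oppr0) => _.
  have vi i : v ord0 i = 0.
    have := enorm_sqr v; rewrite v0 expr0n/= => /esym/eqP.
    rewrite psumr_eq0 => [/allP/(_ i)|j _]; last by rewrite -expr2 sqr_ge0.
    by rewrite mem_index_enum => /(_ isT); rewrite /= mulf_eq0 orbb => /eqP.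
  by rewrite /dotv big1// => i _; rewrite vi mul0r.
have vp : 0 < enorm v by rewrite lt_def v0 enorm_ge0.
have vw : 0 < enorm v * enorm w by rewrite mulr_gt0.
by rewrite -(ler_pM2l vw); nra.
Qed.

Lemma enormN v : enorm (- v) = enorm v.
Proof. by congr Num.sqrt; apply: eq_bigr => i _; rewrite mxE sqrrN. Qed.

Lemma enorm_distC v w : enorm (v - w) = enorm (w - v).
Proof. by rewrite -enormN opprB. Qed.

Lemma enorm0 : enorm (0 : 'rV[R]_k) = 0.
Proof. by rewrite /enorm big1 ?sqrtr0// => i _; rewrite mxE expr0n. Qed.

Lemma enormD v w : enorm (v + w) <= enorm v + enorm w.
Proof.
rewrite -ler_sqr ?nnegrE ?addr_ge0 ?enorm_ge0//.
rewrite enorm_sqr sqrrD dotvDl !(dotvC _ (_ + _)) !dotvDl -!enorm_sqr (dotvC w v).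
by have := dotv_le v w; lra.
Qed.

Lemma enormB u v w : enorm (u - w) <= enorm (u - v) + enorm (v - w).
Proof. by apply: le_trans (enormD _ _); rewrite addrA subrK. Qed.

Lemma enormB3 u v w z :
  enorm (u - z) <= enorm (u - v) + enorm (v - w) + enorm (w - z).
Proof. by rewrite (le_trans (enormB u w z))// lerD2r enormB. Qed.

Lemma enormZ c v : enorm (c *: v) = `|c| * enorm v.
Proof.
rewrite /enorm -sqrtr_sqr -sqrtrM ?sqr_ge0//; congr Num.sqrt.
by rewrite mulr_sumr; apply: eq_bigr => i _; rewrite mxE exprMn.
Qed.

Lemma enorm_coord v i : `|v ord0 i| <= enorm v.
Proof.
rewrite -ler_sqr ?nnegrE ?enorm_ge0// real_normK ?num_real// enorm_sqr /dotv.
rewrite (bigD1 i)//= -expr2 lerDl; apply: sumr_ge0 => j _.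
by rewrite -expr2 sqr_ge0.
Qed.

Lemma norm_le_enorm v : `|v| <= enorm v.
Proof.
rewrite [leLHS]/Num.Def.normr/= mx_normrE; apply: bigmax_le => [|[i j] _].
  exact: enorm_ge0.
by rewrite /= (ord1 i); exact: enorm_coord.
Qed.

Lemma coord_le_norm v i : `|v ord0 i| <= `|v|.
Proof.
by rewrite [leRHS]/Num.Def.normr/= mx_normrE; apply: le_trans (le_bigmax _ _ (ord0, i)).
Qed.

Lemma enorm_le_sum v : enorm v <= \sum_(i < k) `|v ord0 i|.
Proof.
have S0 : 0 <= \sum_(i < k) `|v ord0 i| by apply: sumr_ge0 => i _.
rewrite -ler_sqr ?nnegrE ?enorm_ge0// enorm_sqr expr2 mulr_suml; apply: ler_sum => i _.
rewrite (le_trans (ler_norm _))// normrM ler_wpM2l// (bigD1 i)//= lerDl.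
by apply: sumr_ge0 => j _.
Qed.

Lemma enorm_le_norm v : enorm v <= k%:R * `|v|.
Proof.
apply: le_trans (enorm_le_sum v) _.
apply: le_trans (_ : \sum_(i < k) `|v| <= _).
  by apply: ler_sum => i _; exact: coord_le_norm.
by rewrite sumr_const card_ord mulr_natl.
Qed.

Lemma enorm_eq0 v : enorm v = 0 -> v = 0.
Proof.
by move=> v0; apply/eqP; rewrite -normr_eq0 eq_le normr_ge0 andbT -v0 norm_le_enorm.
Qed.

Lemma dist_enorm v w : `|enorm v - enorm w| <= enorm (v - w).
Proof.
rewrite ler_norml; apply/andP; split.
  rewrite lerBrDl lerBlDr; have := enormD (w - v) v.
  by rewrite subrK enorm_distC; lra.
by rewrite lerBlDr; have := enormD (v - w) w; rewrite subrK.
Qed.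

(** The topology comes from the sup norm; as the two norms are equivalent, convergence can be tested
    with [enorm]. *)
Lemma enorm_cvgP (T : Type) (F : set_system T) {FF : Filter F}
    (f : T -> 'rV[R]_k) (l : 'rV[R]_k) :
  f x @[x --> F] --> l <->
  forall e : R, 0 < e -> \forall x \near F, enorm (f x - l) < e.
Proof.
split=> [/cvgr_dist_lt fl e e0|fl].
  (* [k.+1] instead of [k] keeps the denominator nonzero in dimension 0. *)
  have ke : 0 < e / k.+1%:R by rewrite divr_gt0.
  near=> x; rewrite enorm_distC; apply: le_lt_trans (enorm_le_norm _) _.
  have h : `|l - f x| < e / k.+1%:R by near: x; exact: fl.
  apply: le_lt_trans (_ : k.+1%:R * `|l - f x| < _).
    by rewrite ler_wpM2r// ler_nat.
  by rewrite mulrC -ltr_pdivlMr.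
apply/cvgrPdist_lt => e e0; near=> x.
apply: le_lt_trans (norm_le_enorm _) _; rewrite enorm_distC.
by near: x; exact: fl.
Unshelve. all: by end_near. Qed.

Lemma nbhs_enormP (v : 'rV[R]_k) (A : set 'rV[R]_k) :
  nbhs v A <-> exists2 e : R, 0 < e & forall w, enorm (w - v) < e -> A w.
Proof.
split=> [|[e e0 eA]].
  move=> /nbhs_ballP[e e0 eA]; exists e => // w h; apply: eA.
  rewrite -ball_normE /ball_/=; apply: le_lt_trans (norm_le_enorm _) _.
  by rewrite enorm_distC.
have /enorm_cvgP/(_ e e0) : id x @[x --> v] --> v by exact: cvg_id.
by apply: filterS => w; exact: eA.
Qed.

Lemma enorm_continuous : continuous (@enorm R k).
Proof.
move=> v A /nbhs_ballP[e /= e0 eA]; apply/nbhs_enormP; exists e => // w h; apply: eA.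
by apply: le_lt_trans (dist_enorm _ _) _; rewrite enorm_distC.
Qed.

Lemma bounded_enorm (A : set 'rV[R]_k) (M : R) :
  (forall v, A v -> enorm v <= M) -> bounded_set A.
Proof.
move=> AM; exists M; split; first exact: num_real.
by move=> x Mx v Av; apply: le_trans (norm_le_enorm _) _; apply: le_trans (ltW Mx); exact: AM.
Qed.

Lemma bounded_setP (A : set 'rV[R]_k) :
  bounded_set A -> exists2 M : R, 0 < M & forall v, A v -> enorm v <= M.
Proof.
move=> [M [Mr MA]]; exists (k%:R * (`|M| + 1) + 1).
  by rewrite ltr_wpDl// mulr_ge0// addr_ge0.
move=> v Av; apply: le_trans (enorm_le_norm _) _.
rewrite ler_wpDr// ler_wpM2l//; apply: MA => //.
by rewrite (le_lt_trans (ler_norm _))// ltrDl.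
Qed.

Lemma enorm_ball_compact (c : 'rV[R]_k) (r : R) : compact [set v | enorm (v - c) <= r].
Proof.
apply: bounded_closed_compact.
  apply: (@bounded_enorm _ (r + enorm c)) => v /= h.
  by have := enormD (v - c) c; rewrite subrK; lra.
apply: (@preimage_closed _ _ (fun v => enorm (v - c)) [set x | x <= r]) => [v|].
  move=> _ A /nbhs_ballP[e /= e0 eA]; apply/nbhs_enormP; exists e => // w h; apply: eA.
  apply: le_lt_trans (dist_enorm _ _) _.
  by rewrite opprB addrA subrK enorm_distC.
exact: closed_le.
Qed.

Lemma enorm_ball0_compact (r : R) : compact [set v : 'rV[R]_k | enorm v <= r].
Proof.
have := @enorm_ball_compact 0 r; congr compact; apply/funext => v /=.
by rewrite subr0.
Qed.

Lemma compact_enorm_bounded (K : set 'rV[R]_k) :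
  compact K -> exists2 M : R, 0 < M & forall v, K v -> enorm v <= M.
Proof. by move=> /compact_bounded; exact: bounded_setP. Qed.

End EuclideanNorm.

(** * Derivatives relative to a set *)

Section DerivWithin.
Context {R : realType}.

Lemma near_withinP (I : set R) (t : R) (P : set R) :
  (\forall s \near within I (nbhs t), P s) <->
  exists2 del : R, 0 < del & forall s, I s -> `|s - t| < del -> P s.
Proof.
split=> [/nbhs_ballP[del /= d0 H]|[del d0 H]].
  by exists del => // s Is sd; apply: H => //; rewrite /ball/= distrC.
apply/nbhs_ballP; exists del => // s; rewrite /ball/= distrC => sd Is.
exact: H.
Qed.

(** Multiplying out the quotient gives a form that is also meaningful at [s = t], so that
    restriction, difference and rescaling need no punctured neighbourhoods. *)
Lemma deriv_withinP (k : nat) (I : set R) (phi : R -> 'rV[R]_k) t v :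
  deriv_within I phi t v <->
  forall e : R, 0 < e -> exists2 del : R, 0 < del & forall s, I s -> `|s - t| < del ->
    enorm (phi s - phi t - (s - t) *: v) <= e * `|s - t|.
Proof.
have key s : s != t ->
    enorm ((s - t)^-1 *: (phi s - phi t) - v) =
    enorm (phi s - phi t - (s - t) *: v) / `|s - t|.
  move=> st; have st0 : s - t != 0 by rewrite subr_eq0.
  rewrite -[in LHS](scale1r v) -(mulVf st0) -scalerA -scalerBr enormZ.
  by rewrite normfV mulrC.
rewrite /deriv_within enorm_cvgP; split=> H e e0.
  have /nbhs_ballP[del /= del0 P] := H e e0.
  exists del => // s Is sd; have [->|st] := eqVneq s t.
    by rewrite !subrr scale0r subr0 enorm0 normr0 mulr0.
  have := P s; rewrite /ball/= distrC => /(_ sd)/(_ st)/(_ Is)/ltW.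
  by rewrite key// ler_pdivrMr// normr_gt0 subr_eq0.
have e2 : 0 < e / 2 by lra.
have [del del0 P] := H _ e2.
apply/nbhs_ballP; exists del => // s; rewrite /ball/= distrC => sd st Is.
rewrite key// ltr_pdivrMr ?normr_gt0 ?subr_eq0//.
apply: le_lt_trans (P _ Is sd) _; rewrite ltr_pM2r ?normr_gt0 ?subr_eq0//.
by rewrite ltr_pdivrMr//; lra.
Qed.

Lemma deriv_withinS (k : nat) (I J : set R) (phi : R -> 'rV[R]_k) t v :
  J `<=` I -> deriv_within I phi t v -> deriv_within J phi t v.
Proof.
move=> JI /deriv_withinP H; apply/deriv_withinP => e /H[del d0 P].
by exists del => // s /JI; exact: P.
Qed.

Lemma deriv_within_local (k : nat) (I J : set R) (phi psi : R -> 'rV[R]_k) t v r :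
  0 < r -> phi t = psi t ->
  (forall s, `|s - t| < r -> J s -> I s /\ phi s = psi s) ->
  deriv_within I phi t v -> deriv_within J psi t v.
Proof.
move=> r0 E H /deriv_withinP D; apply/deriv_withinP => e /D[del d0 P].
exists (Num.min del r); first by rewrite lt_min d0.
move=> s Js; rewrite lt_min => /andP[sd sr].
by have [Is <-] := H s sr Js; rewrite -E; exact: P.
Qed.

Lemma deriv_withinB (k : nat) (I : set R) (phi psi : R -> 'rV[R]_k) t v w :
  deriv_within I phi t v -> deriv_within I psi t w ->
  deriv_within I (fun s => phi s - psi s) t (v - w).
Proof.
move=> /deriv_withinP A /deriv_withinP B; apply/deriv_withinP => e e0.
have e20 : 0 < e / 2 by rewrite divr_gt0.
have [d1 d10 P1] := A _ e20; have [d2 d20 P2] := B _ e20.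
exists (Num.min d1 d2); first by rewrite lt_min d10.
move=> s Is; rewrite lt_min => /andP[/(P1 s Is) H1 /(P2 s Is) H2].
have -> : phi s - psi s - (phi t - psi t) - (s - t) *: (v - w) =
  (phi s - phi t - (s - t) *: v) - (psi s - psi t - (s - t) *: w).
  by rewrite scalerBr; apply/rowP => i; rewrite !mxE; ring.
apply: le_trans (enormD _ _) _; rewrite enormN; lra.
Qed.

Lemma deriv_within_scale (k : nat) (I J : set R) (phi : R -> 'rV[R]_k) (c s0 t : R) v :
  (forall s, J s -> I (c * s + s0)) ->
  deriv_within I phi (c * t + s0) v ->
  deriv_within J (fun s => phi (c * s + s0)) t (c *: v).
Proof.
move=> JI /deriv_withinP D; apply/deriv_withinP => e e0.
(* [|c| + 1] replaces [|c|], which may vanish. *)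
have c1 : 0 < `|c| + 1 by rewrite ltr_wpDl.
have [del d0 P] := D (e / (`|c| + 1)) (divr_gt0 e0 c1).
exists (del / (`|c| + 1)); first by rewrite divr_gt0.
move=> s Js sd.
have E : c * s + s0 - (c * t + s0) = c * (s - t) by ring.
have := P _ (JI _ Js); rewrite E normrM scalerA mulrC.
have h : `|c| * `|s - t| <= (`|c| + 1) * `|s - t| by rewrite ler_wpM2r// lerDl.
move=> /(_ _)/le_trans; rewrite (mulrC (s - t)); apply.
  by rewrite mulrC; apply: le_lt_trans h _; rewrite mulrC -ltr_pdivlMr.
by rewrite (mulrC `|s - t|) -mulrA ler_wpM2l ?(ltW e0)// ler_pdivrMl.
Qed.

Lemma deriv_within_shift (k : nat) (I J : set R) (phi : R -> 'rV[R]_k) (s0 t : R) v :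
  (forall s, J s -> I (s + s0)) ->
  deriv_within I phi (t + s0) v ->
  deriv_within J (fun s => phi (s + s0)) t v.
Proof.
move=> JI D; have := @deriv_within_scale k I J phi 1 s0 t v.
under eq_fun do rewrite mul1r; rewrite mul1r scale1r; apply=> // s /JI.
by rewrite mul1r.
Qed.

Lemma deriv_within_continuous (k : nat) (I : set R) (phi : R -> 'rV[R]_k) (dphi : R -> 'rV[R]_k) :
  (forall t, I t -> deriv_within I phi t (dphi t)) -> {within I, continuous phi}.
Proof.
move=> D; apply/subspace_continuousP => t It; apply/enorm_cvgP => e e0.
have /deriv_withinP/(_ 1 ltr01)[del d0 P] := D t It.
have c0 : 0 < 1 + enorm (dphi t) by rewrite ltr_wpDr// enorm_ge0.
apply/near_withinP.
exists (Num.min del (e / (1 + enorm (dphi t)))).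
  by rewrite lt_min d0 divr_gt0.
move=> s Is; rewrite lt_min => /andP[sd se].
have := P s Is sd; rewrite mul1r => h.
have := enormD (phi s - phi t - (s - t) *: dphi t) ((s - t) *: dphi t).
rewrite subrK enormZ => h2; apply: le_lt_trans h2 _.
rewrite ltr_pdivlMr// in se; nra.
Qed.

Lemma deriv_within_coord (k : nat) (I : set R) (phi : R -> 'rV[R]_k) t v i :
  nbhs t I -> deriv_within I phi t v ->
  is_derive t (1 : R) (fun s => phi s ord0 i) (v ord0 i).
Proof.
move=> tI /deriv_withinP D.
suff H : (fun h => h^-1 *: (phi (h *: (1:R) + t) ord0 i - phi t ord0 i)) @ 0^' --> v ord0 i.
  apply: DeriveDef; first by apply/cvg_ex; eexists; exact: H.
  by apply/cvg_lim => //; exact: Rhausdorff.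
apply/cvgrPdist_le => e e0.
have [del d0 P] := D e e0.
have /nbhs_ballP[r /= r0 rI] := tI.
apply/nbhs_ballP; exists (Num.min del r); first by rewrite /= lt_min d0.
move=> h; rewrite /ball/= sub0r normrN lt_min => /andP[hd hr] h0.
have E : h *: (1:R) + t - t = h by rewrite addrK /GRing.scale/= mulr1.
have Ih : I (h *: (1:R) + t) by apply: rI; rewrite /ball/= -opprB E normrN.
have := P _ Ih; rewrite E => /(_ hd).
move=> /(le_trans (enorm_coord _ i)).
rewrite !mxE -(@ler_pM2l _ (`|h|^-1)) ?invr_gt0 ?normr_gt0//.
rewrite -normfV -normrM mulrCA normfV mulVf ?normr_eq0// mulr1.
by rewrite mulrBr mulrA mulVf// mul1r distrC.
Qed.

Lemma coord_within_continuous (k : nat) (A : set R) (phi : R -> 'rV[R]_k) i :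
  {within A, continuous phi} -> {within A, continuous (fun s => phi s ord0 i)}.
Proof.
move=> /subspace_continuousP c; apply/subspace_continuousP => t At.
exact: cvg_comp (c t At) (@coord_continuous _ _ _ ord0 i (phi t)).
Qed.

Lemma ler0_increment (u du : R -> R) (a b : R) : a <= b ->
  {within `[a, b], continuous u} ->
  (forall t, a < t < b -> is_derive t (1 : R) u (du t) /\ du t <= 0) ->
  u b <= u a.
Proof.
move=> ab cu D.
apply: (@ler0_derive1_nincr _ u a b) => // x; rewrite in_itv/= => xab.
  by have [[]] := D x xab.
by have [[? E] ?] := D x xab; rewrite derive1E E.
Qed.

Lemma nbhs_itvcc (a b t : R) : a < t < b -> nbhs t `[a, b]%classic.
Proof.
move=> tab; have : `]a, b[%classic t by rewrite /= in_itv.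
by move=> /near_in_itvoo; apply: filterS => s; exact: subset_itv_oo_cc.
Qed.

(** The vector inequality becomes scalar by pairing the curve with the error vector [z] itself: by
    Cauchy-Schwarz [u] has a nonpositive derivative, and [u b <= u a] amounts to [enorm z ^+ 2 <=
    enorm z * (eta * (b - a))]. *)
Lemma mean_value_le (k : nat) (phi dphi : R -> 'rV[R]_k) (a b : R) w eta :
  a <= b -> (forall t, a <= t <= b -> deriv_within `[a, b] phi t (dphi t)) ->
  (forall t, a <= t <= b -> enorm (dphi t - w) <= eta) ->
  enorm (phi b - phi a - (b - a) *: w) <= eta * (b - a).
Proof.
move=> ab D B; set z := phi b - phi a - (b - a) *: w.
pose u t := dotv (phi t - t *: w) z - enorm z * eta * t.
have cphi : {within `[a, b], continuous phi}.
  apply: (@deriv_within_continuous _ _ _ dphi) => t.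
  by rewrite /= in_itv/=; exact: D.
have : u b <= u a.
  apply: (@ler0_increment u (fun t => dotv (dphi t - w) z - enorm z * eta)) => //.
    have -> : u = (fun t => (\sum_i (phi t ord0 i - t * w ord0 i) * z ord0 i)
                            - enorm z * eta * t).
      by apply/funext => t; congr (_ - _); apply: eq_bigr => i _; rewrite !mxE.
    apply/subspace_continuousP => t tab; apply: cvgB; last first.
      by apply: cvgM; [exact: cvg_cst|exact: cvg_within].
    apply: cvg_sumr => i _; apply: cvgM; last exact: cvg_cst.
    apply: cvgB; last by apply: cvgM; [exact: cvg_within|exact: cvg_cst].
    by move/subspace_continuousP: (@coord_within_continuous _ _ _ i cphi); exact.
  move=> t tab; have tab' : a <= t <= b by case/andP: tab => /ltW-> /ltW->.
  split; last first.
    by rewrite subr_le0 (le_trans (dotv_le _ _))// mulrC ler_wpM2l ?enorm_ge0// B.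
  rewrite /u.
  have Di i := deriv_within_coord i (nbhs_itvcc tab) (D t tab').
  have -> : (fun t => dotv (phi t - t *: w) z - enorm z * eta * t) =
     (\sum_i (fun t => (phi t ord0 i - t * w ord0 i) * z ord0 i))
        - (fun t => enorm z * eta * t).
    apply/funext => s; rewrite /= !fctE fct_sumE; congr (_ - _).
    by apply: eq_bigr => i _; rewrite !mxE.
  apply: is_deriveB; last first.
    have := is_deriveZ (enorm z * eta) (is_derive_id t (1:R)).
    by rewrite /GRing.scale/= mulr1.
  apply: is_derive_sum => i.
  have -> : (dphi t - w) ord0 i * z ord0 i = z ord0 i *: (dphi t ord0 i - w ord0 i).
    by rewrite /GRing.scale/= !mxE mulrC.
  have -> : (fun t => (phi t ord0 i - t * w ord0 i) * z ord0 i) =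
     z ord0 i *: ((fun t => phi t ord0 i) - w ord0 i *: id).
    by apply/funext => s; rewrite !fctE /GRing.scale/= mulrC (mulrC s).
  apply: is_deriveZ; apply: is_deriveB.
  have := is_deriveZ (w ord0 i) (is_derive_id t (1:R)).
  by rewrite /GRing.scale/= mulr1.
rewrite /u => H.
have E : dotv (phi b - b *: w) z - dotv (phi a - a *: w) z = enorm z ^+ 2.
  rewrite enorm_sqr -dotvNl -dotvDl; congr (dotv _ _).
  by rewrite /z scalerBl; apply/rowP => i; rewrite !mxE; ring.
have {}H : enorm z ^+ 2 <= enorm z * (eta * (b - a)) by lra.
have [z0|z0] := eqVneq (enorm z) 0.
  rewrite z0 mulr_ge0 ?subr_ge0//; apply: le_trans (enorm_ge0 _) (B a _).
  by rewrite lexx.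
by move: H; rewrite expr2 ler_pM2l// lt_def z0 enorm_ge0.
Qed.

(** Squares keep the norm differentiable at 0. Since 2<w, w'> is at most |w|^2 + |w'|^2, the
    hypothesis bounds the derivative of |w|^2 + B by A(|w|^2 + B); this is the origin of [A - 1]. *)
Lemma gronwall_sqr (k : nat) (w dw : R -> 'rV[R]_k) (a b A B : R) :
  a <= b -> (forall t, a <= t <= b -> deriv_within `[a, b] w t (dw t)) ->
  (forall t, a <= t <= b ->
     enorm (dw t) ^+ 2 <= (A - 1) * enorm (w t) ^+ 2 + A * B) ->
  enorm (w b) ^+ 2 + B <= (enorm (w a) ^+ 2 + B) * expR (A * (b - a)).
Proof.
move=> ab D H.
pose u t := (dotv (w t) (w t) + B) * expR (- A * (t - a)).
have cw : {within `[a, b], continuous w}.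
  apply: (@deriv_within_continuous _ _ _ dw) => t.
  by rewrite /= in_itv/=; exact: D.
have : u b <= u a.
  apply: (@ler0_increment u
    (fun t => (2 * dotv (w t) (dw t)) * expR (- A * (t - a))
              + (dotv (w t) (w t) + B) * (- A * expR (- A * (t - a))))) => //.
    apply/subspace_continuousP => t tab; apply: cvgM.
      apply: cvgD; last exact: cvg_cst.
      apply: cvg_sumr => i _; apply: cvgM;
        by move/subspace_continuousP: (@coord_within_continuous _ _ _ i cw); exact.
    have := @cvg_comp _ _ _ (fun s => - A * (s - a)) expR _ _ _ _ (@continuous_expR R (- A * (t - a))); apply.
    by apply: cvgM; [exact: cvg_cst|apply: cvgB; [exact: cvg_within|exact: cvg_cst]].
  move=> t tab; have tab' : a <= t <= b by case/andP: tab => /ltW-> /ltW->.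
  have Di i := deriv_within_coord i (nbhs_itvcc tab) (D t tab').
  split; last first.
    have := H t tab'; rewrite enorm_sqr => h.
    have e0 := expR_gt0 (- A * (t - a)).
    set ex := expR _ in e0 *.
    have -> : 2 * dotv (w t) (dw t) * ex + (dotv (w t) (w t) + B) * (- A * ex) =
      ex * (2 * dotv (w t) (dw t) - A * (dotv (w t) (w t) + B)) by ring.
    rewrite pmulr_rle0//.
    have := dotvv_ge0 (w t - dw t).
    rewrite !(dotvDl, dotvNl) !(dotvC _ (_ - _)) !(dotvDl, dotvNl) (dotvC (dw t) (w t)).
    by move: h; rewrite enorm_sqr; lra.
  rewrite /u.
  have Dq : is_derive t (1:R) (fun t => dotv (w t) (w t) + B) (2 * dotv (w t) (dw t)).
    have -> : (fun t => dotv (w t) (w t) + B) =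
      (\sum_i (fun t => w t ord0 i) * (fun t => w t ord0 i)) + cst B.
      by apply/funext => s; rewrite !fctE fct_sumE.
    rewrite -[X in is_derive _ _ _ X]addr0; apply: is_deriveD.
    rewrite mulr_sumr; apply: is_derive_sum => i.
    apply: is_derive_eq.
    by rewrite /GRing.scale/=; ring.
  have De : is_derive t (1:R) (fun t => expR (- A * (t - a))) (- A * expR (- A * (t - a))).
    have D1 : is_derive t (1:R) (fun t => - A * (t - a)) (- A).
      have -> : (fun t => - A * (t - a)) = (- A) *: (id - cst a) :> (R -> R) by [].
      by apply: is_derive_eq; rewrite subr0 /GRing.scale/= mulr1.
    have := @is_derive1_comp _ expR (fun t => - A * (t - a)) t _ _ (is_derive_expR _) D1.
    by rewrite mulrC.
  rewrite [X in is_derive _ _ _ X](_ : _ =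
      (dotv (w t) (w t) + B) *: (- A * expR (- A * (t - a)))
      + expR (- A * (t - a)) *: (2 * dotv (w t) (dw t))).
    exact: is_deriveM.
  by rewrite /GRing.scale/=; ring.
rewrite /u subrr mulr0 expR0 mulr1 -!enorm_sqr mulNr expRN.
by rewrite ler_pdivrMr ?expR_gt0.
Qed.

(** The supremum of the [t] such that [P] holds on [[a, t]] satisfies [P] by the closing hypothesis,
    and it cannot lie below [b] by the opening one. *)
Lemma real_induction (a b : R) (P : R -> Prop) : a <= b -> P a ->
  (forall t, a <= t < b -> (forall s, a <= s <= t -> P s) ->
     exists2 del : R, 0 < del & forall s, t < s < t + del -> s <= b -> P s) ->
  (forall t, a < t <= b -> (forall s, a <= s < t -> P s) -> P t) ->
  forall t, a <= t <= b -> P t.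
Proof.
move=> ab Pa step clos.
pose S := [set t | a <= t <= b /\ forall s, a <= s <= t -> P s].
have Sa : S a.
  split; first by rewrite lexx.
  by move=> s /andP[h1 h2]; have -> : s = a by apply/le_anti; rewrite h1 h2.
have Sub : ubound S b by move=> t [/andP[]].
have hS : has_sup S by split; [exists a|exists b].
pose c := sup S.
have ac : a <= c by apply: ub_le_sup => //; exists b.
have cb : c <= b by apply: ge_sup => //; exists a.
have Plt s : a <= s < c -> P s.
  move=> /andP[as_ sc].
  have sc0 : 0 < c - s by rewrite subr_gt0.
  have [t [_ Pt] st] := sup_adherent sc0 hS.
  by apply: Pt; rewrite as_/= ltW//; move: st; rewrite -/c subKr.
have Pc : P c.
  move: ac; rewrite le_eqVlt => /orP[/eqP <-//|ac].
  by apply: clos Plt; rewrite ac cb.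
have Ple s : a <= s <= c -> P s.
  move=> /andP[as_]; rewrite le_eqVlt => /orP[/eqP->//|sc].
  by apply: Plt; rewrite as_.
have [bc|cb'] := leP b c.
  by move=> t /andP[h1 h2]; apply: Ple; rewrite h1 (le_trans h2).
have [|del d0 Pd] := step c _ Ple; first by rewrite ac.
pose e := Num.min (c + del / 2) b.
have ce : c < e by rewrite lt_min cb' ltrDl divr_gt0.
have : S e.
  split; first by rewrite ge_min lexx orbT andbT (le_trans ac)// ltW.
  move=> s /andP[as_ se]; have [sc|cs] := leP s c; first by apply: Ple; rewrite as_.
  apply: Pd; first rewrite cs/=.
    by apply: le_lt_trans se _; rewrite gt_min; apply/orP; left; lra.
  by apply: le_trans se _; rewrite ge_min lexx orbT.
by move=> /(ub_le_sup (ex_intro _ b Sub)); rewrite leNgt ce.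
Qed.

(* The estimate is bootstrapped: [z] stays in the ball of radius [M + 1], where
   the Lipschitz bound is available, as long as it is [e]-close to [y]. *)
Lemma perturbation (k : nat) (y z dy dz : R -> 'rV[R]_k) (a b M L eta e : R) :
  a <= b -> e < 1 ->
  (forall t, a <= t <= b -> deriv_within `[a, b] y t (dy t)) ->
  (forall t, a <= t <= b -> deriv_within `[a, b] z t (dz t)) ->
  (forall t, a <= t <= b -> enorm (y t) <= M) ->
  (forall t, a <= t <= b -> enorm (z t) <= M + 1 ->
     enorm (dz t - dy t) <= L * enorm (z t - y t) + eta) ->
  (enorm (z a - y a) ^+ 2 + 2 * eta ^+ 2) * expR ((1 + 2 * L ^+ 2) * (b - a)) <= e ^+ 2 ->
  0 <= e ->
  forall t, a <= t <= b -> enorm (z t - y t) <= e.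
Proof.
move=> ab e1 Dy Dz yM H He e0.
have Dw t : a <= t <= b -> deriv_within `[a, b] (fun s => z s - y s) t (dz t - dy t).
  by move=> tab; apply: deriv_withinB; [exact: Dz|exact: Dy].
have A1 : 1 <= 1 + 2 * L ^+ 2 by rewrite lerDl mulr_ge0// sqr_ge0.
(* The estimate is first proved as long as [z] has stayed in the ball of radius [M + 1]. *)
have est c : a <= c <= b -> (forall t, a <= t <= c -> enorm (z t) <= M + 1) ->
    enorm (z c - y c) <= e.
  move=> /andP[ac cb] zM.
  have sub t : a <= t <= c -> a <= t <= b.
    by move=> /andP[-> /= tc]; exact: le_trans tc cb.
  have := @gronwall_sqr k (fun s => z s - y s) (fun s => dz s - dy s) a c
            (1 + 2 * L ^+ 2) (2 * eta ^+ 2) ac.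
  have D' t : a <= t <= c ->
      deriv_within `[a, c] (fun s => z s - y s) t (dz t - dy t).
    move=> tac; apply: deriv_withinS (Dw t (sub t tac)) => s.
    by rewrite /= !in_itv/=; exact: sub.
  move=> /(_ D') G.
  have {G} : enorm (z c - y c) ^+ 2 + 2 * eta ^+ 2 <=
     (enorm (z a - y a) ^+ 2 + 2 * eta ^+ 2) * expR ((1 + 2 * L ^+ 2) * (c - a)).
    apply: G => t tac; have := H t (sub t tac) (zM t tac).
    set D := enorm (dz t - dy t); set W := enorm (z t - y t) => h.
    have D0 : 0 <= D by exact: enorm_ge0.
    have h2 : D ^+ 2 <= (L * W + eta) ^+ 2 by rewrite ler_sqr// nnegrE// (le_trans D0).
    apply: le_trans h2 _.
    (* [p1] gives (L W + eta)^2 <= 2 L^2 W^2 + 2 eta^2, hence the rate [1 + 2 * L ^+ 2] and the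
       shift [2 * eta ^+ 2] passed to [gronwall_sqr]; [p2] covers the remaining product. *)
    have p1 : 0 <= (L * W - eta) ^+ 2 by exact: sqr_ge0.
    have p2 : 0 <= (L ^+ 2) * (eta ^+ 2) by rewrite mulr_ge0 ?sqr_ge0.
    by lra.
  move=> G; rewrite -ler_sqr ?nnegrE ?enorm_ge0//.
  apply: le_trans He; apply: le_trans (_ : enorm (z c - y c) ^+ 2 + 2 * eta ^+ 2 <= _).
    by rewrite lerDl mulr_ge0// sqr_ge0.
  apply: le_trans G _; rewrite ler_wpM2l//.
    by rewrite addr_ge0 ?sqr_ge0// mulr_ge0// sqr_ge0.
  by rewrite ler_expR ler_wpM2l ?(le_trans _ A1)// lerB.
have zM t : a <= t <= b -> enorm (z t - y t) <= 1 -> enorm (z t) <= M + 1.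
  move=> tab h; have := enormD (z t - y t) (y t); rewrite subrK.
  by have := yM t tab; lra.
have ea : enorm (z a - y a) <= e.
  rewrite -ler_sqr ?nnegrE ?enorm_ge0//; apply: le_trans He.
  apply: le_trans (_ : enorm (z a - y a) ^+ 2 + 2 * eta ^+ 2 <= _).
    by rewrite lerDl mulr_ge0// sqr_ge0.
  have eta0 : 0 <= 2 * eta ^+ 2 by rewrite mulr_ge0// sqr_ge0.
  rewrite ler_peMr ?addr_ge0 ?sqr_ge0//.
  apply: le_trans (expR_ge1Dx _); rewrite lerDl mulr_ge0 ?subr_ge0//.
  exact: le_trans A1.
have cont : {within `[a, b], continuous (fun s => z s - y s)}.
  apply: (@deriv_within_continuous _ _ _ (fun t => dz t - dy t)) => t.
  by rewrite /= in_itv/=; exact: Dw.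
move/subspace_continuousP in cont.
(* The bound extends to the right because [e < 1] leaves room inside the ball, so that [est] applies
   a little further; it passes to limits from the left by continuity. *)
apply: real_induction => // [t /andP[a_t tb] Pt|t /andP[a_t tb] Pt].
  have tab : a <= t <= b by rewrite a_t ltW.
  have /enorm_cvgP/(_ (1 - e)) := cont t (tab : `[a, b]%classic t).
  rewrite subr_gt0 => /(_ e1)/near_withinP[del d0 P].
  exists del => // s /andP[ts sd] sb; apply: est.
    by rewrite (le_trans a_t (ltW ts)) sb.
  move=> r /andP[ar rs]; apply: zM; first by rewrite ar (le_trans rs).
  have [rt|tr] := leP r t; first by rewrite (le_trans (Pt r _) (ltW e1))// ar.
  have rI : `[a, b]%classic r by rewrite /= in_itv/= ar (le_trans rs).
  have := P r rI.
  have -> : `|r - t| < del by rewrite gtr0_norm ?subr_gt0//; lra.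
  move=> /(_ isT) h.
  have := enormD (z r - y r - (z t - y t)) (z t - y t); rewrite subrK.
  by have := Pt t; rewrite a_t lexx => /(_ isT); lra.
have tab : a <= t <= b by rewrite tb ltW.
rewrite leNgt; apply/negP => et.
have /enorm_cvgP/(_ (enorm (z t - y t) - e)) := cont t (tab : `[a, b]%classic t).
rewrite subr_gt0 => /(_ et)/near_withinP[del d0 P].
pose s := Num.max a (t - del / 2).
have st : s < t by rewrite gt_max a_t/=; lra.
have as_ : a <= s by rewrite le_max lexx.
have sI : `[a, b]%classic s by rewrite /= in_itv/= as_ ltW// (lt_le_trans st).
have := P s sI.
have -> : `|s - t| < del.
  rewrite ltr0_norm ?subr_lt0//; have : t - del / 2 <= s by rewrite le_max lexx orbT.
  by lra.
move=> /(_ isT); rewrite enorm_distC => h.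
have := enormD (z t - y t - (z s - y s)) (z s - y s); rewrite subrK.
by have := Pt s; rewrite as_ st => /(_ isT); lra.
Qed.

End DerivWithin.

(* [lra] compares its atoms up to conversion, which is costly on norms. *)
Ltac elra :=
  repeat match goal with
  | H : context [expR _] |- _ => clear H
  end;
  repeat match goal with
  | H : is_true (_ <= _) |- _ => revert H
  | H : is_true (_ < _) |- _ => revert H
  end;
  repeat match goal with
  | |- context [enorm ?v] => let a := fresh "a" in set a := (enorm v); clearbody a
  end;
  intros; lra.

(** * Limits along ultrafilters *)

Section Ultralimits.

Lemma fmap_ultra (T U : Type) (f : T -> U) (F : set_system T) :
  UltraFilter F -> UltraFilter (f @ F).
Proof.
move=> FU; split; first exact: fmap_proper_filter.
move=> G GP FG; apply/seteqP; split=> // A GA.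
have [//|nA] := in_ultra_setVsetC (f @^-1` A) FU.
have /(filterI GA) : G (~` A) by exact: FG.
by rewrite setICr => /filter_not_empty.
Qed.

(** One ultrafilter serves all compact-valued families at once, so limits for a continuum of
    parameters need no extraction of subsequences. *)
Lemma ultra_compact_cvg (T : Type) (U : topologicalType) (F : set_system T)
    (f : T -> U) (A : set U) :
  UltraFilter F -> compact A -> (\forall x \near F, A (f x)) ->
  exists2 l, A l & f x @[x --> F] --> l.
Proof.
move=> FU; rewrite compact_ultra => /(_ _ (fmap_ultra f FU)) H FA.
by have [l [Al Hl]] := H FA; exists l.
Qed.

End Ultralimits.

(** * The hull in the compact-open topology *)

Section VfieldTopology.
Context {R : realType} {n m : nat}.
Implicit Types (h : vfield R n m) (p q : 'rV[R]_n * 'rV[R]_m * R).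

Lemma near_triple p (P : set ('rV[R]_n * 'rV[R]_m * R)) :
  (\forall q \near p, P q) <->
  exists2 e : R, 0 < e & forall q, enorm (q.1.1 - p.1.1) < e ->
    enorm (q.1.2 - p.1.2) < e -> `|q.2 - p.2| < e -> P q.
Proof.
case: p => -[x y] t; split; last first.
  move=> [e e0 H].
  exists ([set z : 'rV[R]_n * 'rV[R]_m | enorm (z.1 - x) < e /\ enorm (z.2 - y) < e],
    [set s : R | `|s - t| < e]); last first.
    by move=> [[x' y'] t'] [/= [? ?] ?]; exact: H.
  split=> /=; last first.
    by apply/nbhs_ballP; exists e => // s; rewrite /ball/= distrC.
  exists ([set x' | enorm (x' - x) < e], [set y' | enorm (y' - y) < e]); last first.
    by move=> [? ?] [].
  by split; apply/nbhs_enormP; exists e.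
move=> [[A B] [/= [[A1 A2] [/= NA1 NA2] sA] NB] sAB].
have /nbhs_enormP[e1 e10 H1] := NA1.
have /nbhs_enormP[e2 e20 H2] := NA2.
have /nbhs_ballP[e3 /= e30 H3] := NB.
exists (Num.min e1 (Num.min e2 e3)); first by rewrite !lt_min e10 e20.
move=> [[x' y'] t'] /=; rewrite !lt_min => /andP[xe _] /and3P[_ ye _] /and3P[_ _ te].
apply: sAB; split=> /=; last by apply: H3; rewrite /ball/= distrC.
by apply: sA; split=> /=; [exact: H1|exact: H2].
Qed.

(** Neighbourhoods of a continuous function in the compact-open topology are those of uniform
    convergence on compact sets. The nearby [h'] is arbitrary and may be discontinuous. *)
Lemma vfield_near h (K : set ('rV[R]_n * 'rV[R]_m * R)) (e : R) :
  continuous (h : _ -> 'rV[R]_m) -> compact K -> 0 < e ->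
  \forall h' \near h, forall p, K p -> enorm (h' p - h p) < e.
Proof.
move=> ch cK e0.
have [+ _] := @compact_open_fam_compactP _ _ (h : _ -> 'rV[R]_m) (nbhs h) ch _.
move=> /(_ (fun P H => H)) /fam_cvgP/(_ K cK) C.
have ke : 0 < e / m.+1%:R by rewrite divr_gt0.
have : nbhs h [set h' : vfield R n m | forall p, K p -> ball (h p) (e / m.+1%:R) (h' p)].
  apply: C; rewrite uniform_nbhs.
  exists [set xy | ball xy.1 (e / m.+1%:R) xy.2]; split => //.
  by rewrite -entourage_ballE; exists (e / m.+1%:R).
apply: filterS => h' H p Kp.
have := H p Kp; rewrite -ball_normE /ball_/= => hp.
rewrite enorm_distC; apply: le_lt_trans (enorm_le_norm _) _.
apply: le_lt_trans (_ : m.+1%:R * `|h p - h' p| < _).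
  by rewrite ler_wpM2r// ler_nat.
by rewrite mulrC -ltr_pdivlMr.
Qed.

Lemma vfield_cvg (F : set_system (vfield R n m)) {FF : Filter F} h :
  continuous (h : _ -> 'rV[R]_m) ->
  (forall K (e : R), compact K -> 0 < e ->
     \forall h' \near F, forall p, K p -> enorm (h' p - h p) < e) ->
  F --> h.
Proof.
move=> ch H.
apply/(@compact_open_fam_compactP _ _ (h : _ -> 'rV[R]_m) F ch _).
apply/fam_cvgP => K cK P /uniform_nbhs[E [+ HE]].
rewrite -entourage_ballE => -[e /= e0 eE].
apply: filterS (H K e cK e0) => h' Hh'.
apply: HE => p Kp; apply: eE; rewrite /= -ball_normE /ball_/=.
by rewrite distrC; apply: le_lt_trans (norm_le_enorm _) (Hh' p Kp).
Qed.

Lemma vfield_eval_continuous p : continuous (fun h : vfield R n m => h p).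
Proof.
move=> h A; rewrite nbhsE => -[V [oV Vh] VA].
have : open_nbhs h [set h' : vfield R n m | (h' : _ -> 'rV[R]_m) @` [set p] `<=` V].
  split; last by move=> _ [_ -> <-].
  by apply: compact_open_open => //; exact: compact_set1.
move/open_nbhs_nbhs; apply: filterS => h' Hh'; apply: VA; apply: Hh'.
by exists p.
Qed.

Lemma vfield_hausdorff : hausdorff_space (vfield R n m).
Proof.
move=> h h' cl; apply/funext => p.
apply: (@norm_hausdorff _ 'rV[R]_m) => A B Ah Bh'.
have [k [/= Ak Bk]] := cl _ _ (vfield_eval_continuous Ah) (vfield_eval_continuous Bh').
by exists (k p).
Qed.

Lemma prod_hausdorff (S T : topologicalType) :
  hausdorff_space S -> hausdorff_space T -> hausdorff_space (S * T)%type.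
Proof.
move=> hS hT [s t] [s' t'] cl; congr (_, _).
  apply: hS => A B As Bs'.
  have := cl (A `*` setT) (B `*` setT); case.
  - by exists (A, setT) => //; split=> //; exact: filterT.
  - by exists (B, setT) => //; split=> //; exact: filterT.
  by move=> [u v] [[/= ? _] [/= ? _]]; exists u.
apply: hT => A B At Bt'.
have := cl (setT `*` A) (setT `*` B); case.
- by exists (setT, A) => //; split=> //; exact: filterT.
- by exists (setT, B) => //; split=> //; exact: filterT.
by move=> [u v] [[/= _ ?] [/= _ ?]]; exists v.
Qed.

Definition box (r T : R) : set ('rV[R]_n * 'rV[R]_m * R) :=
  [set p | [/\ enorm p.1.1 <= r, enorm p.1.2 <= r & `|p.2| <= T]].

Lemma box_compact r T : compact (box r T).
Proof.
have -> : box r T = (([set v | enorm v <= r] `*` [set v | enorm v <= r]) `*` `[- T, T]%classic).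
  apply/seteqP; split=> [[[x y] t] [/= ? ?]|[[x y] t] [[/= ? ?]]]; rewrite /= in_itv/=.
    by rewrite ler_norml.
  by rewrite -ler_norml.
apply: compact_setX; last exact: segment_compact.
by apply: compact_setX; exact: enorm_ball0_compact.
Qed.

Lemma compact_box (K : set ('rV[R]_n * 'rV[R]_m * R)) :
  compact K -> exists r : R, 0 < r /\ K `<=` box r r.
Proof.
move=> cK.
have c1 : continuous (fun p : 'rV[R]_n * 'rV[R]_m * R => p.1.1).
  by move=> p; apply: cvg_comp; exact: cvg_fst.
have c2 : continuous (fun p : 'rV[R]_n * 'rV[R]_m * R => p.1.2).
  by move=> p; apply: cvg_comp; [exact: cvg_fst|exact: cvg_snd].
have c3 : continuous (fun p : 'rV[R]_n * 'rV[R]_m * R => p.2).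
  by move=> p; exact: cvg_snd.
have /compact_enorm_bounded[r1 r10 H1] := continuous_compact (continuous_subspaceT c1) cK.
have /compact_enorm_bounded[r2 r20 H2] := continuous_compact (continuous_subspaceT c2) cK.
have /compact_bounded[r3 [_ H3]] := continuous_compact (continuous_subspaceT c3) cK.
exists (Num.max r1 (Num.max r2 (`|r3| + 1))); split; first by rewrite lt_max r10.
move=> p Kp; split; rewrite !le_max.
- by rewrite H1//; exists p.
- by rewrite H2 ?orbT//; exists p.
- rewrite (H3 (`|r3| + 1)) ?orbT//; last by exists p.
  by rewrite (le_lt_trans (ler_norm _))// ltrDl.
Qed.

Lemma tshiftD h (s t : R) : tshift (tshift h s) t = tshift h (s + t).
Proof. by apply/funext => p; rewrite /tshift/= -addrA (addrC t). Qed.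

Lemma tshift0 h : tshift h 0 = h.
Proof. by apply/funext => -[p t]; rewrite /tshift/= addr0. Qed.

End VfieldTopology.

Section Hull.
Context {R : realType} {n m : nat} (g : vfield R n m).
Hypotheses (hadm : admissible g) (hlip : lipschitz_in_y g).
Implicit Types (h : vfield R n m) (p q : 'rV[R]_n * 'rV[R]_m * R).

Lemma ball_setX_compact (r : R) :
  compact ([set v | enorm v <= r] `*` [set v | enorm v <= r] : set ('rV[R]_n * 'rV[R]_m)).
Proof. by apply: compact_setX; exact: enorm_ball0_compact. Qed.

Lemma admissible_continuous : continuous (g : _ -> 'rV[R]_m).
Proof.
move=> p; apply/enorm_cvgP => e e0.
have [_ /(_ e e0)[del d0 H]] := hadm (@ball_setX_compact (enorm p.1.1 + enorm p.1.2 + 1)).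
apply/near_triple; exists (Num.min del 1); first by rewrite lt_min d0/=.
move=> q; rewrite !lt_min => /andP[xd x1] /andP[yd y1] /andP[td _].
have nx := enorm_ge0 p.1.1; have ny := enorm_ge0 p.1.2.
case: p q xd x1 yd y1 td nx ny H => -[x y] t [[x' y'] t'] /= xd x1 yd y1 td nx ny H.
apply: H => //=; last by split=> /=; lra.
have := enormD (x' - x) x; have := enormD (y' - y) y; rewrite !subrK.
by split=> /=; lra.
Qed.

(** Covers at once the hull, the closure of the forward translates, and the closures of the tails,
    whose intersection is the omega-limit set. *)
Definition hull_on (S : set R) : set (vfield R n m) :=
  [set h | continuous (h : _ -> 'rV[R]_m) /\ closure [set tshift g s | s in S] h].

Lemma hull_onS (S S' : set R) : S `<=` S' -> hull_on S `<=` hull_on S'.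
Proof.
move=> SS' h [ch clh]; split => //; apply: closureS clh.
exact: image_subset.
Qed.

Lemma hull_onT : hull_on setT = hull g.
Proof. by []. Qed.

Lemma hull_on_approx S h K (e : R) : hull_on S h -> compact K -> 0 < e ->
  exists2 s, S s & forall p, K p -> enorm (tshift g s p - h p) < e.
Proof.
move=> [ch clh] cK e0.
have [_ [[s Ss <-] H]] := clh _ (vfield_near ch cK e0).
by exists s.
Qed.

Lemma tshift_vfield_continuous h s :
  continuous (h : _ -> 'rV[R]_m) -> continuous (tshift h s : _ -> 'rV[R]_m).
Proof.
move=> ch p; apply/enorm_cvgP => e e0.
have /enorm_cvgP/(_ e e0)/near_triple[del d0 H] := ch (p.1, p.2 + s).
apply/near_triple; exists del => // q a b c; apply: H => //=.
by rewrite opprD addrACA subrr addr0.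
Qed.

Lemma hull_on_tshift S s : S s -> hull_on S (tshift g s).
Proof.
move=> Ss; split; first exact/tshift_vfield_continuous/admissible_continuous.
by apply: subset_closure; exists s.
Qed.

Lemma pair_compact p q : compact [set p; q].
Proof. by apply: compactU; exact: compact_set1. Qed.

(** An estimate on [g] that is uniform in time passes to the hull: it involves one or two points, at
    which some translate of [g] is as close to [h] as desired. The next two lemmas use the same
    device. *)
Lemma hull_bounded (r : R) : exists2 C, 0 < C &
  forall h x y t, hull g h -> enorm x <= r -> enorm y <= r -> enorm (h (x, y, t)) <= C.
Proof.
have [[C HC] _] := hadm (@ball_setX_compact r).
exists (`|C| + 1); first by rewrite ltr_wpDl.
move=> h x y t; rewrite -hull_onT => Hh xr yr.
have [s _ H] := hull_on_approx Hh (@compact_set1 _ (x, y, t)) (@ltr01 R).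
have := H _ erefl; rewrite enorm_distC => h1.
have := enormD (h (x, y, t) - tshift g s (x, y, t)) (tshift g s (x, y, t)).
rewrite subrK => h2; have := HC (x, y) (t + s); rewrite /tshift/= in h1 h2 *.
by move=> /(_ (conj xr yr)) h3; have := ler_norm C; lra.
Qed.

Lemma hull_uniform_continuous (r e : R) : 0 < e -> exists2 del : R, 0 < del &
  forall h x y t x' y' t', hull g h ->
    enorm x <= r -> enorm y <= r -> enorm x' <= r -> enorm y' <= r ->
    enorm (x - x') < del -> enorm (y - y') < del -> `|t - t'| < del ->
    enorm (h (x, y, t) - h (x', y', t')) <= e.
Proof.
move=> e0; have e3 : 0 < e / 3 by lra.
have [_ /(_ _ e3)[del d0 H]] := hadm (@ball_setX_compact r).
exists del => // h x y t x' y' t' + xr yr xr' yr' xd yd td; rewrite -hull_onT => Hh.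
have [s _ Hs] := hull_on_approx Hh (@pair_compact (x, y, t) (x', y', t')) e3.
have h1 := Hs (x, y, t) (or_introl erefl); have h2 := Hs (x', y', t') (or_intror erefl).
have h3 := H (x, y) (x', y') (t + s) (t' + s) (conj xr yr) (conj xr' yr') xd yd.
have {}h3 : enorm (g (x, y, t + s) - g (x', y', t' + s)) < e / 3.
  by apply: h3; rewrite opprD addrACA subrr addr0.
rewrite /tshift/= in h1 h2.
have := enormB (h (x, y, t)) (g (x, y, t + s)) (h (x', y', t')).
have := enormB (g (x, y, t + s)) (g (x', y', t' + s)) (h (x', y', t')).
by rewrite enorm_distC in h1; lra.
Qed.

Lemma hull_lipschitz (r : R) : exists2 L, 0 < L &
  forall h x y y' t, hull g h -> enorm x <= r -> enorm y <= r -> enorm y' <= r ->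
    enorm (h (x, y, t) - h (x, y', t)) <= L * enorm (y - y').
Proof.
have [L HL] := hlip (@enorm_ball0_compact _ _ r) (@enorm_ball0_compact _ _ r).
exists (`|L| + 1); first by rewrite ltr_wpDl.
move=> h x y y' t; rewrite -hull_onT => Hh xr yr yr'.
rewrite -[leRHS]addr0; apply/ler_addgt0Pr => e e0; rewrite addr0.
have e2 : 0 < e / 2 by lra.
have [s _ Hs] := hull_on_approx Hh (@pair_compact (x, y, t) (x, y', t)) e2.
have h1 := Hs (x, y, t) (or_introl erefl); have h2 := Hs (x, y', t) (or_intror erefl).
rewrite /tshift/= in h1 h2.
have h3 := HL x y y' (t + s) xr yr yr'.
have h4 : L * enorm (y - y') <= (`|L| + 1) * enorm (y - y').
  by rewrite ler_wpM2r ?enorm_ge0//; have := ler_norm L; lra.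
have := enormB (h (x, y, t)) (g (x, y, t + s)) (h (x, y', t)).
have := enormB (g (x, y, t + s)) (g (x, y', t + s)) (h (x, y', t)).
by rewrite enorm_distC in h1; lra.
Qed.

(** Arzela-Ascoli along an ultrafilter: boundedness gives pointwise limits, and the common modulus
    of continuity makes the limit continuous and the convergence uniform on compact sets. *)
Lemma hull_on_compact S : compact (hull_on S).
Proof.
rewrite compact_ultra => F FU FS.
have FT : F (hull g) by apply: filterS FS; rewrite -hull_onT; exact: hull_onS.
have ptw p : exists v : 'rV[R]_m, (fun h : vfield R n m => h p) @ F --> v.
  have [C C0 HC] := hull_bounded (enorm p.1.1 + enorm p.1.2).
  have [|v _ Hv] := @ultra_compact_cvg _ _ F (fun h : vfield R n m => h p) _ FU
    (@enorm_ball0_compact R m C); last by exists v.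
  apply: (@filterS _ F _ (hull g)) FT => h Hh.
  have := HC h p.1.1 p.1.2 p.2 Hh; rewrite -!surjective_pairing; apply.
    by rewrite lerDl enorm_ge0.
  by rewrite lerDr enorm_ge0.
have [h Hh] := choice ptw.
have unif (r e : R) : 0 < e -> exists2 del : R, 0 < del &
  forall x y t x' y' t',
    enorm x <= r -> enorm y <= r -> enorm x' <= r -> enorm y' <= r ->
    enorm (x - x') < del -> enorm (y - y') < del -> `|t - t'| < del ->
    enorm (h (x, y, t) - h (x', y', t')) <= e.
  move=> e0; have e3 : 0 < e / 3 by lra.
  have [del d0 H] := hull_uniform_continuous r e3.
  exists del => // x y t x' y' t' xr yr xr' yr' xd yd td.
  have /enorm_cvgP/(_ _ e3) N1 := Hh (x, y, t).
  have /enorm_cvgP/(_ _ e3) N2 := Hh (x', y', t').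
  have [k [[N1k N2k] Hk]] := filter_ex (filterI (filterI N1 N2) FT).
  have := H k x y t x' y' t' Hk xr yr xr' yr' xd yd td.
  have := enormB (h (x, y, t)) (k (x, y, t)) (h (x', y', t')).
  have := enormB (k (x, y, t)) (k (x', y', t')) (h (x', y', t')).
  by move: N1k N2k => /=; rewrite (enorm_distC (k _)); lra.
have ch : continuous (h : _ -> 'rV[R]_m).
  move=> p; apply/enorm_cvgP => e e0; have e2 : 0 < e / 2 by lra.
  have [del d0 H] := unif (enorm p.1.1 + enorm p.1.2 + 1) _ e2.
  apply/near_triple; exists (Num.min del 1); first by rewrite lt_min d0/=.
  move=> q; rewrite !lt_min => /andP[xd x1] /andP[yd y1] /andP[td _].
  have nx := enorm_ge0 p.1.1; have ny := enorm_ge0 p.1.2.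
  case: p q xd x1 yd y1 td nx ny H => -[x y] t [[x' y'] t'] /= xd x1 yd y1 td nx ny H.
  have := enormD (x' - x) x; have := enormD (y' - y) y; rewrite !subrK => hy hx.
  apply: le_lt_trans (H x' y' t' x y t _ _ _ _ xd yd td) _; lra.
have Fh : F --> (h : vfield R n m).
  apply: vfield_cvg => // K e cK e0.
  have e3 : 0 < e / 4 by lra.
  have [r [r0 Kr]] := compact_box cK.
  have [d1 d10 H1] := unif r _ e3.
  have [d2 d20 H2] := hull_uniform_continuous r e3.
  have /compact_near_coveringP/near_covering_withinP Kc := cK.
  apply: (Kc _ F (fun h' p => enorm (h' p - h p) < e)) => p Kp.
  have Np : \forall q \near p, enorm (q.1.1 - p.1.1) < Num.min d1 d2 /\
      enorm (q.1.2 - p.1.2) < Num.min d1 d2 /\ `|q.2 - p.2| < Num.min d1 d2.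
    by apply/near_triple; exists (Num.min d1 d2) => //; rewrite lt_min d10.
  have /enorm_cvgP/(_ _ e3) N1 := Hh p.
  exists ([set q | enorm (q.1.1 - p.1.1) < Num.min d1 d2 /\
      enorm (q.1.2 - p.1.2) < Num.min d1 d2 /\ `|q.2 - p.2| < Num.min d1 d2],
     [set k | hull g k /\ enorm (k p - h p) < e / 4]).
    by split => //; exact: filterI.
  move=> [q k] [/= [qx [qy qt]] [Hk kp]] Kq; move: qx qy qt; rewrite !lt_min.
  have [] := Kr p Kp; have [] := Kr q Kq; move: q p Kq Kp kp {Np N1} => [[x' y'] t'] [[x y] t] /=.
  move=> Kq Kp kp a1 a2 a3 b1 b2 b3 /andP[c1 c2] /andP[c3 c4] /andP[c5 c6].
  have A1 := H1 _ _ _ _ _ _ a1 a2 b1 b2 c1 c3 c5.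
  have A2 := H2 k _ _ _ _ _ _ Hk a1 a2 b1 b2 c2 c4 c6.
  have := enormB (k (x', y', t')) (k (x, y, t)) (h (x', y', t')).
  have := enormB (k (x, y, t)) (h (x, y, t)) (h (x', y', t')).
  by move: A1; rewrite enorm_distC; lra.
exists h; split=> //; split=> //.
apply: (@closed_cvg _ _ F _ id _ (@closed_closure _ _) _ _ Fh).
by apply: filterS FS => k [].
Qed.

(** Shifting moves the time argument, so [h'] must be close to [h] on a longer time box; uniform
    continuity of [h] accounts for the difference of the shifts. *)
Lemma tshift_near h s K (e : R) : hull g h -> compact K -> 0 < e ->
  \forall h' \near h & s' \near s, forall p, K p ->
    enorm (tshift h' s' p - tshift h s p) < e.
Proof.
move=> Hh cK e0; have e2 : 0 < e / 3 by lra.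
have [r [r0 Kr]] := compact_box cK.
have [del d0 H] := hull_uniform_continuous r e2.
have N := vfield_near Hh.1 (@box_compact _ _ _ r (r + `|s| + 1)) e2.
exists ([set h' | forall p, box r (r + `|s| + 1) p -> enorm (h' p - h p) < e / 3],
  [set s' | `|s' - s| < Num.min del 1]).
  split => //; apply/nbhs_ballP; exists (Num.min del 1) => /=.
    by rewrite lt_min d0/=.
  by move=> s'; rewrite /ball/= distrC.
move=> [h' s'] /= [Hh' ]; rewrite lt_min => /andP[sd s1] [[x y] t] Kp; rewrite /tshift/=.
have [/= xr yr tr] := Kr _ Kp.
have b1 : `|t + s'| <= r + `|s| + 1.
  have := ler_normD (s' - s) s; rewrite subrK; have := ler_normD t s'; lra.
have h1 := Hh' (x, y, t + s') (And3 xr yr b1).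
have h2 : enorm (h (x, y, t + s') - h (x, y, t + s)) <= e / 3.
  apply: H => //; rewrite ?subrr ?enorm0//.
  by rewrite (_ : t + s' - (t + s) = s' - s)//; ring.
by have := enormB (h' (x, y, t + s')) (h (x, y, t + s')) (h (x, y, t + s)); lra.
Qed.

Lemma tshift_cvg (T : Type) (F : set_system T) {FF : Filter F}
    (hF : T -> vfield R n m) (sF : T -> R) h s :
  hull g h -> hF i @[i --> F] --> h -> sF i @[i --> F] --> s ->
  tshift (hF i) (sF i) @[i --> F] --> tshift h s.
Proof.
move=> Hh hFh sFs; apply: vfield_cvg.
  exact/tshift_vfield_continuous/Hh.1.
move=> K e cK e0.
have [[A B] [/= Ah Bs] AB] := tshift_near s Hh cK e0.
have NA : F (hF @^-1` A) := hFh _ Ah; have NB : F (sF @^-1` B) := sFs _ Bs.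
suff : F (fun i => forall p, K p -> enorm (tshift (hF i) (sF i) p - tshift h s p) < e) by [].
by apply: filterS (filterI NA NB) => i [Ai Bi]; exact: (AB (hF i, sF i)).
Qed.

Lemma hull_on_shift S S' h s : hull g h -> (forall t, S t -> S' (t + s)) ->
  hull_on S h -> hull_on S' (tshift h s).
Proof.
move=> Hh SS' [ch clh]; split; first exact: tshift_vfield_continuous.
move=> A NA.
have C : tshift k s @[k --> h] --> tshift h s by apply: (@tshift_cvg _ (nbhs h) _ id (fun=> s) h s) => //; exact: cvg_cst.
have N := C A NA.
have [_ [[t St <-] /= At]] := clh _ N.
exists (tshift (tshift g t) s); split => //; rewrite tshiftD.
by exists (t + s) => //; exact: SS'.
Qed.

Lemma hull_on_hull S : hull_on S `<=` hull g.
Proof. by rewrite -hull_onT; exact: hull_onS. Qed.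

Section WithMetric.
Variable d : vfield R n m -> vfield R n m -> R.
Hypothesis hd : metrizes (hull g) d.

Lemma metrizes_near h (e : R) : hull g h -> 0 < e ->
  \forall k \near h, hull g k -> d h k < e.
Proof.
move=> Hh e0; case: hd => _ _ _ /(_ h Hh [set k | d h k < e]) [_ H].
by apply: H; exists e.
Qed.

Lemma omega_limitP h :
  omega_limit g h <-> forall N : R, hull_on [set s | N <= s] h.
Proof.
split=> [[[ch clh] [tau tauoo tauh]] N|H].
  split => // A /tauh NA.
  have : \forall k \near \oo, N <= tau k by move/cvgryPge/(_ N): tauoo.
  have {}NA : \forall k \near \oo, A (tshift g (tau k)) := NA.
  move=> /(filterI NA) /filter_ex[k [Ak Nk]].
  by exists (tshift g (tau k)); split => //; exists (tau k).
have Hh : hull g h := hull_on_hull (H 0).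
split => //.
have pick (k : nat) : exists s, k%:R <= s /\ d h (tshift g s) < k.+1%:R^-1.
  have N := metrizes_near Hh (_ : 0 < k.+1%:R^-1 :> R).
  have [|_ [[s ks <-] Hs]] := (H k%:R).2 _ (N _); first by rewrite invr_gt0.
  exists s; split => //; apply: Hs; rewrite -hull_onT; exact: hull_on_tshift.
have [tau Htau] := choice pick.
exists tau.
  apply/cvgryPge => A; near=> k; apply: le_trans (Htau k).1.
  by near: k; exact: nbhs_infty_ger.
move=> A NA.
case: hd => _ _ _ /(_ h Hh A)[H1 _].
have [e e0 He] : exists2 e : R, 0 < e & forall k, hull g k -> d h k < e -> A k.
  by apply: H1; apply: filterS NA => k Ak _.
suff : \forall k \near \oo, A (tshift g (tau k)) by [].
near=> k; apply: He; first by rewrite -hull_onT; exact: hull_on_tshift.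
apply: lt_trans (Htau k).2 _; near: k.
exact: (near_infty_natSinv_lt (PosNum e0)).
Unshelve. all: by end_near. Qed.

(** Compact and forward invariant, and by [HplusP] made only of forward translates and omega-limits,
    which are the fields with globally defined solutions. *)
Definition Hplus : set (vfield R n m) := hull_on [set s | 0 <= s].

Lemma Hplus_hull : Hplus `<=` hull g.
Proof. exact: hull_on_hull. Qed.

Lemma Hplus_compact : compact Hplus.
Proof. exact: hull_on_compact. Qed.

Lemma omega_Hplus : omega_limit g `<=` Hplus.
Proof. by move=> h /omega_limitP/(_ 0). Qed.

Lemma Hplus_tshift h s : Hplus h -> 0 <= s -> Hplus (tshift h s).
Proof.
move=> Hh s0; apply: hull_on_shift (Hh); first exact: Hplus_hull.
by move=> t /= t0; rewrite addr_ge0.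
Qed.

Lemma Hplus_orbit s : 0 <= s -> Hplus (tshift g s).
Proof. exact: hull_on_tshift. Qed.

Lemma omega_tshift h s : omega_limit g h -> omega_limit g (tshift h s).
Proof.
move=> oh; apply/omega_limitP => N.
move/omega_limitP/(_ (N - s)) : (oh) => H.
by apply: hull_on_shift H => [|t /=]; [exact: oh.1|rewrite lerBlDr].
Qed.

Lemma omega_compact : compact (omega_limit g).
Proof.
apply: (@subclosed_compact _ _ Hplus); last exact: omega_Hplus; last exact: Hplus_compact.
have -> : omega_limit g = \bigcap_(N in [set: R]) hull_on [set s | N <= s].
  by apply/seteqP; split=> h; [move=> /omega_limitP H N _|move=> H; apply/omega_limitP => N; exact: H].
apply: closed_bigI => N _; apply: compact_closed; first exact: vfield_hausdorff.
exact: hull_on_compact.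
Qed.

Lemma omega_nonempty : omega_limit g !=set0.
Proof.
have [h [Hh clh]] : Hplus `&` cluster ((tshift g) @ (pinfty_nbhs R)) !=set0.
  apply: Hplus_compact; rewrite /fmap/= nbhs_filterE.
  near=> s; apply: Hplus_orbit; near: s; exact: nbhs_pinfty_ge.
exists h; apply/omega_limitP => N; split; first exact: Hh.1.
move=> A NA; have [|k []] := clh [set tshift g s | s in [set s | N <= s]] A _ NA.
  by rewrite /fmap/= nbhs_filterE; near=> s; exists s => //=; near: s; exact: nbhs_pinfty_ge.
by move=> ? ?; exists k.
Unshelve. all: by end_near. Qed.

(* A member of the closure that is not an omega-limit is a translate, because
   the translates by a compact time interval form a compact set. *)
Lemma HplusP h :
  Hplus h -> (exists2 s, 0 <= s & h = tshift g s) \/ omega_limit g h.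
Proof.
move=> Hh; have [|/omega_limitP/existsNP[N nN]] := pselect (omega_limit g h); first by right.
left; have clN : closed [set tshift g s | s in `[0, N]%classic].
  apply: compact_closed; first exact: vfield_hausdorff.
  apply: continuous_compact; last exact: segment_compact.
  apply: continuous_subspaceT => s.
  apply: (@tshift_cvg _ (nbhs s) _ (fun=> g) id g s) => //.
  - by rewrite -{2}(tshift0 g) -hull_onT; exact: hull_on_tshift.
  - exact: cvg_cst.
have : (closure [set tshift g s | s in `[0, N]%classic] `|`
        closure [set tshift g s | s in [set s | N <= s]]) h.
  rewrite -closureU; apply: closureS Hh.2 => _ [s /= s0 <-].
  have [sN|/ltW Ns] := leP s N; [left|right]; exists s => //=.
  by rewrite in_itv/= s0 sN.
case=> [|cl]; last by exfalso; apply: nN; split => //; exact: Hh.1.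
rewrite -(closure_id _).1// => -[s /=]; rewrite in_itv/= => /andP[s0 _] <-.
by exists s.
Qed.

End WithMetric.
End Hull.

(** * The fast flow *)

Section FastFlow.
Context {R : realType} {n m : nat} (g : vfield R n m).
Variable d : vfield R n m -> vfield R n m -> R.
Hypotheses (hd : metrizes (hull g) d) (hadm : admissible g) (hlip : lipschitz_in_y g).
Hypothesis hglob : forall h : vfield R n m,
  ((exists2 tau0 : R, 0 <= tau0 & h = tshift g tau0) \/ omega_limit g h) ->
  forall (x : 'rV[R]_n) (y : 'rV[R]_m), exists phi, fast_solution h x 0 y phi.
Implicit Types (h : vfield R n m).

Lemma within_bounded (k : nat) (phi : R -> 'rV[R]_k) (a b : R) :
  {within `[a, b], continuous phi} ->
  exists2 M : R, 0 < M & forall t, a <= t <= b -> enorm (phi t) <= M.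
Proof.
move=> c; have := continuous_compact c (@segment_compact R a b).
move=> /compact_enorm_bounded[M M0 HM]; exists M => // t tab.
by apply: HM; exists t => //=; rewrite in_itv.
Qed.

Lemma fast_solution_within h x tau0 y phi (T : R) t :
  fast_solution h x tau0 y phi -> tau0 <= t <= T ->
  deriv_within `[tau0, T] phi t (h (x, phi t, t)).
Proof.
move=> [_ D] /andP[t0 tT]; apply: deriv_withinS (D t t0) => s.
by rewrite /= in_itv/= => /andP[].
Qed.

(** Both curves stay in a ball on [[0, T]], where [h] is Lipschitz; [gronwall_sqr] with [B = 0] then
    applies to their difference. *)
Lemma ode_unique h x (phi psi : R -> 'rV[R]_m) (T : R) : hull g h ->
  (forall t, 0 <= t <= T -> deriv_within `[0, T] phi t (h (x, phi t, t))) ->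
  (forall t, 0 <= t <= T -> deriv_within `[0, T] psi t (h (x, psi t, t))) ->
  phi 0 = psi 0 -> forall t, 0 <= t <= T -> phi t = psi t.
Proof.
move=> Hh D1 D2 E t /andP[t0 tT].
have [M1 M10 B1] : exists2 M : R, 0 < M & forall t, 0 <= t <= T -> enorm (phi t) <= M.
  apply/within_bounded/(@deriv_within_continuous _ _ _ _ (fun t => h (x, phi t, t))) => s.
  by rewrite /= in_itv; exact: D1.
have [M2 M20 B2] : exists2 M : R, 0 < M & forall t, 0 <= t <= T -> enorm (psi t) <= M.
  apply/within_bounded/(@deriv_within_continuous _ _ _ _ (fun t => h (x, psi t, t))) => s.
  by rewrite /= in_itv; exact: D2.
have [L L0 HL] := hull_lipschitz hlip (enorm x + M1 + M2).
have x0 := enorm_ge0 x.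
have sub s : 0 <= s <= t -> 0 <= s <= T by move=> /andP[-> /= h1]; exact: le_trans tT.
have D s : 0 <= s <= t -> deriv_within `[0, t] (fun s => phi s - psi s) s
    (h (x, phi s, s) - h (x, psi s, s)).
  move=> st; apply: deriv_withinB.
    by apply: deriv_withinS (D1 s (sub s st)) => r; rewrite /= !in_itv/=; exact: sub.
  by apply: deriv_withinS (D2 s (sub s st)) => r; rewrite /= !in_itv/=; exact: sub.
have := @gronwall_sqr _ _ _ _ 0 t (1 + L ^+ 2) 0 t0 D.
rewrite E subrr enorm0 expr0n/= !addr0 mul0r => G.
have : enorm (phi t - psi t) ^+ 2 <= 0.
  apply: G => s st; rewrite mulr0 addr0 addrAC subrr add0r -exprMn.
  rewrite ler_sqr ?nnegrE ?enorm_ge0// ?mulr_ge0 ?enorm_ge0 ?(ltW L0)//.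
  by apply: HL => //; [|have := B1 s (sub s st)|have := B2 s (sub s st)]; elra.
move=> h0; have /eqP : enorm (phi t - psi t) ^+ 2 = 0.
  by apply/le_anti; rewrite h0 sqr_ge0.
by rewrite sqrf_eq0 => /eqP/enorm_eq0/eqP; rewrite subr_eq0 => /eqP.
Qed.

Definition flow h x y := fast_flow h x 0 y.

Lemma flowP h x y : Hplus g h -> fast_solution h x 0 y (flow h x y).
Proof.
move=> Hh; have [phi Hphi] := hglob (HplusP hadm hd Hh) x y.
by rewrite /flow /fast_flow; apply: (xgetPex (fun=> y)); exists phi.
Qed.

Lemma flow0 h x y : Hplus g h -> flow h x y 0 = y.
Proof. by move=> /(flowP x y)[]. Qed.

Lemma flow_within h x y (T : R) t : Hplus g h -> 0 <= t <= T ->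
  deriv_within `[0, T] (flow h x y) t (h (x, flow h x y t, t)).
Proof. by move=> Hh; exact/fast_solution_within/flowP. Qed.

Lemma flow_unique h x y (T : R) (phi : R -> 'rV[R]_m) : Hplus g h ->
  (forall t, 0 <= t <= T -> deriv_within `[0, T] phi t (h (x, phi t, t))) ->
  phi 0 = y -> forall t, 0 <= t <= T -> phi t = flow h x y t.
Proof.
move=> Hh D E; apply: (@ode_unique h x) => //; first exact: Hplus_hull.
  by move=> t tT; exact: flow_within.
by rewrite flow0.
Qed.

Lemma flowD h x y (s t : R) : Hplus g h -> 0 <= s -> 0 <= t ->
  flow h x y (t + s) = flow (tshift h s) x (flow h x y s) t.
Proof.
move=> Hh s0 t0.
apply: (@flow_unique (tshift h s) x _ t (fun t => flow h x y (t + s))); last by rewrite t0 lexx.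
- exact: Hplus_tshift.
- move=> r /andP[r0 rt].
  apply: (@deriv_within_shift _ _ `[0, t + s]%classic); last first.
    by apply: flow_within; rewrite // addr_ge0//= lerD2r.
  by move=> q; rewrite /= !in_itv/= => /andP[q0 qt]; rewrite addr_ge0//= lerD2r.
- by rewrite add0r.
Qed.

(** Links the hypothesis of ultimate boundedness, stated for [g] with a variable initial time, to
    the flow over the translates, started at time 0. *)
Lemma fast_flow_tshift x y (s t : R) : 0 <= s -> 0 <= t ->
  fast_flow g x s y (t + s) = flow (tshift g s) x y t.
Proof.
move=> s0 t0; have Hs : Hplus g (tshift g s) by exact: Hplus_orbit.
have : fast_solution g x s y (fast_flow g x s y).
  apply: (xgetPex (fun=> y)); exists (fun t => flow (tshift g s) x y (t - s)).
  split; first by rewrite subrr flow0.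
  move=> r sr; have [_ D] := flowP x y Hs.
  have := @deriv_within_shift _ _ [set r | 0 <= r] [set r | s <= r]
    (flow (tshift g s) x y) (- s) r.
  by move=> /(_ _ _ (D (r - s) _)); rewrite /tshift/= subrK subr_ge0; apply=> // q; rewrite subr_ge0.
move=> [E D].
apply: (@flow_unique (tshift g s) x y t (fun t => fast_flow g x s y (t + s))) => //.
- move=> r /andP[r0 rt]; apply: (@deriv_within_shift _ _ [set r | s <= r]); last first.
    by rewrite /tshift/=; apply: D; rewrite lerDr.
  by move=> q; rewrite /= in_itv/= => /andP[q0 _]; rewrite lerDr.
- by rewrite add0r.
- by rewrite t0 lexx.
Qed.

(** [eta] serves in [perturbation] both as initial error and as size of the defect, whence the sum
    of two terms. *)
Lemma small_eta (A e : R) : 0 < e ->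
  exists2 eta : R, 0 < eta & (eta ^+ 2 + 2 * eta ^+ 2) * expR A <= e ^+ 2.
Proof.
move=> e0; have E0 := expR_gt0 A; set E := expR A in E0 *.
have q3 : 0 < 3 * (E + 1) by elra.
(* With [eta = e * q] the left-hand side is [e ^+ 2] times [q * (3 * q * E)], and both [q] and
   [3 * q * E] are at most 1. *)
pose q := (3 * (E + 1))^-1; have q0 : 0 < q by rewrite invr_gt0.
have qE : q * (3 * (E + 1)) = 1 by rewrite mulVf// gt_eqF.
exists (e * q); first by rewrite mulr_gt0.
have -> : ((e * q) ^+ 2 + 2 * (e * q) ^+ 2) * E = e ^+ 2 * (q * (3 * q * E)) by ring.
rewrite ler_piMr ?sqr_ge0//.
have q1 : 3 * q * E <= 1 by nra.
have q2 : q <= 1 by nra.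
have q4 : 0 <= 3 * q * E by rewrite !mulr_ge0// ltW.
by nra.
Qed.

(** Near each [(h, x, y)] the flow stays within 1/2 of one bounded trajectory, by [perturbation];
    compactness of [Hplus] and of the balls makes the bound uniform. *)
Lemma flow_bounded (r T : R) : 0 <= T -> exists2 M : R, 0 < M &
  forall h x y t, Hplus g h -> enorm x <= r -> enorm y <= r -> 0 <= t <= T ->
    enorm (flow h x y t) <= M.
Proof.
move=> T0.
have cK := compact_setX (Hplus_compact hadm)
  (compact_setX (@enorm_ball0_compact R n r) (@enorm_ball0_compact R m r)).
move/compact_near_coveringP/near_covering_withinP : cK => cK.
have := cK R (pinfty_nbhs R) (fun B p => forall t, 0 <= t <= T ->
  enorm (flow p.1 p.2.1 p.2.2 t) <= B) _.
suff H : forall p : vfield R n m * ('rV[R]_n * 'rV[R]_m),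
    (Hplus g `*` ([set v | enorm v <= r] `*` [set v | enorm v <= r])) p ->
    \forall p' \near p & B \near +oo,
     (Hplus g `*` ([set v | enorm v <= r] `*` [set v | enorm v <= r])) p' ->
     forall t, 0 <= t <= T -> enorm (flow p'.1 p'.2.1 p'.2.2 t) <= B.
  move=> /(_ _ H) N.
  have [M [M0 HM]] := filter_ex (filterI (nbhs_pinfty_gt (@num_real R 0)) N).
  exists M => // h x y t Hh xr yr tT; exact: (HM (h, (x, y))).
move=> [h [x y]] [/= Hh [/= xr yr]].
have Hhull := Hplus_hull Hh.
have [M1 M10 HM1] : exists2 M : R, 0 < M & forall t, 0 <= t <= T -> enorm (flow h x y t) <= M.
  apply/within_bounded/(@deriv_within_continuous _ _ _ _ (fun t => h (x, flow h x y t, t))) => s.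
  by rewrite /= in_itv; exact: flow_within.
have nr : 0 <= r by exact: le_trans (enorm_ge0 _) xr.
have [L L0 HL] := hull_lipschitz hlip (r + M1 + 2).
have rB : r <= r + M1 + 2 by elra.
have MB : M1 + 1 <= r + M1 + 2 by elra.
have MB' : M1 <= r + M1 + 2 by elra.
have half0 : 0 < 1 / 2 :> R by elra.
have [eta eta0 Heta] := small_eta ((1 + 2 * L ^+ 2) * (T - 0)) half0.
have eta2 : 0 < eta / 2 by elra.
have [del del0 Hdel] := hull_uniform_continuous hadm (r + M1 + 2) eta2.
have Nh := vfield_near Hhull.1 (@box_compact _ _ _ (r + M1 + 2) T) eta2.
exists ([set h' | forall p, box (r + M1 + 2) T p -> enorm (h' p - h p) < eta / 2] `*`
   ([set x' | enorm (x' - x) < del] `*` [set y' | enorm (y' - y) < eta]),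
   [set B | M1 + 1 <= B]); last first.
  move=> [[h' [x' y']] B] /= [[/= Hh' [/= xd yd]] HB] [/= Hp' [/= xr' yr']] t tT.
  have : enorm (flow h' x' y' t - flow h x y t) <= 1 / 2.
    apply: (@perturbation _ _ _ _ (fun t => h (x, flow h x y t, t))
      (fun t => h' (x', flow h' x' y' t, t)) 0 T M1 L eta) => //; [by clear Heta; elra|..].
    - by move=> s sT; exact: flow_within.
    - by move=> s sT; exact: flow_within.
    - move=> s sT zM.
      have b1 := HM1 s sT.
      have A1 := Hh' (x', flow h' x' y' s, s).
      have {}A1 : enorm (h' (x', flow h' x' y' s, s) - h (x', flow h' x' y' s, s)) < eta / 2.
        by apply: A1; split => /=; [exact: le_trans xr' rB|exact: le_trans zM MB|case/andP: sT => s0 sT; rewrite ger0_norm].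
      have A2 : enorm (h (x', flow h' x' y' s, s) - h (x, flow h' x' y' s, s)) <= eta / 2.
        by apply: Hdel; [exact: Hhull|exact: le_trans xr' rB|exact: le_trans zM MB|exact: le_trans xr rB|exact: le_trans zM MB|exact: xd|rewrite subrr enorm0|rewrite subrr normr0].
      have A3 : enorm (h (x, flow h' x' y' s, s) - h (x, flow h x y s, s)) <=
          L * enorm (flow h' x' y' s - flow h x y s).
        by apply: HL; [exact: Hhull|exact: le_trans xr rB|exact: le_trans zM MB|exact: le_trans b1 MB'].
      apply: le_trans (enormB3 _ _ _ _) _.
      by apply: le_trans (lerD (lerD (ltW A1) A2) A3) _; rewrite -splitr addrC.
    - apply: le_trans Heta; rewrite ler_wpM2r ?expR_ge0// lerD2r !flow0//.
      by rewrite ler_sqr ?nnegrE ?enorm_ge0 ?(ltW eta0)// ltW.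
  have := enormD (flow h' x' y' t - flow h x y t) (flow h x y t); rewrite subrK.
  by have := HM1 t tT; clear Heta; elra.
split => /=; last exact: (nbhs_pinfty_ge (num_real _)).
exists ([set h' | forall p, box (r + M1 + 2) T p -> enorm (h' p - h p) < eta / 2],
  ([set x' | enorm (x' - x) < del] `*` [set y' | enorm (y' - y) < eta])) => //.
split => //=; exists ([set x' | enorm (x' - x) < del], [set y' | enorm (y' - y) < eta]) => //.
by split; apply/nbhs_enormP; [exists del|exists eta].
Qed.

(** The common source of continuity of the flow and of tracking by the slow-fast system: [z] is any
    curve that nearly solves the equation while in the ball of radius [M + 1]. [M] is fixed before
    [e], so that the defect can be measured on a fixed ball. *)
Lemma flow_perturb (r T : R) : 0 <= T -> exists2 M : R, 0 < M &
  (forall h x y t, Hplus g h -> enorm x <= r -> enorm y <= r -> 0 <= t <= T ->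
    enorm (flow h x y t) <= M) /\
  forall e : R, 0 < e -> exists2 eta : R, 0 < eta &
  forall h x y (z dz : R -> 'rV[R]_m) b, Hplus g h -> enorm x <= r -> enorm y <= r ->
    0 <= b <= T ->
    (forall t, 0 <= t <= b -> deriv_within `[0, b] z t (dz t)) ->
    enorm (z 0 - y) <= eta ->
    (forall t, 0 <= t <= b -> enorm (z t) <= M + 1 ->
       enorm (dz t - h (x, z t, t)) <= eta) ->
    forall t, 0 <= t <= b -> enorm (z t - flow h x y t) <= e.
Proof.
move=> T0; have [M M0 HM] := flow_bounded r T0; exists M => //; split => // e e0.
have [L L0 HL] := hull_lipschitz hlip (r + M + 1).
(* [perturbation] requires an error below 1. *)
have e'0 : 0 < Num.min e (1 / 2) by rewrite lt_min e0/=; elra.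
have [eta eta0 Heta] := small_eta ((1 + 2 * L ^+ 2) * T) e'0.
exists eta => // h x y z dz b Hh xr yr /andP[b0 bT] Dz zy Hdz t tb.
have nr : 0 <= r by exact: le_trans (enorm_ge0 _) xr.
suff : enorm (z t - flow h x y t) <= Num.min e (1 / 2) by rewrite le_min => /andP[].
have sub s : 0 <= s <= b -> 0 <= s <= T by move=> /andP[-> /= h1]; exact: le_trans bT.
apply: (@perturbation _ _ _ _ (fun t => h (x, flow h x y t, t)) dz 0 b M L eta) => //.
- by rewrite gt_min; apply/orP; right; clear Heta; elra.
- by move=> s sb; exact: flow_within.
- by move=> s sb; apply: HM => //; exact: sub.
- move=> s sb zM.
  have := Hdz s sb zM.
  have b1 := HM h x y s Hh xr yr (sub s sb).
  have : enorm (h (x, z s, s) - h (x, flow h x y s, s)) <= L * enorm (z s - flow h x y s).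
    clear Heta.
    by apply: HL; [exact: Hplus_hull|elra|elra|elra].
  by have := enormB (dz s) (h (x, z s, s)) (h (x, flow h x y s, s)); clear Heta; elra.
- apply: le_trans Heta; rewrite flow0//; apply: ler_pM.
  + by rewrite addr_ge0 ?sqr_ge0// mulr_ge0// sqr_ge0.
  + exact: expR_ge0.
  + by rewrite lerD2r ler_sqr ?nnegrE ?enorm_ge0 ?(ltW eta0).
  + rewrite ler_expR subr0 ler_wpM2l// addr_ge0// mulr_ge0// sqr_ge0//.
- exact: ltW.
Qed.

Lemma flow_near h x y (t e : R) : Hplus g h -> 0 <= t -> 0 < e ->
  \forall h' \near h & q \near (x, y), Hplus g h' ->
    enorm (flow h' q.1 q.2 t - flow h x y t) < e.
Proof.
move=> Hh t0 e0; have e2 : 0 < e / 2 by elra.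
have [M M0 [HM /(_ _ e2)[eta eta0 H]]] := flow_perturb (enorm x + enorm y + 1) t0.
have x0 := enorm_ge0 x; have y0 := enorm_ge0 y.
have eta2 : 0 < eta / 2 by elra.
have [del del0 Hdel] := hull_uniform_continuous hadm (enorm x + enorm y + M + 1) eta2.
have Nh := vfield_near (Hplus_hull Hh).1 (@box_compact _ _ _ (enorm x + enorm y + M + 1) t) eta2.
exists ([set h' | forall p, box (enorm x + enorm y + M + 1) t p -> enorm (h' p - h p) < eta / 2],
   [set q | enorm (q.1 - x) < Num.min del 1 /\ enorm (q.2 - y) < Num.min eta 1]).
  split => //=; exists ([set x' | enorm (x' - x) < Num.min del 1], [set y' | enorm (y' - y) < Num.min eta 1]) => //.
  by split; apply/nbhs_enormP; [exists (Num.min del 1)|exists (Num.min eta 1)] => //;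
    rewrite lt_min ?del0 ?eta0/=.
move=> [h' [x' y']] /= [Hh' []]; rewrite !lt_min => /andP[xd x1] /andP[yd y1] Hp'.
have hx := enormD (x' - x) x; rewrite subrK in hx.
have hy := enormD (y' - y) y; rewrite subrK in hy.
apply: le_lt_trans (_ : e / 2 < _); last by elra.
apply: (H h x y (flow h' x' y') (fun t => h' (x', flow h' x' y' t, t)) t) => //.
- elra.
- elra.
- by rewrite t0 lexx.
- by move=> s st; exact: flow_within.
- by rewrite flow0// ltW.
- move=> s st zM.
  have A1 := Hh' (x', flow h' x' y' s, s).
  have {A1} : enorm (h' (x', flow h' x' y' s, s) - h (x', flow h' x' y' s, s)) < eta / 2.
    by apply: A1; split => /=; [elra|elra|case/andP: st => s0 sT; rewrite ger0_norm].
  have : enorm (h (x', flow h' x' y' s, s) - h (x, flow h' x' y' s, s)) <= eta / 2.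
    by apply: Hdel; [exact: Hplus_hull|elra|elra|elra|elra|exact: xd|rewrite subrr enorm0|rewrite subrr normr0].
  by have := enormB (h' (x', flow h' x' y' s, s)) (h (x', flow h' x' y' s, s)) (h (x, flow h' x' y' s, s)); elra.
- by rewrite t0 lexx.
Qed.

(** The hypothesis concerns translates of [g] only; these are dense in [Hplus], and [flow_near]
    carries the bound to the closure with the same [c] and [T]. *)
Lemma flow_absorb (K0 : set 'rV[R]_n) : ultimately_bounded g K0 ->
  exists2 c : R, 0 < c & forall rho : R, 0 < rho -> exists2 T : R, 0 <= T &
    forall h x y t, Hplus g h -> K0 x -> enorm y <= rho -> T <= t ->
      enorm (flow h x y t) <= c.
Proof.
move=> [c c0 H]; exists c => // rho rho0; have [T T0 HT] := H rho rho0.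
exists T => // h x y t Hh Kx yr Tt; have t0 := le_trans T0 Tt.
apply/ler_addgt0Pr => e e0.
have [[A B] [/= NA NB] AB] := flow_near x y Hh t0 e0.
have [_ [[s s0 <-] As]] := Hh.2 _ NA.
have := AB (tshift g s, (x, y)) (conj As (nbhs_singleton NB)) (Hplus_orbit hadm s0).
rewrite enorm_distC => h1; have := HT x s t y Kx s0 Tt yr.
rewrite fast_flow_tshift// => h2.
have := enormD (flow h x y t - flow (tshift g s) x y t) (flow (tshift g s) x y t).
by rewrite subrK; move: h1 h2 => /= h1 h2 h3; elra.
Qed.

End FastFlow.

(** * Metrics and global attractors *)

Section Metrizes.
Context {R : realType}.

Lemma metrizesS (T : topologicalType) (H H' : set T) (d : T -> T -> R) :
  H' `<=` H -> metrizes H d -> metrizes H' d.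
Proof.
move=> sH [d0 dC dT dN]; split=> [h k /sH hh /sH|h k /sH hh /sH|h k l /sH hh /sH hk /sH|h H'h B].
- exact: d0.
- exact: dC.
- exact: dT.
- have := dN h (sH _ H'h) [set k | H' k -> B k]; rewrite /within/= => -[A1 A2]; split.
    move=> NB; have [|e e0 He] := A1; first by apply: filterS NB => k Bk _.
    by exists e => // k H'k kd; apply: (He k (sH _ H'k) kd).
  move=> [e e0 He]; have : nbhs h (fun x => H x -> H' x -> B x).
    by apply: A2; exists e => // k Hk kd H'k; exact: He.
  by apply: filterS => k Hk H'k; apply: Hk => //; exact: sH.
Qed.

Lemma metrizes_nbhs (T : topologicalType) (H : set T) (d : T -> T -> R) h (e : R) :
  metrizes H d -> H h -> 0 < e -> \forall k \near h, H k -> d h k < e.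
Proof.
by move=> [_ _ _ N] Hh e0; apply: (N h Hh [set k | d h k < e]).2; exists e.
Qed.

Lemma metrizes_self (T : topologicalType) (H : set T) (d : T -> T -> R) h :
  metrizes H d -> H h -> d h h = 0.
Proof. by move=> [d0 _ _ _] Hh; apply/(d0 h h Hh Hh).2. Qed.

Lemma metrizes_eudist (k : nat) (H : set 'rV[R]_k) : metrizes H (@eudist R k).
Proof.
split=> [x y _ _|x y _ _|x y z _ _ _|x Hx B]; rewrite /eudist.
- split; first exact: enorm_ge0.
  split=> [/enorm_eq0/eqP|->]; first by rewrite subr_eq0 => /eqP.
  by rewrite subrr enorm0.
- exact: enorm_distC.
- exact: enormB.
- split=> [/nbhs_enormP[e e0 He]|[e e0 He]].
    by exists e => // y Hy xy; apply: He => //; rewrite enorm_distC.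
  by apply/nbhs_enormP; exists e => // y xy Hy; apply: He => //; rewrite enorm_distC.
Qed.

Lemma metrizes_prod (S T : topologicalType) (H : set S) (K : set T)
    (dS : S -> S -> R) (dT : T -> T -> R) :
  metrizes H dS -> metrizes K dT -> metrizes (H `*` K) (prod_dist dS dT).
Proof.
move=> mS mT; have [s0 sC sT sN] := mS; have [t0 tC tT tN] := mT.
split=> [[a b] [a' b'] [/= Ha Kb] [/= Ha' Kb']|[a b] [a' b'] [/= Ha Kb] [/= Ha' Kb']|
  [a b] [a' b'] [a'' b''] [/= Ha Kb] [/= Ha' Kb'] [/= Ha'' Kb'']|
  [a b] [/= Ha Kb] B]; rewrite /prod_dist/=.
- have [p1 q1] := s0 a a' Ha Ha'; have [p2 q2] := t0 b b' Kb Kb'.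
  split; first by rewrite le_max p1.
  split=> [E|[E1 E2]]; last by rewrite (q1.2 E1) (q2.2 E2) maxxx.
  have h1 : dS a a' <= 0 by rewrite -E le_max lexx.
  have h2 : dT b b' <= 0 by rewrite -E le_max lexx orbT.
  congr (_, _); [apply: q1.1|apply: q2.1]; apply/le_anti.
    by rewrite h1 p1.
  by rewrite h2 p2.
- by rewrite sC// tC.
- rewrite ge_max; apply/andP; split.
    by apply: le_trans (sT _ _ _ Ha Ha' Ha'') _; apply: lerD; rewrite le_max lexx.
  by apply: le_trans (tT _ _ _ Kb Kb' Kb'') _; apply: lerD; rewrite le_max lexx orbT.
- split.
    move=> [[A1 A2] [/= N1 N2] sA].
    have [|e1 e10 H1] := (sN a Ha A1).1; first by apply: filterS N1 => x.
    have [|e2 e20 H2] := (tN b Kb A2).1; first by apply: filterS N2 => x.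
    exists (Num.min e1 e2); first by rewrite lt_min e10.
    move=> [x y] [/= Hx Ky]; rewrite gt_max !lt_min => /andP[/andP[x1 _] /andP[_ y2]].
    by apply: (sA (x, y)) => //; split; [exact: H1|exact: H2].
  move=> [e e0 He].
  exists ([set x | H x -> dS a x < e], [set y | K y -> dT b y < e]) => /=.
    by split; [exact: metrizes_nbhs|exact: metrizes_nbhs].
  move=> [x y] [/= Hx Ky] [/= Hx' Ky']; apply: He => //=.
  by rewrite gt_max Hx// Ky.
Qed.

Lemma semidist_lt (T : Type) (dT : T -> T -> R) (A B : set T) (e : R) :
  (semidist dT A B < e%:E)%E -> forall p, A p -> exists2 q, B q & dT p q < e.
Proof.
rewrite /semidist gt_max => /andP[_ H] p Ap.
have : (ereal_inf [set (dT p q)%:E | q in B] < e%:E)%E.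
  by apply: le_lt_trans H; apply: ereal_sup_ubound; exists p.
by move=> /ereal_inf_lt[_ [q Bq <-]]; rewrite lte_fin => h; exists q.
Qed.

Lemma semidist_le (T : Type) (dT : T -> T -> R) (A B : set T) (e : R) : 0 <= e ->
  (forall p, A p -> exists2 q, B q & dT p q <= e) -> (semidist dT A B <= e%:E)%E.
Proof.
move=> e0 H; rewrite /semidist ge_max lee_fin e0/=.
apply: ge_ereal_sup => _ [p Ap <-]; have [q Bq pq] := H p Ap.
by apply: ereal_inf_le; exists (dT p q)%:E; [exists q|rewrite lee_fin].
Qed.

Lemma semidist_cvg0 (T : Type) (dT : T -> T -> R) (A : R -> set T) (B : set T) :
  semidist dT (A tau) B @[tau --> +oo] --> 0%E <->
  forall e : R, 0 < e -> exists T0 : R, forall tau, T0 <= tau ->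
    forall p, A tau p -> exists2 q, B q & dT p q < e.
Proof.
split=> [H e e0|H].
  have : \forall tau \near +oo, (semidist dT (A tau) B < e%:E)%E.
    by apply: (H [set u | (u < e%:E)%E]); apply: open_ereal_lt'; rewrite lte_fin.
  move=> [M [_ HM]]; exists (M + 1) => tau Mtau p Ap.
  by apply: semidist_lt Ap; apply: HM; apply: lt_le_trans Mtau; rewrite ltrDl.
move=> C [e /= e0 eC]; have e2 : 0 < e / 2 by lra.
have [T0 HT] := H _ e2.
suff : \forall tau \near +oo, C (semidist dT (A tau) B) by [].
exists T0; split=> [|tau /ltW Ttau]; first exact: num_real.
have : (semidist dT (A tau) B <= (e / 2)%:E)%E.
  apply: semidist_le; first exact: ltW.
  by move=> p Ap; have [q Bq /ltW pq] := HT tau Ttau p Ap; exists q.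
have : (0 <= semidist dT (A tau) B)%E by rewrite /semidist le_max lexx.
case: (semidist dT (A tau) B) => //= s; rewrite !lee_fin => s0 se.
by apply: eC; rewrite /ball/= sub0r normrN ger0_norm//; lra.
Qed.

End Metrizes.

Section AttractorExistence.
Context {R : realType} {B : topologicalType} {m : nat}.
Variables (P : set B) (dB : B -> B -> R) (S : R -> B * 'rV[R]_m -> B * 'rV[R]_m).
Hypotheses (hB : hausdorff_space B) (mP : metrizes P dB) (cP : compact P)
  (P0 : P !=set0).
Let Z : set (B * 'rV[R]_m) := P `*` setT.
Hypotheses (SZ : forall tau z, 0 <= tau -> Z z -> Z (S tau z))
  (SD : forall s t z, 0 <= s -> 0 <= t -> Z z -> S (t + s) z = S t (S s z))
  (Sc : forall tau z, 0 <= tau -> Z z -> S tau w @[w --> within Z (nbhs z)] --> S tau z)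
  (Sabs : exists2 c : R, 0 < c & forall rho : R, 0 < rho -> exists2 T : R, 0 <= T &
     forall z tau, Z z -> enorm z.2 <= rho -> T <= tau -> enorm (S tau z).2 <= c).

(** The attractor is the omega-limit set of the compact absorbing set [D], obtained as the cluster
    set of the filter [G] of its late images. *)
Lemma global_attractor_exists : exists A, is_global_attractor P dB S A.
Proof.
have [c c0 Habs] := Sabs.
pose D : set (B * 'rV[R]_m) := P `*` [set v | enorm v <= c].
have DZ z : D z -> Z z by move=> [].
have cD : compact D by apply: compact_setX => //; exact: enorm_ball0_compact.
have hW : hausdorff_space (B * 'rV[R]_m)%type.
  by apply: prod_hausdorff => //; exact: norm_hausdorff.
have clD : closed D by exact: compact_closed.
have D0 : D !=set0.
  by have [p Pp] := P0; exists (p, 0); split => //=; rewrite enorm0 ltW.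
have [Tc Tc0 HTc] := Habs c c0.
have SDD tau z : Tc <= tau -> D z -> D (S tau z).
  move=> Tt Dz; split; first by have [] := SZ (le_trans Tc0 Tt) (DZ _ Dz).
  by apply: HTc => //; [exact: DZ|case: Dz].
pose G : set_system (B * 'rV[R]_m) :=
  [set X | exists s : R, forall tau w, s <= tau -> D w -> X (S tau w)].
have GP : ProperFilter G.
  split.
    by move=> [s H]; have [w Dw] := D0; exact: (H s w).
  split.
  - by exists 0.
  - move=> X Y [s Hs] [t Ht]; exists (Num.max s t) => tau w.
    by rewrite ge_max => /andP[h1 h2] Dw; split; [exact: Hs|exact: Ht].
  - by move=> X Y XY [s Hs]; exists s => tau w h Dw; apply: XY; exact: Hs.
have GD : G D by exists Tc => tau w; exact: SDD.
pose A := cluster G.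
have AD : A `<=` D.
  by rewrite /A clusterE => z /(_ D GD); rewrite -(closure_id _).1.
have clA : closed A.
  by rewrite /A clusterE; apply: closed_bigI => X _; exact: closed_closure.
exists A; split.
- by move=> z /AD/DZ.
- by have [z [_ Az]] := cD G GP GD; exists z.
- exact: subclosed_compact cD AD.
- move=> tau tau0; apply/seteqP; split.
    move=> _ [z Az <-] X Y [s Hs] NY.
    have NV := Sc tau0 (DZ _ (AD _ Az)) NY.
    have GX : G [set w | exists sig w0, [/\ Num.max s Tc <= sig, D w0 & w = S sig w0]].
      by exists (Num.max s Tc) => sig w0 h Dw0; exists sig, w0.
    have [_ [[sig [w0 [+ Dw0 ->]]] Vw]] := Az _ _ GX NV.
    rewrite ge_max => /andP[h1 h2].
    exists (S tau (S sig w0)); split.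
      rewrite -SD//; [|exact: le_trans h2|exact: DZ].
      by apply: Hs => //; rewrite (le_trans h1)// lerDr.
    by apply: Vw; apply/DZ/SDD.
  move=> z Az.
  (* Negative invariance: [F1] is the filter of pairs of a late time [sig] and a point [w] of [D]
     with [S sig w] near [z]. A cluster point of [S (sig - tau) w] along [F1] is a preimage of [z]
     under [S tau]. *)
  pose f (p : R * (B * 'rV[R]_m)) := S (p.1 - tau) p.2.
  pose F1 : set_system (R * (B * 'rV[R]_m)) :=
    [set Q | exists s V, nbhs z V /\
       forall sig w, s <= sig -> D w -> V (S sig w) -> Q (sig, w)].
  have F1P : ProperFilter F1.
    split.
      move=> [s [V [NV H]]].
      have GX : G [set w | exists sig w0, [/\ s <= sig, D w0 & w = S sig w0]].
        by exists s => sig w0 h Dw0; exists sig, w0.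
      have [_ [[sig [w0 [h Dw0 ->]]] Vw]] := Az _ _ GX NV.
      exact: (H sig w0).
    split.
    - by exists 0, setT; split => //; exact: filterT.
    - move=> Q Q' [s [V [NV H]]] [s' [V' [NV' H']]].
      exists (Num.max s s'), (V `&` V'); split; first exact: filterI.
      move=> sig w; rewrite ge_max => /andP[h1 h2] Dw [v1 v2].
      by split; [exact: H|exact: H'].
    - move=> Q Q' QQ' [s [V [NV H]]]; exists s, V; split => // sig w h Dw Vw.
      by apply: QQ'; exact: H.
  have F1D : (f @ F1) D.
    exists (Tc + tau), setT; split; first exact: filterT.
    by move=> sig w h Dw _ /=; apply: SDD => //=; rewrite lerBrDr.
  have [w [Dw clw]] := cD (f @ F1) (fmap_proper_filter f F1P) F1D.
  exists w.
    move=> X Y [s Hs] NY; apply: clw => //.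
    exists (s + tau), setT; split; first exact: filterT.
    by move=> sig w' h Dw' _ /=; apply: Hs => //=; rewrite lerBrDr.
  apply: hW => Y V NY NV.
  have NU := Sc tau0 (DZ _ Dw) NY.
  have FQ : (f @ F1) [set w' | exists sig w0, [/\ Tc + tau <= sig, D w0, V (S sig w0) & w' = f (sig, w0)]].
    by exists (Tc + tau), V; split => // sig w0 h Dw0 Vw0 /=; exists sig, w0.
  have [_ [[sig [w0 [h Dw0 Vw ->]]] Uw]] := clw _ _ FQ NU.
  have h' : Tc <= sig - tau by rewrite lerBrDr.
  exists (S sig w0); split => //.
  have := Uw (DZ _ (SDD _ _ h' Dw0)).
  by rewrite /f/= -SD//; [rewrite addrC subrK|exact: le_trans h'|exact: DZ].
- move=> D' /bounded_setP[M M0 HM]; apply/semidist_cvg0 => e e0.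
  have mZ : metrizes Z (prod_dist dB (@eudist R m)).
    by apply: metrizes_prod => //; exact: metrizes_eudist.
  have [T T0 HT] := Habs M M0.
  have : G [set w | exists2 a, A a & prod_dist dB (@eudist R m) w a < e].
    (* Each point of [D] either belongs to the attractor or is separated from the late images;
       compactness of [D] turns this local alternative into one uniform late time. *)
    move/compact_near_coveringP/near_covering_withinP : (cD) => ncD.
    have := ncD _ G (fun w' w => w = w' ->
      exists2 a, A a & prod_dist dB (@eudist R m) w a < e) _.
    move=> /(_ _) H; have {H} H : \forall w' \near G, D `<=` (fun w => w = w' ->
      exists2 a, A a & prod_dist dB (@eudist R m) w a < e).
      apply: H => w Dw.
      have [Aw|nAw] := pselect (A w).
        exists ([set w' | Z w' -> prod_dist dB (@eudist R m) w w' < e], setT).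
          split; last exact: filterT.
          by apply: (metrizes_nbhs mZ) => //; exact: DZ.
        move=> [w' w''] /= [h _] Dw' _; exists w => //.
        case: mZ => _ sym _ _; rewrite sym; [exact: h (DZ _ Dw')|exact: DZ|exact: DZ].
      have [X [Y [GX NY XY]]] : exists X Y, [/\ G X, nbhs w Y & X `&` Y = set0].
        apply: contrapT => H; apply: nAw => X Y GX NY; apply/set0P/eqP => XY.
        by apply: H; exists X, Y.
      exists (Y, X) => //= -[w' w''] /= [Yw' Xw''] Dw' E.
      have : (X `&` Y) w' by split => //; rewrite E.
      by rewrite XY.
    have GH : G (fun w' => D `<=` (fun w => w = w' ->
      exists2 a, A a & prod_dist dB (@eudist R m) w a < e)) := H.
    by apply: filterS (filterI GH GD) => w [h Dw]; exact: (h w Dw erefl).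
  move=> [s Hs]; exists (Num.max s 0 + T) => tau Ttau _ [[p y] [/= Pp D'y] <-].
  have Zp : Z (p, y) by [].
  have h1 : Num.max s 0 <= tau - T by rewrite lerBrDr.
  have h2 : 0 <= tau - T by rewrite (le_trans _ h1)// le_max lexx orbT.
  have -> : tau = (tau - T) + T by rewrite subrK.
  rewrite SD//; apply: Hs; first by rewrite (le_trans _ h1)// le_max lexx.
  split; first by have [] := SZ T0 Zp.
  by apply: HT => //=; exact: HM.
Qed.

End AttractorExistence.

(** * The attractors of the skew-product semiflows *)

Lemma cvg_pair2 (T : Type) (A B : topologicalType) (F : set_system T) {FF : Filter F}
    (f : T -> A) (g : T -> B) (a : A) (b : B) :
  f x @[x --> F] --> a -> g x @[x --> F] --> b -> (f x, g x) @[x --> F] --> (a, b).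
Proof.
move=> fa gb X [[U V] [/= NU NV] UV].
have HU : F (f @^-1` U) := fa U NU; have HV : F (g @^-1` V) := gb V NV.
suff : F (fun x => X (f x, g x)) by [].
by apply: filterS (filterI HU HV) => x [Ux Vx]; exact: (UV (f x, g x)).
Qed.

Section SkewProduct.
Context {R : realType} {n m : nat} (g : vfield R n m).
Variable d : vfield R n m -> vfield R n m -> R.
Hypotheses (hd : metrizes (hull g) d) (hadm : admissible g) (hlip : lipschitz_in_y g).
Hypothesis hglob : forall h : vfield R n m,
  ((exists2 tau0 : R, 0 <= tau0 & h = tshift g tau0) \/ omega_limit g h) ->
  forall (x : 'rV[R]_n) (y : 'rV[R]_m), exists phi, fast_solution h x 0 y phi.
Hypothesis hbound : forall K0 : set 'rV[R]_n, compact K0 -> ultimately_bounded g K0.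
Implicit Types (h : vfield R n m).

Lemma flow_cvg (T : Type) (F : set_system T) {FF : Filter F}
    (hF : T -> vfield R n m) (xF : T -> 'rV[R]_n) (yF : T -> 'rV[R]_m) h x y (t : R) :
  Hplus g h -> 0 <= t -> (\forall i \near F, Hplus g (hF i)) ->
  hF i @[i --> F] --> h -> xF i @[i --> F] --> x -> yF i @[i --> F] --> y ->
  flow (hF i) (xF i) (yF i) t @[i --> F] --> flow h x y t.
Proof.
move=> Hh t0 FH hFh xFx yFy; apply/enorm_cvgP => e e0.
have [[A B] [/= NA NB] AB] := flow_near hd hadm hlip hglob x y Hh t0 e0.
have HA : F (hF @^-1` A) := hFh A NA.
have HB : F ((fun i => (xF i, yF i)) @^-1` B) := cvg_pair2 (FF := FF) xFx yFy NB.
have HC : F (fun i => Hplus g (hF i)) := FH.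
suff : F (fun i => enorm (flow (hF i) (xF i) (yF i) t - flow h x y t) < e) by [].
by apply: filterS (filterI (filterI HA HB) HC) => i [[Ai Bi]]; exact: (AB (hF i, (xF i, yF i))).
Qed.

Lemma omega_hull : omega_limit g `<=` hull g.
Proof. by move=> h []. Qed.

Lemma metrizes_omega : metrizes (omega_limit g) d.
Proof. exact: metrizesS omega_hull hd. Qed.

(** [attractor] is a choice with the empty set as default, so its properties rest on existence. *)
Lemma semiflow_attractor (K0 : set 'rV[R]_n) : compact K0 -> K0 !=set0 ->
  is_global_attractor (omega_limit g `*` K0) (prod_dist d (@eudist R n)) (@semiflow R n m)
    (attractor g d K0).
Proof.
move=> cK K00; apply: xgetPex.
apply: global_attractor_exists.
- apply: prod_hausdorff; [exact: vfield_hausdorff|exact: norm_hausdorff].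
- by apply: metrizes_prod; [exact: metrizes_omega|exact: metrizes_eudist].
- by apply: compact_setX => //; exact: (omega_compact hadm hd).
- have [h oh] := omega_nonempty hadm hd; have [x Kx] := K00.
  by exists (h, x).
- move=> tau [[h x] y] tau0 [[/= oh Kx] _]; split => //; split => //=.
  exact: (omega_tshift hadm hd).
- move=> s t [[h x] y] s0 t0 [[/= oh Kx] _].
  have Hh := omega_Hplus hadm hd oh.
  have := flowD hd hadm hlip hglob x y Hh s0 t0; rewrite /flow => ->.
  by rewrite tshiftD (addrC s).
- move=> tau [[h x] y] tau0 [[/= oh Kx] _].
  have Hh := omega_Hplus hadm hd oh.
  set z := (h, x, y).
  have -> : semiflow tau = (fun w : vfield R n m * 'rV[R]_n * 'rV[R]_m =>
     (tshift w.1.1 tau, w.1.2, flow w.1.1 w.1.2 w.2 tau)).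
    by apply/funext => -[[? ?] ?].
  have c11 : w.1.1 @[w --> within ((omega_limit g `*` K0) `*` setT) (nbhs z)] --> h.
    by apply: cvg_within_filter; apply: (@cvg_comp _ _ _ fst fst); [exact: cvg_fst|exact: cvg_fst].
  have c12 : w.1.2 @[w --> within ((omega_limit g `*` K0) `*` setT) (nbhs z)] --> x.
    by apply: cvg_within_filter; apply: (@cvg_comp _ _ _ fst snd); [exact: cvg_fst|exact: cvg_snd].
  have c2 : w.2 @[w --> within ((omega_limit g `*` K0) `*` setT) (nbhs z)] --> y.
    by apply: cvg_within_filter; exact: cvg_snd.
  apply: cvg_pair2; first apply: cvg_pair2 => //.
    by apply: (tshift_cvg hadm) => //; [exact: omega_hull|exact: cvg_cst].
  apply: flow_cvg => //.
  by apply: filterS (withinT _ _) => w [[ow _] _]; exact: (omega_Hplus hadm hd).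
- have [c c0 H] := flow_absorb hd hadm hlip hglob (hbound cK).
  exists c => // rho rho0; have [T T0 HT] := H rho rho0; exists T => //.
  move=> [[h x] y] tau [[/= oh Kx] _] yr Tt.
  by apply: HT => //; exact: (omega_Hplus hadm hd).
Qed.

(** [Q] is the phase space over the omega-limit set in one use, and in another a compact set over
    [Hplus] that contains the points of the empirical measures. *)
Lemma semiflow_at_cvg (Q : set (vfield R n m * 'rV[R]_m)) x tau z :
  Q `<=` Hplus g `*` setT -> 0 <= tau -> Q z ->
  semiflow_at x tau w @[w --> within Q (nbhs z)] --> semiflow_at x tau z.
Proof.
move=> QH tau0 Qz; case: z Qz => h y Qz; have [/= Hh _] := QH _ Qz.
set z := (h, y).
have -> : semiflow_at x tau = (fun w : vfield R n m * 'rV[R]_m =>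
   (tshift w.1 tau, flow w.1 x w.2 tau)) by apply/funext => -[? ?].
have c1 : w.1 @[w --> within Q (nbhs z)] --> h.
  by apply: cvg_within_filter; exact: cvg_fst.
have c2 : w.2 @[w --> within Q (nbhs z)] --> y.
  by apply: cvg_within_filter; exact: cvg_snd.
apply: cvg_pair2.
  by apply: (tshift_cvg hadm) => //; [exact: Hplus_hull|exact: cvg_cst].
apply: flow_cvg => //; last exact: cvg_cst.
by apply: filterS (withinT _ _) => w /QH[].
Qed.

Lemma semiflow_at_attractor x :
  is_global_attractor (omega_limit g) d (@semiflow_at R n m x) (attractor_at g d x).
Proof.
apply: xgetPex; apply: global_attractor_exists.
- exact: vfield_hausdorff.
- exact: metrizes_omega.
- exact: (omega_compact hadm hd).
- exact: (omega_nonempty hadm hd).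
- move=> tau [h y] tau0 [/= oh _]; split => //=; exact: (omega_tshift hadm hd).
- move=> s t [h y] s0 t0 [/= oh _].
  have Hh := omega_Hplus hadm hd oh.
  have := flowD hd hadm hlip hglob x y Hh s0 t0; rewrite /flow => ->.
  by rewrite tshiftD (addrC s).
- move=> tau z tau0 Zz; apply: semiflow_at_cvg => //.
  by move=> [h y] [/= oh _]; split => //=; exact: (omega_Hplus hadm hd).
- have [c c0 H] := flow_absorb hd hadm hlip hglob (hbound (@compact_set1 _ x)).
  exists c => // rho rho0; have [T T0 HT] := H rho rho0; exists T => //.
  move=> [h y] tau [/= oh _] yr Tt.
  by apply: HT => //; exact: (omega_Hplus hadm hd).
Qed.

End SkewProduct.

(** * Limits of empirical measures *)

Section UnitInterval.
Context {R : realType}.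
Let mu := @lebesgue_measure R.
Definition unif01 : probability (measurableTypeR R) R := uniform_prob (@ltr01 R).

Lemma unif01_itv (p q : R) : 0 <= p -> p <= q -> q <= 1 -> unif01 `[p, q[%classic = (q - p)%:E.
Proof.
move=> p0 pq q1; rewrite /unif01 /= /uniform_prob integral_uniform_pdf setIidl; last first.
  move=> x; rewrite /= !in_itv/= => /andP[px xq].
  by rewrite (le_trans p0 px) (le_trans (ltW xq) q1).
rewrite (eq_integral (fun=> 1%:E)); last first.
  move=> x; rewrite inE/= in_itv/= => /andP[px xq].
  by rewrite /uniform_pdf (le_trans p0 px) (le_trans (ltW xq) q1) subr0 invr1.
rewrite integral_cst//= mul1e lebesgue_measure_itv/= lte_fin.
move: pq; rewrite le_eqVlt => /predU1P[->|->]; last by rewrite EFinB.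
by rewrite ltxx subrr.
Qed.

Lemma unif01_out : unif01 (~` `[0, 1[%classic) = 0%E.
Proof.
rewrite (probability_setC unif01); last exact: measurable_itv.
by rewrite unif01_itv// subr0 subee.
Qed.

Lemma unif01_integrable (f : R -> R) (C : R) :
  measurable_fun [set: measurableTypeR R] f -> (forall u, `|f u| <= C) ->
  unif01.-integrable setT (EFin \o f).
Proof.
move=> mf fC; apply: measurable_bounded_integrable => //.
  by apply: le_lt_trans (ltry 1); exact: (probability_le1 unif01).
exists C; split; first exact: num_real.
by move=> M CM u _; apply: le_trans (fC u) (ltW CM).
Qed.

Lemma unif01_Rintegral_indic (A : set (measurableTypeR R)) : measurable A ->
  \int[unif01]_u (\1_A u : R) = fine (unif01 A).
Proof. by move=> mA; rewrite /Rintegral integral_indic// setIT. Qed.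

Lemma unif01_indic_integrable (A : set (measurableTypeR R)) (c : R) : measurable A ->
  unif01.-integrable setT (EFin \o (fun u => c * (\1_A u : R))).
Proof.
move=> mA; apply: (@unif01_integrable _ `|c|).
  by apply: measurable_funM; [exact: measurable_cst|exact: measurable_indic].
by move=> u; rewrite normrM indicE; case: (u \in A); rewrite /= ?normr1 ?mulr1 ?normr0 ?mulr0.
Qed.

(** The last term prescribes the value [c] off [[0, 1[], a null set for [unif01], so that functions
    defined on the whole line can be equal to step functions everywhere. *)
Definition step_fun (M : nat) (G H : nat -> R) (c u : R) : R :=
  \sum_(k < M) H k * \1_(`[G k, G k.+1[%classic) u + c * \1_(~` `[0, 1[%classic) u.

Lemma measurable_step_fun M G H c : measurable_fun [set: measurableTypeR R] (step_fun M G H c).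
Proof.
apply: measurable_funD.
  apply: measurable_sum => k; apply: measurable_funM; first exact: measurable_cst.
  by apply: measurable_indic; exact: measurable_itv.
apply: measurable_funM; first exact: measurable_cst.
by apply/measurable_indic/measurableC; exact: measurable_itv.
Qed.

Lemma Rintegral_step_fun M (G H : nat -> R) (c : R) :
  (forall k, 0 <= G k) -> (forall k, G k <= G k.+1) -> (forall k, G k <= 1) ->
  \int[unif01]_u step_fun M G H c u = \sum_(k < M) H k * (G k.+1 - G k).
Proof.
move=> G0 Gnd G1.
have mI k : measurable (`[G k, G k.+1[%classic : set (measurableTypeR R)) by exact: measurable_itv.
have mO : measurable (~` `[0, 1[%classic : set (measurableTypeR R)).
  by apply: measurableC; exact: measurable_itv.
have S : unif01.-integrable setT (EFin \o (fun u => \sum_(k < M) H k * (\1_(`[G k, G k.+1[%classic) u : R))) /\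
   \int[unif01]_u (\sum_(k < M) H k * (\1_(`[G k, G k.+1[%classic) u : R)) = \sum_(k < M) H k * (G k.+1 - G k).
  elim: M => [|M [IH1 IH2]].
    split.
      have -> : (fun u : R => \sum_(k < 0) H k * (\1_(`[G k, G k.+1[%classic) u : R)) = (fun u => 0 * (\1_(~` `[0, 1[%classic) u : R)).
        by apply/funext => u; rewrite big_ord0 mul0r.
      exact: (unif01_indic_integrable 0 mO).
    by under eq_Rintegral do rewrite big_ord0; rewrite big_ord0 Rintegral_cst// mul0r.
  have E : (fun u => \sum_(k < M.+1) H k * (\1_(`[G k, G k.+1[%classic) u : R)) =
     (fun u => \sum_(k < M) H k * (\1_(`[G k, G k.+1[%classic) u : R) + H M * (\1_(`[G M, G M.+1[%classic) u : R)).
    by apply/funext => u; rewrite big_ord_recr.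
  rewrite E; split.
    have := integrableD measurableT IH1 (unif01_indic_integrable (H M) (mI M)).
    by congr (integrable _ _ _); apply/funext => u /=; rewrite EFinD.
  rewrite RintegralD//; last exact: unif01_indic_integrable.
  rewrite IH2 big_ord_recr/= RintegralZl//; last first.
    by have := unif01_indic_integrable 1 (mI M); under eq_fun do rewrite /= mul1r.
  by rewrite unif01_Rintegral_indic// unif01_itv.
have [S1 S2] := S.
rewrite /step_fun RintegralD//; last exact: unif01_indic_integrable.
rewrite S2 RintegralZl//; last first.
  by have := unif01_indic_integrable 1 mO; under eq_fun do rewrite /= mul1r.
by rewrite unif01_Rintegral_indic// unif01_out/= mulr0 addr0.
Qed.

End UnitInterval.

(** * Coding points by finite covers, and quantiles of the codes *)

Section Coding.
Context {R : realType} {W : choiceType}.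
Variables (K : set W) (dK : W -> W -> R) (e_ : nat -> R) (L : nat -> seq W).
Hypotheses (dK_sym : forall z w, K z -> K w -> dK z w = dK w z)
  (dK_tri : forall x y z, K x -> K y -> K z -> dK x z <= dK x y + dK y z)
  (LK : forall l i w0, (i < size (L l))%N -> K (nth w0 (L l) i))
  (Lcov : forall l z, K z -> has (fun w => dK w z < e_ l) (L l)).

(** One more than the number of centres, because [find] returns the size of the list when no centre
    is close. *)
Definition radix l := (size (L l)).+1.
Definition digit l z := find (fun w => dK w z < e_ l) (L l).
(** A mixed-radix numeral whose leading digits come from the coarsest covers: the codes of one level
    that extend a given code of the previous level form a block of consecutive integers. *)
Fixpoint code l z := if l is l'.+1 then (code l' z * radix l' + digit l' z)%N else 0%N.
Fixpoint ncode l := if l is l'.+1 then (ncode l' * radix l')%N else 1%N.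

Lemma digit_lt l z : (digit l z < radix l)%N.
Proof. by rewrite ltnS find_size. Qed.

Lemma ncode_gt0 l : (0 < ncode l)%N.
Proof. by elim: l => //= l IH; rewrite muln_gt0 IH. Qed.

Lemma code_lt l z : (code l z < ncode l)%N.
Proof.
elim: l => //= l IH; apply: leq_trans (_ : (code l z).+1 * radix l <= _)%N.
  by rewrite mulSn addnC ltn_add2r digit_lt.
by rewrite leq_mul2r IH orbT.
Qed.

Lemma code_div l z : (code l.+1 z %/ radix l)%N = code l z.
Proof. by rewrite /= divnMDl// divn_small ?addn0// digit_lt. Qed.

Lemma code_mod l z : (code l.+1 z %% radix l)%N = digit l z.
Proof. by rewrite /= modnMDl modn_small// digit_lt. Qed.

Lemma code_ltM l z k : (code l.+1 z < k * radix l)%N = (code l z < k)%N.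
Proof. by rewrite -ltn_divLR// code_div. Qed.

Lemma code_close l z w : K z -> K w -> code l.+1 z = code l.+1 w -> dK z w < 2 * e_ l.
Proof.
move=> Kz Kw E; have D : digit l z = digit l w by rewrite -!code_mod E.
have h1 := nth_find z (Lcov l Kz); have h2 := nth_find z (Lcov l Kw).
rewrite -/(digit l z) in h1; rewrite -/(digit l w) -D in h2.
have Kc : K (nth z (L l) (digit l z)) by apply: LK; rewrite -has_find; exact: Lcov.
have := dK_tri Kz Kc Kw; rewrite (dK_sym Kz Kc) => h3.
by rewrite mulr_natl mulr2n; apply: le_lt_trans h3 _; apply: ltrD.
Qed.

Variables (U : set_system nat) (cnt : nat -> nat) (gam : nat -> nat -> W) (V : nat -> set nat).
Hypotheses (UU : UltraFilter U) (cnt0 : forall j, (0 < cnt j)%N) (UV : forall l, U (V l)).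

(** The integral of [F] against the [j]-th empirical measure. *)
Definition avg j (F : W -> R) : R := (\sum_(i < cnt j) F (gam j i)) / (cnt j)%:R.

Lemma cntR_gt0 j : 0 < (cnt j)%:R :> R.
Proof. by rewrite ltr0n. Qed.

Lemma avg_le j F G : (forall i, (i < cnt j)%N -> F (gam j i) <= G (gam j i)) -> avg j F <= avg j G.
Proof.
by move=> FG; rewrite ler_pM2r ?invr_gt0 ?cntR_gt0//; apply: ler_sum => i _; exact: FG.
Qed.

Lemma avg_cst j c : avg j (fun=> c) = c.
Proof.
by rewrite /avg sumr_const card_ord -[c *+ _]mulr_natr mulfK// gt_eqF// cntR_gt0.
Qed.

Lemma avgB j F G : avg j (fun z => F z - G z) = avg j F - avg j G.
Proof. by rewrite /avg -mulrBl sumrB. Qed.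

Lemma avgD j F G : avg j (fun z => F z + G z) = avg j F + avg j G.
Proof. by rewrite /avg -mulrDl big_split. Qed.

Lemma avg_sum j M (F : nat -> W -> R) :
  avg j (fun z => \sum_(k < M) F k z) = \sum_(k < M) avg j (F k).
Proof. by rewrite /avg exchange_big/= mulr_suml. Qed.

Lemma avgZ j c F : avg j (fun z => c * F z) = c * avg j F.
Proof. by rewrite /avg -mulr_sumr mulrA. Qed.

Lemma eq_avg j F G : (forall i, (i < cnt j)%N -> F (gam j i) = G (gam j i)) -> avg j F = avg j G.
Proof. by move=> FG; congr (_ / _); apply: eq_bigr => i _; exact: FG. Qed.

Lemma avg_ultralimit (F : W -> R) (C : R) :
  (\forall j \near U, forall i, (i < cnt j)%N -> `|F (gam j i)| <= C) ->
  exists a : R, avg j F @[j --> U] --> a.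
Proof.
move=> FC; have [||a _ Ha] := @ultra_compact_cvg _ _ U (fun j => avg j F) `[- C, C]%classic UU.
- exact: segment_compact.
- apply: filterS FC => j H; rewrite /= in_itv/= -{1}(avg_cst j (- C)) -{2}(avg_cst j C).
  by apply/andP; split; apply: avg_le => i ij; have := H i ij; rewrite ler_norml => /andP[].
- by exists a.
Qed.

Let below l k z : R := (code l z < k)%N%:R.

Let below_bound l k : exists a : R, avg j (below l k) @[j --> U] --> a.
Proof.
apply: (@avg_ultralimit _ 1); apply: nearW => j i _.
by rewrite /below; case: (_ < _)%N; rewrite /= ?normr1 ?normr0.
Qed.

(** The ultralimit of the distribution functions of the level [l] code under the empirical
    measures. *)
Definition wt l k : R := sval (cid (below_bound l k)).

Lemma wt_cvg l k : avg j (below l k) @[j --> U] --> wt l k.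
Proof. exact: (svalP (cid (below_bound l k))). Qed.

Lemma ultra_lim_le (F G : nat -> R) (a b : R) : (\forall j \near U, F j <= G j) ->
  F j @[j --> U] --> a -> G j @[j --> U] --> b -> a <= b.
Proof. by move=> FG Fa Gb; exact: (ler_cvg_to Fa Gb FG). Qed.

Lemma wt_nd l k k' : (k <= k')%N -> wt l k <= wt l k'.
Proof.
move=> kk'; apply: (ultra_lim_le _ (@wt_cvg l k) (@wt_cvg l k')).
apply: nearW => j; apply: avg_le => i _; rewrite /below ler_nat.
by have [h|//] := ltnP (code l (gam j i)) k; rewrite (leq_trans h kk').
Qed.

Lemma wt_cst l k c : (forall z, below l k z = c) -> wt l k = c.
Proof.
move=> H; have := @wt_cvg l k; under eq_fun do rewrite (eq_avg (G := fun=> c))// avg_cst.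
by move=> h; exact: (cvg_unique (@Rhausdorff R) h (cvg_cst _)).
Qed.

Lemma wt0 l : wt l 0 = 0. Proof. exact: wt_cst. Qed.

Lemma wt1 l : wt l (ncode l) = 1.
Proof. by apply: wt_cst => z; rewrite /below code_lt. Qed.

Lemma wt_refine l k : wt l.+1 (k * radix l) = wt l k.
Proof.
have h1 := @wt_cvg l.+1 (k * radix l); have h2 := @wt_cvg l k.
apply: (cvg_unique (@Rhausdorff R) h1).
suff -> : (fun j => avg j (below l.+1 (k * radix l))) = (fun j => avg j (below l k)) by [].
by apply/funext => j; apply: eq_avg => i _; rewrite /below code_ltM.
Qed.

Lemma wt_ge0 l k : 0 <= wt l k.
Proof. by rewrite -(wt0 l) wt_nd. Qed.

Lemma wt_le1 l k : wt l k <= 1.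
Proof.
apply: (ultra_lim_le (G := fun=> 1) _ (@wt_cvg l k) (cvg_cst _)); apply: nearW => j.
rewrite -[leRHS](avg_cst j); apply: avg_le => i _; rewrite /below.
by case: (_ < _)%N; rewrite /= ?ler01.
Qed.

(** The quantile function of the limit distribution [wt l]. *)
Definition cell l (u : R) := find (fun k => u < wt l k.+1) (iota 0 (ncode l)).

Lemma cell_lt l u : u < 1 -> (cell l u < ncode l)%N.
Proof.
move=> u1; rewrite /cell -[X in (_ < X)%N](size_iota 0) -has_find.
apply/hasP; exists (ncode l).-1; last by rewrite prednK ?ncode_gt0// wt1.
by rewrite mem_iota/= add0n prednK ?ncode_gt0.
Qed.

Lemma cellP l u : 0 <= u < 1 -> wt l (cell l u) <= u < wt l (cell l u).+1.
Proof.
move=> /andP[u0 u1]; have lt := cell_lt l u1.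
have := lt; rewrite /cell -[X in (_ < X)%N](size_iota 0) -has_find => hs.
have := nth_find 0%N hs; rewrite -/(cell l u) nth_iota// add0n => ->; rewrite andbT.
case E : (cell l u) => [|k]; first by rewrite wt0.
have := @before_find _ 0%N (fun k => u < wt l k.+1) (iota 0 (ncode l)) k.
rewrite -/(cell l u) E ltnSn => /(_ isT); rewrite nth_iota; last first.
  by rewrite (leq_trans _ (ltnW lt))// E.
by rewrite add0n => /negbT; rewrite -leNgt.
Qed.

Lemma cell_eq l u k : 0 <= u < 1 -> wt l k <= u < wt l k.+1 -> cell l u = k.
Proof.
move=> /(cellP l)/andP[c1 c2] /andP[k1 k2]; apply/eqP; rewrite eqn_leq.
apply/andP; split; rewrite leqNgt; apply/negP => h.
  by have := lt_le_trans k2 (le_trans (wt_nd l h) c1); rewrite ltxx.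
by have := lt_le_trans c2 (le_trans (wt_nd l h) k1); rewrite ltxx.
Qed.

Lemma cell_refine l u : 0 <= u < 1 -> (cell l.+1 u %/ radix l)%N = cell l u.
Proof.
move=> u01; apply/esym/cell_eq => //; have /andP[c1 c2] := cellP l.+1 u01.
set q := (cell l.+1 u %/ radix l)%N.
rewrite -(wt_refine l q) -(wt_refine l q.+1); apply/andP; split.
  by apply: le_trans c1; apply: wt_nd; exact: leq_trunc_div.
by apply: lt_le_trans c2 _; apply: wt_nd; rewrite -ltn_divLR.
Qed.

(** Restricting to indices in the large set [V l] lets a representative inherit what is known there
    of the points [gam j i], namely that they lie in the [l]-th set of a decreasing family. *)
Definition occurs l k (z : W) := exists j i, [/\ V l j, (i < cnt j)%N, z = gam j i & code l z = k].

(** If no point over [V l] had code [k], the averages of [below l k] and [below l k.+1] would agree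
    on a set of [U]. *)
Lemma occurs_ex l k : wt l k < wt l k.+1 -> exists z, occurs l k z.
Proof.
move=> lt; apply: contrapT => H.
suff : wt l k.+1 <= wt l k by rewrite leNgt lt.
apply: (ultra_lim_le _ (@wt_cvg l k.+1) (@wt_cvg l k)).
apply: filterS (UV l) => j Vj; apply: avg_le => i ij; rewrite /below ltnS leq_eqVlt.
case: eqP => [E|//]; exfalso; apply: H; exists (gam j i), j, i; split => //.
Qed.

Definition code_rep w0 l k : W := xget w0 (occurs l k).

Definition code_sum w0 l (F : W -> R) : R :=
  \sum_(k < ncode l) F (code_rep w0 l k) * (wt l k.+1 - wt l k).

Lemma avg_code j l (H : nat -> R) :
  avg j (fun z => H (code l z)) =
  \sum_(k < ncode l) H k * (avg j (below l k.+1) - avg j (below l k)).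
Proof.
transitivity (\sum_(k < ncode l) avg j (fun z => H k * (below l k.+1 z - below l k z))).
  rewrite -(avg_sum j (ncode l) (fun k z => H k * (below l k.+1 z - below l k z))); apply: eq_avg => i _; set z := gam j i.
  rewrite (bigD1 (Ordinal (code_lt l z)))//= big1 ?addr0.
    by rewrite /below ltnSn ltnn subr0 mulr1.
  move=> k /negP nk; rewrite /below ltnS leq_eqVlt.
  case: eqP => [E|_] /=; last by rewrite subrr mulr0.
  by exfalso; apply: nk; apply/eqP/val_inj.
by apply: eq_bigr => k _; rewrite avgZ avgB.
Qed.

(* Points with the same code are close, so that the empirical average of [F] is
   close to the sum of its values at the representatives. *)
Lemma avg_code_sum w0 l (F : W -> R) (om a : R) :
  (forall j i, V l.+1 j -> (i < cnt j)%N -> K (gam j i)) ->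
  (forall z w, K z -> K w -> dK z w < 2 * e_ l -> `|F z - F w| <= om) ->
  avg j F @[j --> U] --> a -> `|code_sum w0 l.+1 F - a| <= om.
Proof.
move=> VK Fom Fa.
pose H k := F (code_rep w0 l.+1 k).
have cH : avg j (fun z => H (code l.+1 z)) @[j --> U] --> code_sum w0 l.+1 F.
  under eq_fun do rewrite avg_code.
  apply: cvg_sumr => k _; apply: cvgM; first exact: cvg_cst.
  by apply: cvgB; exact: wt_cvg.
have close j i : V l.+1 j -> (i < cnt j)%N -> `|F (gam j i) - H (code l.+1 (gam j i))| <= om.
  move=> Vj ij; have /(xgetPex w0) : exists z, occurs l.+1 (code l.+1 (gam j i)) z.
    by exists (gam j i), j, i.
  move=> [j' [i' [Vj' ij' E1 E2]]]; apply: Fom; first exact: VK.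
    by rewrite /code_rep E1; exact: VK.
  apply: code_close; [exact: VK|by rewrite /code_rep E1; exact: VK|by rewrite /code_rep E2].
rewrite ler_norml; apply/andP; split.
  rewrite lerBrDr addrC.
  apply: (@ultra_lim_le (fun j => avg j F - om) (fun j => avg j (fun z => H (code l.+1 z)))) => //.
    apply: filterS (UV l.+1) => j Vj; rewrite -{1}(avg_cst j om) -avgB; apply: avg_le => i ij.
    by have := close j i Vj ij; rewrite ler_norml lerBlDr => /andP[_]; rewrite lerBlDl addrC.
  by apply: cvgB => //; exact: cvg_cst.
rewrite lerBlDr addrC.
apply: (@ultra_lim_le (fun j => avg j (fun z => H (code l.+1 z))) (fun j => avg j F + om)) => //.
  apply: filterS (UV l.+1) => j Vj; rewrite -(avg_cst j om) -avgD; apply: avg_le => i ij.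
  by have := close j i Vj ij; rewrite ler_distlC => /andP[].
by apply: cvgD => //; exact: cvg_cst.
Qed.

Definition code_point w0 l (u : R) : W := code_rep w0 l (cell l u).

Lemma approx_occurs w0 l u : 0 <= u < 1 -> occurs l (cell l u) (code_point w0 l u).
Proof.
move=> u01; rewrite /code_point /code_rep; apply: xgetPex; apply: occurs_ex.
by have /andP[h1 h2] := cellP l u01; exact: le_lt_trans h2.
Qed.

Lemma approx_code w0 l l' u : (l <= l')%N -> 0 <= u < 1 ->
  code l (code_point w0 l' u) = cell l u.
Proof.
move=> /subnK <- u01; move: (l' - l)%N => k; elim: k l => [|k IH] l0.
  by have [j [i []]] := approx_occurs w0 l0 u01.
by rewrite -code_div -(cell_refine l0 u01) addSnnS IH.
Qed.

(** All later points share the code of level [l.+1], so each is directly within [2 * e_ l] of the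
    point of that level. No errors are summed, and radii [1 / (l + 1)] suffice. *)
Lemma approx_close w0 l l' u : (forall k j i, V k j -> (i < cnt j)%N -> K (gam j i)) ->
  (l < l')%N -> 0 <= u < 1 -> dK (code_point w0 l.+1 u) (code_point w0 l' u) < 2 * e_ l.
Proof.
move=> VK ll' u01; apply: code_close.
- by have [j [i [Vj ij -> _]]] := approx_occurs w0 l.+1 u01; exact: VK Vj ij.
- by have [j [i [Vj ij -> _]]] := approx_occurs w0 l' u01; exact: VK Vj ij.
- by rewrite !approx_code.
Qed.

End Coding.

Section EmpiricalLimit.
Context {R : realType} {W : ptopologicalType}.
Variables (dW : W -> W -> R) (C : nat -> set W).
Hypotheses (cC : compact (C 0%N)) (clC : forall l, closed (C l))
  (ndC : forall l l', (l <= l')%N -> C l' `<=` C l) (mC : metrizes (C 0%N) dW).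
Variables (U : set_system nat) (cnt : nat -> nat) (gam : nat -> nat -> W).
Hypotheses (UU : UltraFilter U) (cnt0 : forall j, (0 < cnt j)%N)
  (UC : forall l, \forall j \near U, forall i, (i < cnt j)%N -> C l (gam j i)).

Lemma metrizes_totally_bounded (K : set W) (e : R) : compact K -> metrizes K dW -> 0 < e ->
  exists s : seq W, (forall i w0, (i < size s)%N -> K (nth w0 s i)) /\
    forall z, K z -> has (fun w => dW w z < e) s.
Proof.
move=> cK mK e0.
have := cK; rewrite compact_cover => /(_ W K (fun w => [set z | K z -> dW w z < e]°)).
case=> [w Kw|z Kz|D' sD cov].
- exact: open_interior.
- by exists z => //; exact: metrizes_nbhs.
exists (finmap.enum_fset D'); split.
  by move=> i w0 iD; apply/set_mem/sD; exact: mem_nth.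
move=> z Kz; have [w /= wD /interior_subset/= H] := cov z Kz.
by apply/hasP; exists w => //; exact: H.
Qed.

(** A representation of the limit of the empirical measures as the law of [phi]. The sets [C l]
    carry the information on the support; measurability is stated for uniformly continuous functions
    of [phi] and is extended to Borel sets in [measurable_borel_map]. *)
Theorem empirical_limit : exists phi : R -> W, (forall u l, C l (phi u)) /\
  forall (F : W -> R) (B : R), (forall z, C 0%N z -> `|F z| <= B) ->
    (forall e : R, 0 < e -> exists2 del : R, 0 < del &
       forall z w, C 0%N z -> C 0%N w -> dW z w < del -> `|F z - F w| <= e) ->
    measurable_fun [set: measurableTypeR R] (F \o phi) /\
    forall a : R, avg cnt gam j F @[j --> U] --> a -> \int[unif01]_u (F (phi u)) = a.
Proof.
set K := C 0%N.
pose e_ l : R := l.+1%:R^-1.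
have e_gt0 l : 0 < e_ l by rewrite invr_gt0.
have [L HL] := choice (fun l => metrizes_totally_bounded cC mC (e_gt0 l)).
have LK l i w0 : (i < size (L l))%N -> K (nth w0 (L l) i) by exact: (HL l).1.
have Lcov l z : K z -> has (fun w => dW w z < e_ l) (L l) by exact: (HL l).2.
have [_ sym tri _] := mC.
pose V l : set nat := [set j | forall i, (i < cnt j)%N -> C l (gam j i)].
have UV l : U (V l) by exact: UC.
have VK k j i : V k j -> (i < cnt j)%N -> K (gam j i).
  by move=> Vj ij; apply: (ndC (leq0n k)); exact: Vj.
pose w0 : W := point.
pose psi l u := code_point dW e_ L gam V UU cnt0 w0 l u.
(* Points outside [[0, 1[] are sent to 0, so that every [u] falls into a cell. *)
pose cl (u : R) : R := if 0 <= u < 1 then u else 0.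
have cl01 (u : R) : 0 <= cl u < 1 by rewrite /cl; case: ifPn => //; rewrite lexx ltr01.
have psiC l (u : R) : C l (psi l (cl u)).
  have [j [i [Vj ij E _]]] := approx_occurs dW e_ L gam UU cnt0 UV w0 l (cl01 u).
  by rewrite /psi E; exact: Vj.
have psiK l (u : R) : K (psi l (cl u)) by apply: (ndC (leq0n l)).
(* [p] is a cluster point of the [psi l (cl u)]; it lies in every [C l] because these sets are
   closed and decreasing. *)
have ex (u : R) : exists p, forall l, C l p /\ dW (psi l.+1 (cl u)) p <= 2 * e_ l.
  have [|p [Kp clp]] := cC (F := (fun l => psi l (cl u)) @ \oo) _.
    by apply: (@filterS _ \oo _ setT) => [l _|]; [exact: psiK|exact: filterT].
  exists p => l; split.
    rewrite (closure_id (C l)).1// => A NA.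
    have [|w [Cw Aw]] := clp (C l) A _ NA; last by exists w.
    by exists l => // l' /= ll'; exact: (ndC ll').
  apply/ler_addgt0Pr => eta eta0.
  have [|_ [[l' ll' <-] H]] := clp [set psi l' (cl u) | l' in [set l' | (l < l')%N]] _ _
    (metrizes_nbhs mC Kp eta0).
    by exists l.+1 => // l' /= ll'; exists l'.
  apply: le_trans (tri _ (psi l' (cl u)) _ (psiK _ _) (psiK _ _) Kp) _.
  apply: lerD; last by rewrite (sym _ _ (psiK _ _) Kp); exact: ltW (H (psiK _ _)).
  by apply/ltW/(approx_close sym tri LK Lcov UU cnt0 UV w0 VK) => //; exact: cl01.
have [phi Hphi] := choice ex.
exists phi; split=> [u l|F B FB Fuc]; first by have [] := Hphi u l.
pose Fl l (u : R) : R := F (psi l.+1 (cl u)).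
(* [Fl l] is constant off [[0, 1[]; its value there is read at the outside point [-1]. *)
have FlE l : Fl l = step_fun (ncode L l.+1) (wt dW e_ L gam UU cnt0 l.+1)
    (fun k => F (code_rep dW e_ L cnt gam V w0 l.+1 k)) (Fl l (-1)).
  apply/funext => u; rewrite /Fl /step_fun.
  have wge0 := wt_ge0 dW e_ L gam UU cnt0 l.+1; have wle1 := wt_le1 dW e_ L gam UU cnt0 l.+1.
  case: (boolP (0 <= u < 1)) => u01.
    have [u0 u1] := andP u01.
    rewrite [in RHS]indicE memNset ?mulr0 ?addr0; last by rewrite /= in_itv/= u01.
    rewrite /cl u01.
    rewrite (bigD1 (Ordinal (cell_lt dW e_ L gam UU cnt0 l.+1 u1)))//= big1 ?addr0.
      by rewrite indicE mem_set ?mulr1//= in_itv/=; exact: cellP.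
    move=> k /negP nk; rewrite indicE memNset ?mulr0//= in_itv/= => h; apply: nk.
    by apply/eqP/val_inj/esym/cell_eq.
  rewrite big1 ?add0r.
    rewrite indicE mem_set ?mulr1; last by rewrite /= in_itv/=; exact/negP.
    by rewrite /cl (negbTE u01) ler0N1.
  move=> k _; rewrite indicE memNset ?mulr0//= in_itv/= => /andP[h1 h2].
  by move: u01; rewrite (le_trans (wge0 k) h1) (lt_le_trans h2 (wle1 k.+1)).
have mFl l : measurable_fun [set: measurableTypeR R] (Fl l).
  by rewrite FlE; exact: measurable_step_fun.
have small (e : R) : 0 < e -> \forall l \near \oo, 2 * e_ l < e.
  move=> e0; have e2 : 0 < e / 2 by lra.
  near=> l; rewrite mulrC -ltr_pdivlMr//.
  by near: l; exact: (near_infty_natSinv_lt (PosNum e2)).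
have Flphi (e : R) : 0 < e -> \forall l \near \oo, forall u, `|Fl l u - F (phi u)| <= e.
  move=> /Fuc[del del0 H]; near=> l => u; apply: H; first exact: psiK.
    by have [] := Hphi u 0%N.
  apply: le_lt_trans (Hphi u l).2 _; near: l; exact: small.
have mF : measurable_fun [set: measurableTypeR R] (F \o phi).
  apply: (measurable_fun_cvg (h := Fl)) => // u _.
  apply/cvgrPdist_le => e e0; have := Flphi e e0.
  by apply: filterS => l /(_ u); rewrite distrC.
split => // a Fa.
have iF : unif01.-integrable setT (EFin \o (F \o phi)).
  by apply: (@unif01_integrable _ _ B) => // u; apply: FB; have [] := Hphi u 0%N.
have iFl l : unif01.-integrable setT (EFin \o Fl l).
  by apply: (@unif01_integrable _ _ B) => // u; apply: FB; exact: psiK.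
apply/eqP; rewrite -subr_eq0 -normr_le0; apply/ler_addgt0Pr => /= e0' e0'p; pose e : R := e0'; have e0 : 0 < e := e0'p.
rewrite add0r -/e; have e2 : 0 < e / 2 by lra.
have [del del0 Hdel] := Fuc _ e2.
have [l [H1 H2]] := filter_ex (filterI (Flphi _ e2) (small _ del0)).
have h1 : `|\int[unif01]_u (Fl l u) - a| <= e / 2.
  rewrite FlE Rintegral_step_fun; first last.
  - by move=> k; exact: wt_le1.
  - by move=> k; exact: wt_nd.
  - by move=> k; exact: wt_ge0.
  apply: (avg_code_sum sym tri LK Lcov (V := V)) => //.
  - by move=> j i; exact: VK.
  - by move=> z w Kz Kw zw; apply: Hdel => //; exact: lt_trans H2.
have h2 : `|\int[unif01]_u (F (phi u)) - \int[unif01]_u (Fl l u)| <= e / 2.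
  rewrite -RintegralB//; apply: le_trans (le_normr_Rintegral _ _) _ => //.
    by have := integrableB measurableT iF (iFl l); congr (integrable _ _ _).
  apply: le_trans (_ : \int[unif01]_u (e / 2) <= _).
    apply: le_Rintegral => //.
    - have := integrable_norm (integrableB measurableT iF (iFl l)).
      by congr (integrable _ _ _).
    - apply: (@unif01_integrable R (fun=> e / 2) (e / 2)); first exact: measurable_cst.
      by move=> _; rewrite ger0_norm//; exact: ltW.
    - by move=> u _; rewrite distrC; exact: H1.
  rewrite Rintegral_cst// (_ : fine _ = 1) ?mulr1//.
  by rewrite -[RHS]/(fine 1%E); congr fine; exact: (probability_setT unif01).
have := ler_normD (\int[unif01]_u (F (phi u)) - \int[unif01]_u (Fl l u)) (\int[unif01]_u (Fl l u) - a).
by rewrite addrA subrK; lra.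
Unshelve. all: by end_near. Qed.

End EmpiricalLimit.

(** * Lipschitz functions are almost everywhere derivable *)

Section LipschitzDerivable.
Context (R : realType).
Implicit Types (F : R -> R) (G H : cumulative R R).
Local Notation mu := (@lebesgue_measure R).

Lemma stieltjes_itv G (a b : R) : a <= b ->
  lebesgue_stieltjes_measure G `]a, b]%classic = (G b - G a)%:E.
Proof.
move=> ab; rewrite -(wlength_itv_bnd _ false false ab).
rewrite /lebesgue_stieltjes_measure /measure_extension/=.
by rewrite measurable_mu_extE//=; exact: is_ocitv.
Qed.

(* [G + H = id] makes the Stieltjes measures of [G] and [H] sum to Lebesgue measure. *)
Lemma stieltjes_le_lebesgue G H : (forall t, G t + H t = t) ->
  forall A, measurable A -> (lebesgue_stieltjes_measure G A <= mu A)%E.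
Proof.
move=> GH A mA.
rewrite (@lebesgue_measure_unique _ (measure_add (lebesgue_stieltjes_measure G)
   (lebesgue_stieltjes_measure H)))//; last first.
  move=> X /ocitvP[->|[[a b] ab ->]]; first by rewrite !measure0.
  rewrite /= in ab *.
  transitivity (lebesgue_stieltjes_measure G `]a, b]%classic + lebesgue_stieltjes_measure H `]a, b]%classic)%E;
    last exact/esym/measure_addE.
  rewrite !stieltjes_itv ?ltW// lebesgue_measure_itv/= lte_fin ab.
  by rewrite -!EFinD; congr EFin; rewrite -{1}(GH a) -{1}(GH b); ring.
rewrite [leRHS](_ : _ = lebesgue_stieltjes_measure G A + lebesgue_stieltjes_measure H A)%E.
  by rewrite leeDl.
exact: measure_addE.
Qed.

(** The restriction to a bounded interval is a finite measure, as the Radon-Nikodym theorem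
    requires. *)
Definition stieltjes_restr G (N : R) :=
  mrestr (lebesgue_stieltjes_measure G) (measurable_itv `]-N, N]).

HB.instance Definition _ G (N : R) := Measure.on (stieltjes_restr G N).

Let stieltjes_restr_fin G (N : R) : fin_num_fun (stieltjes_restr G N).
Proof.
move=> A mA; rewrite ge0_fin_numE ?measure_ge0//.
apply: (@le_lt_trans _ _ (lebesgue_stieltjes_measure G `]-N, N]%classic)).
  by apply: le_measure; rewrite ?inE//=; exact: measurableI.
have [NN|NN] := leP (- N) N; first by rewrite stieltjes_itv// ltry.
by rewrite set_itv_ge ?measure0// bnd_simp -leNgt ltW.
Qed.

HB.instance Definition _ G (N : R) :=
  @Measure_isFinite.Build _ _ _ (stieltjes_restr G N) (stieltjes_restr_fin G N).

(** The Stieltjes measure of [G] is dominated by Lebesgue measure, hence has a density. On []-n, n[]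
    the function [G] is a constant plus the integral of this density, and Lebesgue differentiation
    applies; countably many [n] cover the line. *)
Lemma cumulative_ae_derivable G H : (forall t, G t + H t = t) ->
  {ae mu, forall x, derivable G x 1}.
Proof.
move=> GH.
suff HN (N : nat) : {ae mu, forall x, - N%:R < x < N%:R -> derivable G x 1}.
  have := ae_foralln HN.
  apply: filterS => x Hx; apply: (Hx (Num.bound `|x|)).
  by rewrite -ltr_norml; exact: archi_boundP.
set n : R := N%:R.
pose nu := charge_of_finite_measure (stieltjes_restr G n).
have numu : nu `<< mu.
  apply/null_content_dominatesP => A mA A0; apply/eqP.
  rewrite eq_le; apply/andP; split; last exact: measure_ge0.
  rewrite -A0; apply: le_trans (stieltjes_le_lebesgue GH mA).
  by apply: le_measure; rewrite ?inE//=; apply: measurableI.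
have ffin := fun x => @Radon_Nikodym_fin_num _ _ _ nu mu x numu.
have fint := @Radon_Nikodym_integrable _ _ _ nu mu numu.
pose f : R -> R := fine \o Radon_Nikodym nu mu.
have fE : EFin \o f = Radon_Nikodym nu mu by apply/funext => x /=; rewrite fineK.
have iT : mu.-integrable setT (EFin \o f) by rewrite fE.
have := @FTC1Ny R f; case.
- by move=> y; apply: (integrableS _ _ _ iT) => //; exact: measurable_itv.
- by apply: open_integrable_locally => //; exact: openT.
move=> N' [mN N0 sN]; exists N'; split => // x xP; apply: sN => /= dx; apply: xP.
move: dx => [dx _] /andP[x1 x2].
have ev y : - n < y < n -> G y = \int[mu]_(t in `]-oo, y]) f t + G (- n).
  move=> /andP[y1 y2]; rewrite /Rintegral -/(EFin \o f) fE.
  rewrite -(@Radon_Nikodym_integral _ _ _ nu mu _ numu)//.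
  rewrite /nu /charge_of_finite_measure /=.
  rewrite -[stieltjes_restr G n _]/(lebesgue_stieltjes_measure G (_ `&` `]- n, n]%classic)).
  rewrite (_ : _ `&` _ = `]- n, y]%classic) ?stieltjes_itv ?ltW//=; first by rewrite subrK.
  by apply/seteqP; split => z /=; rewrite !in_itv/=; [move=> [-> /andP[->]]|move=> /andP[-> zy]; rewrite zy (le_trans zy (ltW y2))].
have : derivable ((fun y => \int[mu]_(t in `]-oo, y]) f t) \+ cst (G (- n))) x 1.
  by apply: derivableD; [exact: dx|exact: derivable_cst].
apply: near_eq_derivable => //.
have : \forall y \near x, y \in `]- n, n[ by apply: near_in_itvoo; rewrite in_itv/= x1.
by apply: filterS => y; rewrite in_itv/= => /ev ->.
Qed.

(** The functions (c t + F t) / (2 c) and (c t - F t) / (2 c) are nondecreasing and add up to t.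
    Derivability of the first gives that of [F]. *)
Lemma lipschitz_ae_derivable F (C : R) : (forall s t, `|F s - F t| <= C * `|s - t|) ->
  {ae mu, forall x, derivable F x 1}.
Proof.
move=> FC; have [c c0 {}FC] : exists2 c : R, 0 < c & forall s t, s <= t -> `|F t - F s| <= c * (t - s).
  exists (`|C| + 1) => [|s t st]; first by rewrite ltr_wpDl.
  apply: le_trans (FC t s) _; rewrite [`|t - s|]ger0_norm ?subr_ge0//.
  by rewrite ler_wpM2r ?subr_ge0//; have := ler_norm C; lra.
have cF : continuous F.
  move=> t; apply/cvgrPdist_lt => e e0; have ec : 0 < e / c by rewrite divr_gt0.
  near=> s.
  have : `|t - s| < e / c by near: s; exact: cvgr_dist_lt.
  rewrite ltr_pdivlMr// mulrC.
  have [ts|st] := leP t s.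
    by apply: le_lt_trans; rewrite distrC (le_trans (FC _ _ ts))// distrC ger0_norm// subr_ge0.
  by apply: le_lt_trans; rewrite (le_trans (FC _ _ (ltW st)))// ger0_norm// subr_ge0 ltW.
pose G0 (a : R) (t : R) := (c * t + a * F t) / (2 * c).
have nd (a : R) : `|a| <= 1 -> nondecreasing (G0 a).
  move=> a1 s t st; rewrite /G0 ler_pM2r ?invr_gt0; last lra.
  have := FC s t st; have : `|a * (F t - F s)| <= `|F t - F s| by rewrite normrM ler_piMl.
  have h := ler_norm (- (a * (F t - F s))); rewrite normrN in h => h1 h2.
  have h3 : - (a * (F t - F s)) <= c * (t - s) by exact: le_trans h (le_trans h1 h2).
  lra.
have rc a x : G0 a t @[t --> at_right x] --> G0 a x.
  apply: cvg_within_filter; apply: cvgMl => //; apply: cvgD; apply: cvgZl_tmp => //.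
  exact: cF.
have n1 : `|1 : R| <= 1 by rewrite normr1.
have n2 : `|-1 : R| <= 1 by rewrite normrN1.
pose G := HB.pack_for (cumulative R R) (G0 1) (isCumulative.Build R _ R (G0 1) (nd 1 n1) (rc 1)).
pose H := HB.pack_for (cumulative R R) (G0 (-1)) (isCumulative.Build R _ R (G0 (-1)) (nd (-1) n2) (rc (-1))).
have GH t : G t + H t = t by rewrite /G /H/= /G0; field; rewrite gt_eqF.
have := cumulative_ae_derivable GH; apply: filterS; first exact: (ae_filter_ringOfSetsType mu).
move=> x dG.
have -> : F = ((2 * c) \*: (G : R -> R)) - (c \*: (id : R -> R)).
  by apply/funext => t; rewrite !fctE /G/= /G0 /GRing.scale/=; field; rewrite gt_eqF.
apply: derivableB; apply: derivableZ; first exact: dG.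
exact: derivable_id.
Unshelve. all: by end_near. Qed.

End LipschitzDerivable.

(** * Extension of solutions *)

Section PeanoExtension.
Context {R : realType} {k : nat}.
Implicit Types (z : 'rV[R]_k) (Z : R -> 'rV[R]_k).

(* The window [s - h, t] makes the notion insensitive to the jumps of a
   piecewise constant Euler scheme of step [h], and stable under concatenation. *)
Definition approx_solution (F : R * 'rV[R]_k -> 'rV[R]_k) (T h : R) Z :=
  forall (s t : R) w (eta : R), 0 <= s -> s <= t -> t <= T -> 0 <= eta ->
  (forall r : R, 0 <= r -> s - h <= r <= t -> enorm (F (r, Z r) - w) <= eta) ->
  enorm (Z t - Z s - (t - s) *: w) <= eta * (t - s) + (eta + enorm w) * h.

Fixpoint euler (F : R * 'rV[R]_k -> 'rV[R]_k) (a h : R) z (j : nat) :=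
  if j is i.+1 then
    euler F a h z i + h *: F (a + i%:R * h, euler F a h z i)
  else z.

Lemma euler_increment F (a h : R) z w (eta : R) p q : 0 <= h ->
  (forall j, (p <= j < p + q)%N ->
     enorm (F (a + j%:R * h, euler F a h z j) - w) <= eta) ->
  enorm (euler F a h z (p + q) - euler F a h z p - (q%:R * h) *: w)
    <= q%:R * h * eta.
Proof.
move=> h0; elim: q => [|q IH] H.
  by rewrite addn0 subrr mul0r scale0r subrr enorm0 mul0r.
have Hq := H (p + q)%N; rewrite leq_addr addnS ltnSn in Hq.
have {}IH : enorm (euler F a h z (p + q) - euler F a h z p - (q%:R * h) *: w)
    <= q%:R * h * eta.
  by apply: IH => j /andP[pj jq]; apply: H; rewrite pj addnS ltnS ltnW.
rewrite addnS /=.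
set e := euler F a h z (p + q) in Hq IH *; set Fe := F _ in Hq *.
have -> : e + h *: Fe - euler F a h z p - (q.+1%:R * h) *: w
  = (e - euler F a h z p - (q%:R * h) *: w) + h *: (Fe - w).
  apply/rowP => i; rewrite !mxE -natr1; ring.
apply: le_trans (enormD _ _) _; rewrite enormZ ger0_norm//.
have h1 := Hq isT; have h2 : h * enorm (Fe - w) <= h * eta by rewrite ler_wpM2l.
rewrite -natr1; lra.
Qed.

Definition euler_path F (a h : R) z (t : R) :=
  euler F a h z (Num.truncn ((t - a) / h)).

Lemma euler_pathS F (a h : R) z j : 0 < h ->
  euler_path F a h z (a + j%:R * h) = euler F a h z j.
Proof.
by move=> h0; rewrite /euler_path addrAC subrr add0r mulfK ?gt_eqF// natrK.
Qed.

Lemma euler_path_approx F (a h : R) z (s t : R) w (eta : R) :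
  0 < h -> a <= s -> s <= t -> 0 <= eta ->
  (forall r : R, a <= r -> s - h <= r <= t ->
     enorm (F (r, euler_path F a h z r) - w) <= eta) ->
  enorm (euler_path F a h z t - euler_path F a h z s - (t - s) *: w)
    <= eta * (t - s) + (eta + enorm w) * h.
Proof.
move=> h0 as_ st eta0 H.
have itv (u : R) : a <= u ->
    (Num.truncn ((u - a) / h))%:R * h <= u - a
    < ((Num.truncn ((u - a) / h))%:R + 1) * h.
  move=> au; rewrite -ler_pdivlMr// -ltr_pdivrMr// natr1.
  by apply: truncn_itv; rewrite divr_ge0 ?subr_ge0// ltW.
have /andP[s1 s2] := itv _ as_; have /andP[t1 t2] := itv _ (le_trans as_ st).
have pq : (Num.truncn ((s - a) / h) <= Num.truncn ((t - a) / h))%N.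
  by apply: le_truncn; rewrite ler_pM2r ?invr_gt0// lerB.
rewrite /euler_path; set p := Num.truncn _ in s1 s2 pq *.
set pq' := Num.truncn _ in t1 t2 pq *.
have [q pqE] : exists q, pq' = (p + q)%N by exists (pq' - p)%N; rewrite subnKC.
rewrite pqE natrD in t1 t2 *.
have := @euler_increment F a h z w eta p q (ltW h0).
have H1 j : (p <= j < p + q)%N -> enorm (F (a + j%:R * h, euler F a h z j) - w) <= eta.
  move=> /andP[pj jq]; rewrite -(euler_pathS _ _ _ _ h0); apply: H.
    by rewrite lerDl mulr_ge0// ltW.
  have pj' : p%:R * h <= j%:R * h by rewrite ler_pM2r// ler_nat.
  have jq' : j%:R * h <= (p%:R + q%:R) * h by rewrite ler_pM2r// -natrD ler_nat ltnW.
  lra.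
move=> /(_ H1) {}H1.
have -> : euler F a h z (p + q) - euler F a h z p - (t - s) *: w
  = (euler F a h z (p + q) - euler F a h z p - (q%:R * h) *: w)
    + (q%:R * h - (t - s)) *: w.
  by apply/rowP => i; rewrite !mxE; ring.
apply: le_trans (enormD _ _) _; rewrite enormZ.
have d1 : `|q%:R * h - (t - s)| <= h by rewrite ler_norml; lra.
have d2 : `|q%:R * h - (t - s)| * enorm w <= h * enorm w.
  by rewrite ler_wpM2r ?enorm_ge0.
have d3 : q%:R * h * eta <= (t - s + h) * eta by rewrite ler_wpM2r//; lra.
lra.
Qed.

(** The exact part satisfies the mean value estimate without error; only the Euler part contributes
    the term in [h], so it occurs once even when [[s, t]] contains [a]. *)
Lemma approx_solution_glue F (T a h : R) (z Z : R -> 'rV[R]_k) : 0 < h -> 0 <= a ->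
  (forall t : R, 0 <= t <= a -> deriv_within `[0, a] z t (F (t, z t))) ->
  (forall t : R, t <= a -> Z t = z t) ->
  (forall t : R, a <= t -> Z t = euler_path F a h (z a) t) ->
  approx_solution F T h Z.
Proof.
move=> h0 a0 zF Zz Ze s t w eta s0 st tT eta0 H.
have left_ (u : R) : s <= u -> u <= a -> u <= t ->
    enorm (Z u - Z s - (u - s) *: w) <= eta * (u - s).
  move=> su ua ut; rewrite !Zz//; last exact: le_trans su ua.
  apply: (mean_value_le (dphi := fun r => F (r, z r))) => // r /andP[r1 r2].
    apply: deriv_withinS (zF r _) => [v /=|]; rewrite ?in_itv/=; last first.
      by rewrite (le_trans s0 r1) (le_trans r2 ua).
    by move=> /andP[v1 v2]; rewrite (le_trans s0 v1) (le_trans v2 ua).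
  rewrite -Zz; last exact: le_trans r2 ua.
  by apply: H; [exact: le_trans s0 r1|apply/andP; split; lra].
have right_ (u : R) : s <= u -> a <= u -> u <= t ->
    enorm (Z t - Z u - (t - u) *: w) <= eta * (t - u) + (eta + enorm w) * h.
  move=> su au ut; rewrite !Ze//; last exact: le_trans au ut.
  apply: euler_path_approx => // r ar /andP[r1 r2].
  rewrite -Ze//; apply: H; first exact: le_trans a0 ar.
  by apply/andP; split; lra.
have h1 : 0 <= (eta + enorm w) * h by rewrite mulr_ge0 ?addr_ge0 ?enorm_ge0// ltW.
have [ta|ta] := leP t a.
  by apply: le_trans (left_ t st ta (lexx _)) _; rewrite lerDl.
have [sa|sa] := leP a s; first exact: right_ sa st.
have -> : Z t - Z s - (t - s) *: w
   = (Z a - Z s - (a - s) *: w) + (Z t - Z a - (t - a) *: w).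
  by apply/rowP => i; rewrite !mxE; ring.
apply: le_trans (enormD _ _) _.
have := left_ a (ltW sa) (lexx _) (ltW ta); have := right_ a (ltW sa) (lexx _) (ltW ta).
lra.
Qed.

(** Take [w = F (t, Z t)] in the definition of [approx_solution]: near [t] the field along [Z_ j]
    stays within [e] of [w], uniformly in [j], because the [Z_ j] are Lipschitz up to [h_ j]. The
    terms in [h_ j] vanish in the limit. *)
Lemma approx_solution_limit F (T B : R) (U : set_system nat) (h_ : nat -> R)
    (Z_ : nat -> R -> 'rV[R]_k) z0 :
  UltraFilter U -> continuous F -> 0 <= B ->
  (forall (t : R) z, 0 <= t <= T -> enorm (F (t, z)) <= B) ->
  (forall j, 0 < h_ j) -> h_ @ U --> 0 ->
  (forall j, approx_solution F T (h_ j) (Z_ j)) -> (forall j, Z_ j 0 = z0) ->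
  exists Z, (forall t : R, 0 <= t <= T -> Z_ j t @[j --> U] --> Z t) /\
    forall t : R, 0 <= t <= T -> deriv_within `[0, T] Z t (F (t, Z t)).
Proof.
move=> UU cF B0 FB h0 hU ZF Z0.
have lip j (s t : R) : 0 <= s -> s <= t -> t <= T ->
    enorm (Z_ j t - Z_ j s) <= B * (t - s) + B * h_ j.
  move=> s0 st tT; have := ZF j s t 0 B s0 st tT B0.
  rewrite scaler0 subr0 enorm0 addr0; apply=> r r0 /andP[_ rt].
  by rewrite subr0 FB// r0 (le_trans rt tT).
have hsmall (e : R) : 0 < e -> \forall j \near U, h_ j < e.
  move=> e0; have /cvgrPdist_lt /(_ _ e0) := hU.
  by apply: filterS => j; rewrite sub0r normrN gtr0_norm.
have [Z ZU] : exists Z : R -> 'rV[R]_k, forall t : R, 0 <= t <= T -> Z_ j t @[j --> U] --> Z t.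
  suff H (t : R) : exists l : 'rV[R]_k, 0 <= t <= T -> Z_ j t @[j --> U] --> l.
    by exists (fun t => projT1 (cid (H t))) => t; case: cid.
  have [t0T|t0T] := boolP (0 <= t <= T); last by exists 0.
  have /andP[t0 tT] := t0T.
  have [|l _ Hl] := @ultra_compact_cvg _ _ U (Z_ ^~ t) _ UU (@enorm_ball_compact _ _ z0 (B * t + B)).
    apply: filterS (hsmall 1 ltr01) => j hj /=; rewrite -(Z0 j).
    apply: le_trans (lip j 0 t (lexx _) t0 tT) _.
    by rewrite subr0 lerD2l ler_piMr// ltW.
  by exists l.
exists Z; split => // t t0T; have /andP[t0 tT] := t0T.
apply/deriv_withinP => e e0.
set w := F (t, Z t).
have /cvgrPdist_lt := cF (t, Z t).
have n0 : 0 < e / (k%:R + 1) by rewrite divr_gt0// ltr_wpDl.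
move=> /(_ _ n0) [[A1 A2] /= [/nbhs_ballP[d1 d10 dA1] /nbhs_enormP[d2 d20 dA2]] HA].
have Fw (r : R) y : `|r - t| < d1 -> enorm (y - Z t) < d2 -> enorm (F (r, y) - w) <= e.
  move=> rt yt; rewrite enorm_distC; apply: le_trans (enorm_le_norm _) _.
  have := HA (r, y) (conj (dA1 r _) (dA2 _ yt)).
  rewrite -ball_normE /= distrC => /(_ rt) /ltW.
  rewrite ler_pdivlMr ?ltr_wpDl// mulrC; apply: le_trans.
  by rewrite ler_wpM2r//; lra.
(* The factor 2 accounts for the window, which reaches back by [h_ j < del] beyond the
   [del]-neighbourhood of [t]. *)
have [del [del0 deld1 delB]] : exists del : R, [/\ 0 < del, 2 * del < d1 & 2 * B * del < d2 / 4].
  have B1 : 0 < B + 1 by rewrite ltr_wpDl.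
  exists (Num.min (d1 / 4) (d2 / 16 / (B + 1))); split.
  - by rewrite lt_min !divr_gt0.
  - have : Num.min (d1 / 4) (d2 / 16 / (B + 1)) <= d1 / 4 by rewrite ge_min lexx.
    by have {}d10 : 0 < d1 := d10; lra.
  - have : Num.min (d1 / 4) (d2 / 16 / (B + 1)) <= d2 / 16 / (B + 1) by rewrite ge_min lexx orbT.
    rewrite ler_pdivlMr//; set m := Num.min _ _ => h.
    have m0 : 0 <= m by rewrite /m le_min !divr_ge0 ?ltW.
    lra.
exists del => // s; rewrite /= in_itv /= => /andP[s0 sT] st.
have /enorm_cvgP ZUt := ZU _ t0T.
have tri (a c : R) : 0 <= a -> a <= T -> 0 <= c -> c <= T -> a <= c -> `|a - t| < del -> `|c - t| < del ->
    enorm (Z c - Z a - (c - a) *: w) <= e * (c - a).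
  move=> a0 aT c0 cT ac at_ ct.
  have ev : \forall j \near U, enorm (Z_ j c - Z_ j a - (c - a) *: w) <= e * (c - a) + (e + enorm w) * h_ j.
    have hd : \forall j \near U, h_ j < del by exact: hsmall.
    have zd : \forall j \near U, enorm (Z_ j t - Z t) < d2 / 2 by apply: ZUt; lra.
    apply: filterS (filterI hd zd) => j [hj zj].
    apply: ZF => //; first exact: ltW.
    move=> r r0 /andP[r1 r2].
    have rt : `|r - t| < 2 * del by move: at_ ct; rewrite !ltr_norml => *; lra.
    apply: Fw; first exact: lt_trans deld1.
    apply: le_lt_trans (enormB (Z_ j r) (Z_ j t) (Z t)) _.
    have hB : B * h_ j <= B * del by rewrite ler_wpM2l// ltW.
    have : enorm (Z_ j r - Z_ j t) <= B * `|r - t| + B * h_ j.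
      have [rt'|rt'] := leP r t.
        by rewrite enorm_distC distrC ger0_norm ?subr_ge0//; apply: lip.
      by rewrite gtr0_norm ?subr_gt0//; apply: lip; [|exact: ltW|exact: le_trans r2 cT].
    have : B * `|r - t| <= B * (2 * del) by rewrite ler_wpM2l// ltW.
    elra.
  have cvZ : enorm (Z_ j c - Z_ j a - (c - a) *: w) @[j --> U] --> enorm (Z c - Z a - (c - a) *: w).
    apply: continuous_cvg; first exact: enorm_continuous.
    apply: cvgB; last exact: cvg_cst.
    by apply: cvgB; apply: ZU; apply/andP.
  have cvh : e * (c - a) + (e + enorm w) * h_ j @[j --> U] --> e * (c - a) + (e + enorm w) * 0.
    by apply: cvgD; [exact: cvg_cst|apply: cvgMr].
  rewrite mulr0 addr0 in cvh.
  exact: ler_cvg_to cvZ cvh ev.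
have [st'|st'] := leP t s.
  by rewrite ger0_norm ?subr_ge0//; apply: tri => //; rewrite subrr normr0.
have := tri s t s0 sT t0 tT (ltW st') st; rewrite subrr normr0 => /(_ del0).
rewrite distrC gtr0_norm ?subr_gt0//; apply: le_trans.
rewrite -enormN (_ : - _ = Z t - Z s - (t - s) *: w)//.
by apply/rowP => i; rewrite !mxE; ring.
Qed.

Lemma exhausting_seq (J : set R) (b : R) : J 0 -> (forall t, J t -> t <= b) ->
  exists2 s_ : nat -> R, forall j, J (s_ j) &
    forall t, J t -> \forall j \near \oo, t <= s_ j.
Proof.
move=> J0 Jb; have hs : has_sup J by split; [exists 0|exists b => t /Jb].
have [Js|Js] := pselect (J (sup J)).
  by exists (fun=> sup J) => // t Jt; apply: nearW => _; exact: sup_upper_bound.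
have H (j : nat) : exists s, J s /\ sup J - j.+1%:R^-1 < s.
  by have [|s Jx xs] := @sup_adherent _ J j.+1%:R^-1 _ hs; [|exists s].
exists (fun j => projT1 (cid (H j))) => [j|t Jt]; first by case: cid => s [].
have tJ : 0 < sup J - t.
  rewrite subr_gt0 lt_neqAle sup_upper_bound// andbT; apply/eqP => tE.
  by apply: Js; rewrite -tE.
near=> j; case: cid => /= s [Jx xs].
have : j.+1%:R^-1 < sup J - t by near: j; exact: (near_infty_natSinv_lt (PosNum tJ)).
set x : R := _^-1 in xs * => xJ; rewrite ltW//; lra.
Unshelve. all: by end_near. Qed.

(** The approximations follow [z] up to a point [s_ j] of [J] and continue by Euler steps. As the
    [s_ j] exhaust [J], the limit agrees with [z] there, even if [J] is open on the right. *)
Lemma peano_bounded F (T B : R) (J : set R) (z : R -> 'rV[R]_k) :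
  continuous F -> 0 <= B ->
  (forall (t : R) z, 0 <= t <= T -> enorm (F (t, z)) <= B) ->
  is_interval J -> J 0 -> (forall t, J t -> 0 <= t <= T) ->
  (forall t, J t -> deriv_within J z t (F (t, z t))) ->
  exists phi, (forall t : R, 0 <= t <= T -> deriv_within `[0, T] phi t (F (t, phi t))) /\
    forall t, J t -> phi t = z t.
Proof.
move=> cF B0 FB itvJ J0 JT zF.
have [s_ Js sE] := exhausting_seq J0 (fun t Jt => proj2 (andP (JT t Jt))).
have s0 j : 0 <= s_ j by have /andP[] := JT _ (Js j).
have [U [UU sU]] := ultraFilterLemma (@eventually_filter : ProperFilter \oo).
pose Z_ j (t : R) := if t <= s_ j then z t else euler_path F (s_ j) j.+1%:R^-1 (z (s_ j)) t.
have h0 j : 0 < j.+1%:R^-1 :> R by rewrite invr_gt0 ltr0n.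
have [] := @approx_solution_limit F T B U (fun j => j.+1%:R^-1) Z_ (z 0) UU cF B0 FB h0.
- apply: cvg_trans (@cvg_app _ _ _ _ (fun j : nat => j.+1%:R^-1 : R) sU) _.
  exact: cvg_harmonic.
- move=> j; apply: (approx_solution_glue (a := s_ j) (z := z)) => //.
  + move=> t /andP[t0 ts]; apply: deriv_withinS (zF t _) => [r /=|].
      by rewrite in_itv/=; exact: itvJ.
    by apply: (itvJ _ _ J0 (Js j)); rewrite t0.
  + by move=> t ts; rewrite /Z_ ts.
  + move=> t; rewrite le_eqVlt => /predU1P[<-|st].
      rewrite /Z_ lexx -[X in euler_path _ _ _ _ X](addr0 (s_ j)) -(mul0r j.+1%:R^-1).
      by rewrite (euler_pathS _ _ _ 0).
    by rewrite /Z_ leNgt st.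
- by move=> j; rewrite /Z_ s0.
move=> Z [ZU ZF]; exists Z; split => // t Jt.
apply: (@cvg_unique _ (@norm_hausdorff _ _) (Z_ j t @[j --> U])).
  exact: ZU (JT t Jt).
apply: cvg_near_cst; apply: sU; apply: filterS (sE t Jt) => j tj.
by rewrite /Z_ tj.
Qed.

(** The radial retraction onto the ball of radius [rho]. *)
Definition clampv (rho : R) z := (rho / Num.max rho (enorm z)) *: z.

Lemma clampv_continuous (rho : R) : 0 < rho -> continuous (clampv rho).
Proof.
move=> r0 z; apply: (@cvgZ _ _ _ (nbhs z)); last exact: cvg_id.
apply: (@cvgM _ _ (nbhs z)); first exact: cvg_cst.
apply: (@cvgV _ _ (nbhs z)); first by rewrite gt_eqF// lt_max r0.
apply: (@continuous_comp _ _ _ (@enorm R k) (Num.max rho)); first exact: enorm_continuous.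
move=> x; apply: (@continuous_max _ _ (cst rho) id); [exact: cst_continuous|exact: cvg_id].
Qed.

Lemma clampv_le (rho : R) z : 0 < rho -> enorm (clampv rho z) <= rho.
Proof.
move=> r0; have m0 : 0 < Num.max rho (enorm z) by rewrite lt_max r0.
rewrite enormZ ger0_norm ?(divr_ge0 (ltW r0) (ltW m0))// mulrAC ler_pdivrMr// ler_pM2l//.
by rewrite le_max lexx orbT.
Qed.

Lemma clampv_id (rho : R) z : 0 < rho -> enorm z <= rho -> clampv rho z = z.
Proof. by move=> r0 zr; rewrite /clampv max_l// divff ?gt_eqF// scale1r. Qed.

(** Retracting to the ball of radius [rho + 1] makes the field bounded. The a priori bound [rho]
    concerns solutions of the original equation, which the new curve solves as long as it stays in
    the larger ball; [real_induction] uses the gap to show that it never leaves. *)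
Lemma peano_extension F (T rho : R) (J : set R) (z : R -> 'rV[R]_k) :
  continuous F -> 0 <= T -> 0 <= rho ->
  is_interval J -> J 0 -> (forall t, J t -> 0 <= t <= T) ->
  (forall t, J t -> deriv_within J z t (F (t, z t))) ->
  (forall (b : R) (phi : R -> 'rV[R]_k), 0 <= b <= T -> phi 0 = z 0 ->
     (forall t : R, 0 <= t <= b -> deriv_within `[0, b] phi t (F (t, phi t))) ->
     enorm (phi b) <= rho) ->
  exists phi, (forall t : R, 0 <= t <= T -> deriv_within `[0, T] phi t (F (t, phi t))) /\
    forall t, J t -> phi t = z t.
Proof.
move=> cF T0 rho0 itvJ J0 JT zF apri.
have r1 : 0 < rho + 1 by rewrite ltr_wpDl.
pose G (p : R * 'rV[R]_k) := F (p.1, clampv (rho + 1) p.2).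
have cG : continuous G.
  move=> p; apply: (continuous_comp (f := fun p => (p.1, clampv (rho + 1) p.2)) (g := F)).
    apply: (@cvg_pair2 _ _ _ (nbhs p)) => /=; first exact: cvg_fst.
    by apply: continuous_comp; [exact: cvg_snd|exact: clampv_continuous].
  exact: cF.
have [B B0 GB] : exists2 B, 0 <= B & forall (t : R) z, 0 <= t <= T -> enorm (G (t, z)) <= B.
  have cK : compact (F @` (`[0, T]%classic `*` [set z | enorm z <= rho + 1])).
    apply: continuous_compact; first exact: continuous_subspaceT.
    by apply: compact_setX; [exact: segment_compact|exact: enorm_ball0_compact].
  have [B B0 HB] := compact_enorm_bounded cK; exists B => [|t y tT]; first exact: ltW.
  apply: HB; exists (t, clampv (rho + 1) y) => //; split => /=; first by rewrite in_itv.
  exact: clampv_le.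
have zrho t : J t -> enorm (z t) <= rho.
  move=> Jt; apply: (apri t z) => //; first exact: JT.
  move=> s /andP[s0 st]; apply: deriv_withinS (zF s _) => [r /=|].
    by rewrite in_itv/=; exact: itvJ.
  by apply: (itvJ _ _ J0 Jt); rewrite s0.
have [phi [phiG phiz]] : exists phi,
    (forall t : R, 0 <= t <= T -> deriv_within `[0, T] phi t (G (t, phi t))) /\
    forall t, J t -> phi t = z t.
  apply: (peano_bounded cG B0 GB itvJ J0 JT) => t Jt.
  by rewrite /G/= clampv_id//; [exact: zF|rewrite (le_trans (zrho t Jt))// lerDl].
have nearphi (t e : R) : 0 <= t <= T -> 0 < e -> exists2 del : R, 0 < del &
    forall s : R, 0 <= s <= T -> `|s - t| < del -> enorm (phi s - phi t) < e.
  move=> tT e0; have [del del0 Hd] := (deriv_withinP _ _ _ _).1 (phiG t tT) 1 ltr01.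
  set w := G _ in Hd; have w1 : 0 < enorm w + 2 by rewrite ltr_wpDl ?enorm_ge0.
  exists (Num.min del (e / (enorm w + 2))); first by rewrite lt_min del0 divr_gt0.
  move=> s sT; rewrite lt_min => /andP[sd]; rewrite ltr_pdivlMr// => se.
  have := Hd s; rewrite /= in_itv/= => /(_ sT sd) H.
  have -> : phi s - phi t = (phi s - phi t - (s - t) *: w) + (s - t) *: w by rewrite subrK.
  apply: le_lt_trans (enormD _ _) _; rewrite enormZ.
  have [s0|s0] := eqVneq s t.
    by move: H; rewrite s0 !subrr normr0 mulr0 mul0r addr0 => /le_lt_trans; apply.
  have : 0 < `|s - t| by rewrite normr_gt0 subr_eq0.
  by elra.
have bound : forall t : R, 0 <= t <= T -> enorm (phi t) <= rho.
  have sol (b : R) : 0 <= b <= T -> (forall s : R, 0 <= s <= b -> enorm (phi s) <= rho + 1) ->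
      enorm (phi b) <= rho.
    move=> /andP[b0 bT] Hb; apply: (apri b phi); first by rewrite b0.
      exact: phiz.
    move=> t /andP[t0 tb]; have tT : 0 <= t <= T by rewrite t0 (le_trans tb).
    have := phiG t tT; rewrite /G/= clampv_id//; last by apply: Hb; rewrite t0.
    apply: deriv_withinS => r /=; rewrite !in_itv/= => /andP[-> rb] /=.
    exact: le_trans bT.
  apply: real_induction => //; first by rewrite phiz//; exact: zrho.
  - move=> t /andP[t0 tT] H; have tT' : 0 <= t <= T by rewrite t0 ltW.
    have [del del0 Hd] := nearphi t 1 tT' ltr01; exists del => // s /andP[ts std] sT.
    apply: sol; first by rewrite sT andbT; lra.
    move=> r /andP[r0 rs]; have [rt|rt] := leP r t.
      by apply: le_trans (H r _) _; rewrite ?r0// lerDl.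
    have rd : r - t < del by lra.
    have := Hd r; rewrite r0 (le_trans rs sT) gtr0_norm ?subr_gt0// => /(_ isT rd) h1.
    have := enormB (phi r) (phi t) 0; rewrite !subr0 => h2.
    have := H t; rewrite t0 lexx => /(_ isT) h3; elra.
  - move=> t /andP[t0 tT] H; have tT' : 0 <= t <= T by rewrite ltW.
    apply: sol => // r /andP[r0 rt]; move: rt; rewrite le_eqVlt => /predU1P[->|rt]; last first.
      by apply: le_trans (H r _) _; rewrite ?r0// lerDl.
    have [del del0 Hd] := nearphi t 1 tT' ltr01.
    pose s := Num.max 0 (t - del / 2).
    have s1 : 0 <= s by rewrite /s le_max lexx.
    have s2 : s < t by rewrite /s gt_max t0/=; lra.
    have s3 : t - del / 2 <= s by rewrite /s le_max lexx orbT.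
    have sd : t - s < del by lra.
    have := Hd s; rewrite s1 (le_trans (ltW s2) tT) distrC gtr0_norm ?subr_gt0//.
    move=> /(_ isT sd) h1.
    have := enormB (phi t) (phi s) 0; rewrite !subr0 enorm_distC => h2.
    have := H s; rewrite s1 s2 => /(_ isT) h3; elra.
exists phi; split => // t tT; have := phiG t tT; rewrite /G /= clampv_id//.
by apply: le_trans (bound t tT) _; rewrite lerDl.
Qed.

End PeanoExtension.

(** * Solutions of the slow-fast system *)

Section RowMx.
Context {R : realType} {n m : nat}.
Implicit Types (x : 'rV[R]_n) (y : 'rV[R]_m) (z : 'rV[R]_(n + m)).

Lemma enorm_row_mx_sqr x y : enorm (row_mx x y) ^+ 2 = enorm x ^+ 2 + enorm y ^+ 2.
Proof.
rewrite !enorm_sqr /dotv big_split_ord/=.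
by congr (_ + _); apply: eq_bigr => i _; rewrite ?row_mxEl ?row_mxEr.
Qed.

Lemma enorm_row_mx x y : enorm (row_mx x y) <= enorm x + enorm y.
Proof.
rewrite -ler_sqr ?nnegrE ?addr_ge0 ?enorm_ge0// enorm_row_mx_sqr sqrrD.
by have := mulr_ge0 (enorm_ge0 x) (enorm_ge0 y); lra.
Qed.

Lemma enorm_lsubmx z : enorm (lsubmx z) <= enorm z.
Proof.
rewrite -ler_sqr ?nnegrE ?enorm_ge0// -[in leRHS](hsubmxK z) enorm_row_mx_sqr.
by rewrite lerDl sqr_ge0.
Qed.

Lemma enorm_rsubmx z : enorm (rsubmx z) <= enorm z.
Proof.
rewrite -ler_sqr ?nnegrE ?enorm_ge0// -[in leRHS](hsubmxK z) enorm_row_mx_sqr.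
by rewrite lerDr sqr_ge0.
Qed.

Lemma lsubmx_continuous : continuous (@lsubmx R 1 n m).
Proof.
move=> z; apply/(@enorm_cvgP _ _ _ (nbhs z)) => e e0; apply/nbhs_enormP.
exists e => // w; have := enorm_lsubmx (w - z).
by rewrite linearB/= => h1 h2; exact: le_lt_trans h1 h2.
Qed.

Lemma rsubmx_continuous : continuous (@rsubmx R 1 n m).
Proof.
move=> z; apply/(@enorm_cvgP _ _ _ (nbhs z)) => e e0; apply/nbhs_enormP.
exists e => // w; have := enorm_rsubmx (w - z).
by rewrite linearB/= => h1 h2; exact: le_lt_trans h1 h2.
Qed.

Lemma cvg_row_mx (T : Type) (F : set_system T) {FF : Filter F} (f : T -> 'rV[R]_n)
    (g : T -> 'rV[R]_m) x y :
  f t @[t --> F] --> x -> g t @[t --> F] --> y ->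
  row_mx (f t) (g t) @[t --> F] --> row_mx x y.
Proof.
move=> /enorm_cvgP fx /enorm_cvgP gy; apply/enorm_cvgP => e e0.
have e2 : 0 < e / 2 by lra.
apply: filterS2 (fx _ e2) (gy _ e2) => t; rewrite opp_row_mx add_row_mx.
by have := enorm_row_mx (f t - x) (g t - y); elra.
Qed.

Lemma deriv_within_lsubmx (I : set R) (Z : R -> 'rV[R]_(n + m)) (t : R) z :
  deriv_within I Z t z -> deriv_within I (fun s => lsubmx (Z s)) t (lsubmx z).
Proof.
move=> /deriv_withinP HZ; apply/deriv_withinP => e e0.
have [del del0 H] := HZ e e0; exists del => // s Is sd.
by rewrite -linearZ/= -!linearB/= (le_trans (enorm_lsubmx _)) ?H.
Qed.

Lemma deriv_within_rsubmx (I : set R) (Z : R -> 'rV[R]_(n + m)) (t : R) z :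
  deriv_within I Z t z -> deriv_within I (fun s => rsubmx (Z s)) t (rsubmx z).
Proof.
move=> /deriv_withinP HZ; apply/deriv_withinP => e e0.
have [del del0 H] := HZ e e0; exists del => // s Is sd.
by rewrite -linearZ/= -!linearB/= (le_trans (enorm_rsubmx _)) ?H.
Qed.

End RowMx.

Lemma deriv_within_row_mx (R : realType) (n m : nat) (I : set R)
    (X : R -> 'rV[R]_n) (Y : R -> 'rV[R]_m) (t : R) v w :
  deriv_within I X t v -> deriv_within I Y t w ->
  deriv_within I (fun s => row_mx (X s) (Y s)) t (row_mx v w).
Proof.
move=> /deriv_withinP HX /deriv_withinP HY; apply/deriv_withinP => e e0.
have e2 : 0 < e / 2 by lra.
have [d1 d10 H1] := HX _ e2; have [d2 d20 H2] := HY _ e2.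
exists (Num.min d1 d2) => [|s Is]; first by rewrite lt_min d10.
rewrite lt_min => /andP[sd1 sd2]; have := H1 s Is sd1; have := H2 s Is sd2.
rewrite scale_row_mx opp_row_mx add_row_mx opp_row_mx add_row_mx.
have := enorm_row_mx (X s - X t - (s - t) *: v) (Y s - Y t - (s - t) *: w).
by elra.
Qed.

Section SlowFast.
Context {R : realType} {n m : nat}.
Context (f : 'rV[R]_n * 'rV[R]_m -> 'rV[R]_n) (g : vfield R n m).
Context (d : vfield R n m -> vfield R n m -> R).
Hypotheses (hd : metrizes (hull g) d) (hf : continuous f).
Context (a b : R).
Hypotheses (ha : 0 < a) (hb : 0 < b).
Hypothesis hfab : forall x y, enorm (f (x, y)) <= a + b * enorm x.
Hypotheses (hadm : admissible g) (hlip : lipschitz_in_y g).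
Hypothesis hglob : forall h : vfield R n m,
  (exists2 tau0 : R, 0 <= tau0 & h = tshift g tau0) \/ omega_limit g h ->
  forall (x : 'rV[R]_n) (y : 'rV[R]_m), exists phi, fast_solution h x 0 y phi.
Hypothesis hbound : forall K0 : set 'rV[R]_n, compact K0 -> ultimately_bounded g K0.
Context (x0 : 'rV[R]_n) (y0 : 'rV[R]_m).

Local Notation sol eps c := (slow_fast_solution f g x0 y0 eps `[0, c]%classic).

Lemma slow_fast_solutionS (eps : R) (I J : set R) X Y : J `<=` I ->
  slow_fast_solution f g x0 y0 eps I X Y -> slow_fast_solution f g x0 y0 eps J X Y.
Proof.
move=> JI [X0 Y0 XY]; split => // t Jt; have [dX [v dY vE]] := XY t (JI t Jt).
by split; [exact: deriv_withinS dX|exists v => //; exact: deriv_withinS dY].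
Qed.

(** Linear growth gives |f|^2 <= 2 a^2 + 2 b^2 |X|^2, whatever [Y] is; this is the hypothesis of
    [gronwall_sqr] for [A = 1 + 2 * b ^+ 2] and [A * B = 2 * a ^+ 2]. *)
Lemma slow_bounded (t0 : R) : exists2 Rx : R, 0 < Rx &
  forall (eps c : R) X Y, c <= t0 -> sol eps c X Y ->
  forall t : R, 0 <= t <= c -> enorm (X t) <= Rx.
Proof.
pose A := 1 + 2 * b ^+ 2; pose B := 2 * a ^+ 2 / A.
have A0 : 0 < A by have := sqr_ge0 b; rewrite /A; lra.
have B0 : 0 <= B by rewrite /B divr_ge0 ?mulr_ge0 ?sqr_ge0// ltW.
pose Q := (enorm x0 ^+ 2 + B) * expR (A * t0).
have Q0 : 0 <= Q by rewrite /Q mulr_ge0 ?addr_ge0 ?sqr_ge0 ?expR_ge0.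
(* [Q] bounds the squared norm, and |X|^2 <= Q implies |X| <= Q + 1. *)
exists (Q + 1) => [|eps c X Y ct0 XY t /andP[t0' tc]]; first by rewrite ltr_wpDl.
have [X0 Y0 {}XY] := slow_fast_solutionS (I := `[0, c]%classic) (J := `[0, t]%classic)
  (fun s => ltac:(by rewrite /= !in_itv/= => /andP[-> st]; exact: le_trans tc)) XY.
have := @gronwall_sqr _ _ X (fun s => f (X s, Y s)) 0 t A B t0'.
rewrite subr0 X0 => H.
have {}H : enorm (X t) ^+ 2 + B <= (enorm x0 ^+ 2 + B) * expR (A * t).
  apply: H => s st; first by have [] := XY s ltac:(by rewrite /= in_itv).
  have -> : A * B = 2 * a ^+ 2 by rewrite /B mulrCA divff ?mulr1// gt_eqF.
  rewrite /A addrAC subrr add0r.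
  have := hfab (X s) (Y s); have := enorm_ge0 (X s); have := enorm_ge0 (f (X s, Y s)).
  set u := enorm (X s); set v := enorm _ => v0 u0 vu.
  have : v ^+ 2 <= (a + b * u) ^+ 2 by rewrite ler_sqr ?nnegrE// (le_trans v0).
  by have := sqr_ge0 (a - b * u); rewrite !sqrrD sqrrN; nra.
have : (enorm x0 ^+ 2 + B) * expR (A * t) <= Q.
  rewrite /Q ler_wpM2l ?addr_ge0 ?sqr_ge0// ler_expR ler_pM2l//.
  exact: le_trans ct0.
have := sqr_ge0 (enorm (X t) - 1); rewrite sqrrB.
by move: H; set u := enorm _; set v := _ * expR _; lra.
Qed.

Lemma slow_lipschitz (eps c r : R) X Y : sol eps c X Y ->
  (forall t : R, 0 <= t <= c -> enorm (X t) <= r) ->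
  forall s t : R, 0 <= s <= c -> 0 <= t <= c ->
    enorm (X t - X s) <= (a + b * r) * `|t - s|.
Proof.
move=> [_ _ XY] Xr.
have main (s t : R) : 0 <= s -> s <= t -> t <= c -> enorm (X t - X s) <= (a + b * r) * (t - s).
  move=> s0 st tc.
  have sub (u : R) : s <= u <= t -> 0 <= u <= c.
    by move=> /andP[su ut]; rewrite (le_trans s0 su) (le_trans ut tc).
  have := @mean_value_le _ _ X (fun s => f (X s, Y s)) s t 0 (a + b * r) st.
  rewrite scaler0 subr0; apply=> u ust.
    have [dX _] := XY u ltac:(by rewrite /= in_itv/=; exact: sub).
    by apply: deriv_withinS dX => v /=; rewrite !in_itv/=; exact: sub.
  by rewrite subr0 (le_trans (hfab _ _))// lerD2l ler_pM2l// Xr// sub.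
move=> s t /andP[s0 sc] /andP[t0 tc]; have [st|ts] := leP s t.
  by rewrite ger0_norm ?subr_ge0//; exact: main.
by rewrite enorm_distC distrC gtr0_norm ?subr_gt0//; apply: main => //; exact: ltW.
Qed.

Lemma fast_deriv (eps c s l : R) X Y : sol eps c X Y -> 0 < eps -> 0 <= s ->
  eps * (s + l) <= c -> forall t : R, 0 <= t <= l ->
  deriv_within `[0, l] (fun t => Y (eps * (t + s))) t
    (g (X (eps * (t + s)), Y (eps * (t + s)), t + s)).
Proof.
move=> [_ _ XY] e0 s0 slc t tl.
have sub (u : R) : 0 <= u <= l -> 0 <= eps * u + eps * s <= c.
  move=> /andP[u0 ul]; rewrite -mulrDr mulr_ge0 ?addr_ge0// ?(ltW e0)//=.
  by apply: le_trans slc; rewrite ler_pM2l// addrC lerD2l.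
have [_ [v dY vE]] := XY (eps * t + eps * s) ltac:(by rewrite /= in_itv/=; exact: sub).
have -> : (fun t => Y (eps * (t + s))) = (fun t => Y (eps * t + eps * s)).
  by apply/funext => u; rewrite mulrDr.
rewrite mulrDr (_ : g _ = eps *: v); last first.
  by rewrite vE -mulrDr mulrAC divff ?mul1r// gt_eqF.
apply: deriv_within_scale dY => u; rewrite /= !in_itv/=; exact: sub.
Qed.

Lemma slow_fast_track (r T e : R) : 0 <= T -> 0 < e ->
  exists M del : R, [/\ 0 < M, 0 < del &
  forall (eps c s l : R) X Y h x y, sol eps c X Y -> 0 < eps -> 0 <= s ->
    0 <= l <= T -> eps * (s + l) <= c ->
    (forall t : R, 0 <= t <= c -> enorm (X t) <= r) ->
    Hplus g h -> enorm x <= r -> enorm y <= r ->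
    (forall p, box M T p -> enorm (tshift g s p - h p) <= del) ->
    (forall t : R, 0 <= t <= l -> enorm (X (eps * (t + s)) - x) < del) ->
    enorm (Y (eps * s) - y) <= del ->
    forall t : R, 0 <= t <= l ->
      enorm (flow h x y t) <= M /\ enorm (Y (eps * (t + s)) - flow h x y t) <= e].
Proof.
clear a b ha hb hfab; move=> T0 e0; have [M0 M00 [MB MP]] := flow_perturb hd hadm hlip hglob r T0.
have [eta eta0 Heta] := MP e e0.
pose M := Num.max r (M0 + 1).
have eta2 : 0 < eta / 2 by lra.
have [del del0 Hdel] := hull_uniform_continuous hadm M eta2.
have rM : r <= M by rewrite /M le_max lexx.
have M0M : M0 + 1 <= M by rewrite /M le_max lexx orbT.
exists M, (Num.min del (eta / 2)); split; [lra|by rewrite lt_min del0|].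
move=> eps c s l X Y h x y XY eps0 s0 lT slc Xr Hh xr yr gh Xx Yy t tl.
have /andP[l0 lT'] := lT; have /andP[t0 tl'] := tl.
split; first by apply: (le_trans (MB h x y t Hh xr yr _)); [rewrite t0 (le_trans tl')|lra].
have := Heta h x y (fun t => Y (eps * (t + s))) _ l Hh xr yr lT (fast_deriv XY eps0 s0 slc).
rewrite add0r; apply=> //.
  by apply: le_trans Yy _; apply: le_trans (_ : eta / 2 <= _); [rewrite ge_min lexx orbT|lra].
move=> u /andP[u0 ul]; set y' := Y _ => y'M.
set x' := X _.
have x'r : enorm x' <= r.
  apply: Xr; rewrite mulr_ge0 ?addr_ge0 ?(ltW eps0)//=.
  by apply: le_trans slc; rewrite ler_pM2l// addrC lerD2l.
have h1 : enorm (tshift g s (x', y', u) - h (x', y', u)) <= eta / 2.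
  apply: le_trans (gh _ _) _; last by rewrite ge_min lexx orbT.
  split => /=; [exact: le_trans rM|exact: le_trans M0M|].
  by rewrite ger0_norm// (le_trans ul).
have h2 : enorm (h (x', y', u) - h (x, y', u)) <= eta / 2.
  apply: Hdel; rewrite ?subrr ?enorm0 ?normr0//.
  - exact: Hplus_hull.
  - exact: le_trans rM.
  - exact: le_trans M0M.
  - exact: le_trans rM.
  - exact: le_trans M0M.
  - by have := Xx u; rewrite u0 ul lt_min => /(_ isT) /andP[].
apply: le_trans (enormB _ (h (x', y', u)) _) _.
by rewrite /tshift /= in h1; elra.
Qed.

Lemma fast_bounded (t0 : R) : exists Ry eps1 : R, [/\ 0 < Ry, 0 < eps1 &
  forall (eps c : R) X Y, 0 < eps < eps1 -> c <= t0 -> sol eps c X Y ->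
  forall t : R, 0 <= t <= c -> enorm (Y t) <= Ry].
Proof.
have [Rx Rx0 HX] := slow_bounded t0.
have [c1 c10 Habs] := flow_absorb hd hadm hlip hglob (hbound (@enorm_ball0_compact R n Rx)).
pose rho := Num.max (c1 + 1) (enorm y0).
have rho1 : c1 + 1 <= rho by rewrite /rho le_max lexx.
have rho2 : enorm y0 <= rho by rewrite /rho le_max lexx orbT.
have [T T0 HT] := Habs rho ltac:(lra).
have T1 : 0 < T + 1 by lra.
have [M [del [M0 del0 Htr]]] := slow_fast_track (Num.max Rx rho) (ltW T1) ltr01.
have ab0 : 0 < (a + b * Rx) * (T + 1) by rewrite mulr_gt0// addr_gt0// mulr_gt0.
(* Below this [eps] the slow variable moves by less than [del] during one block. *)
exists (M + 1), (del / ((a + b * Rx) * (T + 1))); split; [lra|by rewrite divr_gt0|].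
move=> eps c X Y /andP[eps0]; rewrite ltr_pdivlMr// => eps1 ct0 XY.
have Xr := HX eps c X Y ct0 XY.
have XL := slow_lipschitz XY Xr.
have rr : Rx <= Num.max Rx rho by rewrite le_max lexx.
have rr' : rho <= Num.max Rx rho by rewrite le_max lexx orbT.
have block (s l : R) : 0 <= s -> 0 <= l <= T + 1 -> eps * (s + l) <= c ->
    enorm (Y (eps * s)) <= rho ->
    enorm (flow (tshift g s) (X (eps * s)) (Y (eps * s)) l) <= M /\
    enorm (Y (eps * (l + s)) - flow (tshift g s) (X (eps * s)) (Y (eps * s)) l) <= 1.
  move=> s0 lT slc Yr; have /andP[l0 lT'] := lT.
  have es0 : 0 <= eps * s by rewrite mulr_ge0// ltW.
  have esc : eps * s <= c by apply: le_trans slc; rewrite ler_pM2l// lerDl.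
  apply: (Htr eps c s l X Y (tshift g s)) => //; try exact: le_trans rr'.
  - by move=> t tc; apply: le_trans rr; exact: Xr.
  - exact: Hplus_orbit.
  - by apply: le_trans rr; apply: Xr; rewrite es0.
  - by move=> p _; rewrite subrr enorm0 ltW.
  - move=> t /andP[t0' tl]; apply: le_lt_trans (XL (eps * s) _ _ _) _.
    + by rewrite es0.
    + rewrite mulr_ge0 ?addr_ge0 ?(ltW eps0)//=.
      by apply: le_trans slc; rewrite ler_pM2l// addrC lerD2l.
    + rewrite -mulrBr addrK normrM !ger0_norm// ?(ltW eps0)//.
      rewrite mulrCA; apply: le_lt_trans eps1; rewrite ler_pM2l//.
      by rewrite ler_pM2l ?addr_gt0 ?mulr_gt0//; exact: le_trans lT'.
  - by rewrite subrr enorm0 ltW.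
  - by rewrite l0 lexx.
have [X0 Y0 _] := XY.
have step (i : nat) : eps * (i%:R * (T + 1)) <= c -> enorm (Y (eps * (i%:R * (T + 1)))) <= rho.
  elim: i => [|i IH ic]; first by rewrite mul0r mulr0 Y0.
  have iE : i.+1%:R * (T + 1) = T + 1 + i%:R * (T + 1) by rewrite -natr1; ring.
  have i0 : 0 <= i%:R * (T + 1) by rewrite mulr_ge0// ltW.
  have ic' : eps * (i%:R * (T + 1) + (T + 1)) <= c by rewrite addrC -iE.
  have ic2 : eps * (i%:R * (T + 1)) <= c by apply: le_trans ic'; rewrite ler_pM2l// lerDl ltW.
  have [] := block (i%:R * (T + 1)) (T + 1) i0 _ ic' (IH ic2); first by rewrite ltW/=.
  rewrite -iE => _.
  have H : enorm (flow (tshift g (i%:R * (T + 1))) (X (eps * (i%:R * (T + 1))))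
      (Y (eps * (i%:R * (T + 1)))) (T + 1)) <= c1.
    apply: HT; [exact: Hplus_orbit|apply: Xr|exact: IH|lra].
    by rewrite mulr_ge0 ?(ltW eps0).
  set u := Y _; set v := flow _ _ _ _ in H *.
  by have := enormB u v 0; rewrite !subr0; elra.
move=> t /andP[t0' tc].
(* The block containing [t] may be incomplete, which is why [block] allows every length up to
   [T + 1]. *)
pose i := Num.truncn (t / eps / (T + 1)).
have te0 : 0 <= t / eps by rewrite divr_ge0// ltW.
have /andP[i1 i2] : (i%:R : R) <= t / eps / (T + 1) < i.+1%:R.
  by apply: truncn_itv; rewrite divr_ge0// ltW.
rewrite ler_pdivlMr// in i1; rewrite ltr_pdivrMr// -natr1 in i2.
have tE : eps * (i%:R * (T + 1) + (t / eps - i%:R * (T + 1))) = t.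
  by rewrite addrCA subrr addr0 mulrC divfK// gt_eqF.
have i0 : 0 <= i%:R * (T + 1) by rewrite mulr_ge0// ltW.
have [] := block (i%:R * (T + 1)) (t / eps - i%:R * (T + 1)) i0 _ _ (step i _).
- by apply/andP; split; lra.
- by rewrite tE.
- by apply: le_trans tc; rewrite -tE ler_pM2l//; lra.
have tE' : eps * (t / eps) = t by rewrite mulrC divfK// gt_eqF.
rewrite subrK tE'; set v := flow _ _ _ _ => h1 h2.
by have := enormB (Y t) v 0; rewrite !subr0; elra.
Qed.

(** The pair is one curve in dimension [n + m]. Its continuation need not be unique, so
    [peano_extension] is fed with bounds valid for every solution from the same initial point. *)
Lemma slow_fast_extends (t0 : R) : 0 < t0 -> exists2 eps1 : R, 0 < eps1 &
  forall eps I X Y, 0 < eps < eps1 -> is_interval I -> I 0 ->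
    (forall t, I t -> 0 <= t) -> slow_fast_solution f g x0 y0 eps I X Y ->
    exists X' Y', extends_to f g x0 y0 t0 eps I X Y X' Y'.
Proof.
move=> t00; have [Rx Rx0 HX] := slow_bounded t0.
have [Ry [eps1 [Ry0 eps10 HY]]] := fast_bounded t0.
exists eps1 => // eps I X Y epsr itvI I0 Ige XY.
have eps0 : 0 < eps by have /andP[] := epsr.
pose F (p : R * 'rV[R]_(n + m)) : 'rV[R]_(n + m) :=
  row_mx (f (lsubmx p.2, rsubmx p.2)) (eps^-1 *: g (lsubmx p.2, rsubmx p.2, p.1 / eps)).
have cF : continuous F.
  move=> p.
  have cl : lsubmx q.2 @[q --> p] --> lsubmx p.2.
    by apply: (@continuous_comp _ _ _ snd (@lsubmx R 1 n m)); [exact: cvg_snd|exact: lsubmx_continuous].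
  have cr : rsubmx q.2 @[q --> p] --> rsubmx p.2.
    by apply: (@continuous_comp _ _ _ snd (@rsubmx R 1 n m)); [exact: cvg_snd|exact: rsubmx_continuous].
  have c2 : (lsubmx q.2, rsubmx q.2) @[q --> p] --> (lsubmx p.2, rsubmx p.2).
    exact: cvg_pair2.
  apply: cvg_row_mx; first exact: (cvg_comp _ _ c2 (@hf _)).
  apply: cvgZl_tmp.
  have c3 : (lsubmx q.2, rsubmx q.2, q.1 / eps) @[q --> p] --> (lsubmx p.2, rsubmx p.2, p.1 / eps).
    by apply: cvg_pair2 => //; apply: cvgMl; exact: cvg_fst.
  by apply: (cvg_comp _ _ c3); exact: (admissible_continuous hadm).
have toF (J : set R) X1 Y1 : slow_fast_solution f g x0 y0 eps J X1 Y1 ->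
    forall t, J t -> deriv_within J (fun s => row_mx (X1 s) (Y1 s)) t (F (t, row_mx (X1 t) (Y1 t))).
  move=> [_ _ H] t Jt; have [dX [v dY vE]] := H t Jt.
  rewrite /F /= !row_mxKl !row_mxKr; apply: deriv_within_row_mx => //.
  by rewrite -vE scalerA mulVf ?scale1r// gt_eqF.
have ofF (c : R) (phi : R -> 'rV[R]_(n + m)) : phi 0 = row_mx x0 y0 ->
    (forall t : R, 0 <= t <= c -> deriv_within `[0, c] phi t (F (t, phi t))) ->
    sol eps c (lsubmx \o phi) (rsubmx \o phi).
  move=> phi0 H; split => /=; [by rewrite phi0 row_mxKl|by rewrite phi0 row_mxKr|].
  move=> t; rewrite /= in_itv/= => tc; split.
    by have := deriv_within_lsubmx (H t tc); rewrite /F/= row_mxKl.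
  exists (eps^-1 *: g (lsubmx (phi t), rsubmx (phi t), t / eps)).
    by have := deriv_within_rsubmx (H t tc); rewrite /F/= row_mxKr.
  by rewrite scalerA mulfV ?scale1r// gt_eqF.
pose J := I `&` [set t : R | t <= t0].
have JT t : J t -> 0 <= t <= t0 by move=> [/Ige -> /= ->].
have itvJ : is_interval J.
  move=> u v [Iu _] [Iv vt0] w uwv; split; first exact: itvI uwv.
  by have /andP[_ wv] := uwv; exact: le_trans vt0.
have J0 : J 0 by split => //=; exact: ltW.
have [X0 Y0 _] := XY.
have [||phi [phiF phiE]] := @peano_extension R (n + m) F t0 (Rx + Ry) J
    (fun s => row_mx (X s) (Y s)) cF (ltW t00) _ itvJ J0 JT
    (toF J X Y (slow_fast_solutionS (@subIsetl _ _ _) XY)).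
- by rewrite addr_ge0// ltW.
- move=> c phi /andP[c0 ct0]; rewrite X0 Y0 => phi0 phiF.
  have S := ofF c phi phi0 phiF.
  rewrite -(hsubmxK (phi c)); apply: le_trans (enorm_row_mx _ _) _; apply: lerD.
    by apply: (HX eps c _ _ ct0 S c); rewrite c0 lexx.
  by apply: (HY eps c _ _ epsr ct0 S c); rewrite c0 lexx.
exists (lsubmx \o phi), (rsubmx \o phi); split.
  by apply: ofF => //; rewrite phiE// X0 Y0.
by move=> t It tt0 /=; rewrite phiE ?row_mxKl ?row_mxKr.
Qed.

End SlowFast.

(** * Pullback attraction along the hull *)

Lemma uniform_enormP (R : realType) (k : nat) (T : Type) (F : set_system T) {FF : Filter F}
    (A : set R) (u : T -> R -> 'rV[R]_k) (v : R -> 'rV[R]_k) :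
  {uniform A, u x @[x --> F] --> v} <->
  forall e : R, 0 < e -> \forall x \near F, forall t, A t -> enorm (u x t - v t) < e.
Proof.
split=> [H e e0|H P /uniform_nbhs[E [+ HE]]].
  have ke : 0 < e / k.+1%:R by rewrite divr_gt0.
  have : F (u @^-1` [set w | forall t, A t -> ball (v t) (e / k.+1%:R) (w t)]).
    apply: H; apply/uniform_nbhs; exists [set xy | ball xy.1 (e / k.+1%:R) xy.2].
    by split => //; rewrite -entourage_ballE; exists (e / k.+1%:R).
  move=> H1; suff : F (fun x => forall t, A t -> enorm (u x t - v t) < e) by [].
  apply: filterS H1 => x Hx t At; have := Hx t At; rewrite -ball_normE /ball_/= => vt.
  rewrite enorm_distC; apply: le_lt_trans (enorm_le_norm _) _.
  apply: le_lt_trans (_ : k.+1%:R * `|v t - u x t| < _).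
    by rewrite ler_wpM2r// ler_nat.
  by rewrite mulrC -ltr_pdivlMr.
rewrite -entourage_ballE => -[e /= e0 eE].
have H1 : F (fun x => forall t, A t -> enorm (u x t - v t) < e) := H e e0.
suff : F (fun x => P (u x)) by [].
apply: filterS H1 => x Hx; apply: HE => t At; apply: eE; rewrite /= -ball_normE /ball_/=.
by rewrite distrC; apply: le_lt_trans (norm_le_enorm _) (Hx t At).
Qed.

Section PullbackClose.
Context {R : realType} {n m : nat}.
Context (f : 'rV[R]_n * 'rV[R]_m -> 'rV[R]_n) (g : vfield R n m).
Context (d : vfield R n m -> vfield R n m -> R).
Hypothesis hd : metrizes (hull g) d.
Context (a b : R).
Hypotheses (ha : 0 < a) (hb : 0 < b).
Hypothesis hfab : forall x y, enorm (f (x, y)) <= a + b * enorm x.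
Hypotheses (hadm : admissible g) (hlip : lipschitz_in_y g).
Hypothesis hglob : forall h : vfield R n m,
  (exists2 tau0 : R, 0 <= tau0 & h = tshift g tau0) \/ omega_limit g h ->
  forall (x : 'rV[R]_n) (y : 'rV[R]_m), exists phi, fast_solution h x 0 y phi.
Hypothesis hbound : forall K0 : set 'rV[R]_n, compact K0 -> ultimately_bounded g K0.
Context (x0 : 'rV[R]_n) (y0 : 'rV[R]_m).
Local Notation sol eps c := (slow_fast_solution f g x0 y0 eps `[0, c]%classic).

(** Compactness of the omega-limit set makes [del] independent of [h], as required by a constant
    chosen before the sequence of maps [h_i]. *)
Lemma metric_box_close (M T e : R) : 0 < e -> exists2 del : R, 0 < del &
  forall k h, hull g k -> omega_limit g h -> d k h < del ->
  forall p, box M T p -> enorm (k p - h p) <= e.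
Proof.
move=> e0; apply: contrapT => Hn.
have [U [UU sU]] := ultraFilterLemma (@eventually_filter : ProperFilter \oo).
have H (j : nat) : exists w : vfield R n m * vfield R n m,
    [/\ hull g w.1, omega_limit g w.2, d w.1 w.2 < j.+1%:R^-1 &
    exists2 p, box M T p & e < enorm (w.1 p - w.2 p)].
  apply: contrapT => Hj; apply: Hn; exists j.+1%:R^-1; first by rewrite invr_gt0.
  move=> k h Hk oh kh p Bp; rewrite leNgt; apply/negP => pe.
  by apply: Hj; exists (k, h); split => //; exists p.
have /choice[w Hw] := H.
have [|h oh wh] := @ultra_compact_cvg _ _ U (fun j => (w j).2) _ UU (omega_compact hadm hd).
  by apply: filterE => j; have [] := Hw j.
have e2 : 0 < e / 2 by lra.
have Hh := omega_hull oh.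
have nB := vfield_near Hh.1 (box_compact (r := M) (T := T)) e2.
have [_ dC dT dN] := hd.
have [e1 e10 HB] : exists2 e1 : R, 0 < e1 &
    forall k, hull g k -> d h k < e1 -> forall p, box M T p -> enorm (k p - h p) < e / 2.
  apply: (dN h Hh [set k | forall p, box M T p -> enorm (k p - h p) < e / 2]).1.
  by apply: filterS nB.
have n1 : \forall j \near U, d h (w j).2 < e1 / 2.
  have e12 : 0 < e1 / 2 by lra.
  suff : U (fun j => d h (w j).2 < e1 / 2) by [].
  have H1 : U (fun j => hull g (w j).2 -> d h (w j).2 < e1 / 2).
    exact: (wh _ (metrizes_near hd Hh e12)).
  apply: filterS H1 => j; apply.
  by apply: omega_hull; have [] := Hw j.
have n2 : \forall j \near U, j.+1%:R^-1 < e1 / 2.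
  have e12 : 0 < e1 / 2 by lra.
  by apply: sU; exact: (near_infty_natSinv_lt (PosNum e12)).
have [j [/= [j1 j2] j3]] := filter_ex (filterI (filterI n1 n2) (wh _ nB)).
have [Hk oh' dj [p Bp]] := Hw j.
have Hh' := omega_hull oh'.
apply/negP; rewrite -leNgt.
have := HB _ Hk; have := dT h (w j).2 (w j).1 Hh Hh' Hk; rewrite (dC _ _ Hh' Hk) => d1.
have d2 : d h (w j).1 < e1 by move: (lt_trans dj j2); clear dj j2 => dj; lra.
move=> /(_ d2 p Bp) => q1; have := j3 p Bp; rewrite enorm_distC => q2.
have := enormB ((w j).1 p) (h p) ((w j).2 p); elra.
Qed.

(** The filter is general: it is [\oo] for the tracking statement and an ultrafilter for the
    differential inclusion. *)
Lemma limit_lipschitz (F : set_system nat) {FF : ProperFilter F} (t0 : R) (e_ : nat -> R)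
    (X : nat -> R -> 'rV[R]_n) Y xlim :
  (\forall k \near F, sol (e_ k) t0 (X k) (Y k)) ->
  (forall t : R, 0 <= t <= t0 -> X k t @[k --> F] --> xlim t) ->
  exists Rx : R, [/\ 0 < Rx, \forall k \near F, forall t : R, 0 <= t <= t0 -> enorm (X k t) <= Rx,
    forall t : R, 0 <= t <= t0 -> enorm (xlim t) <= Rx &
    forall s t : R, 0 <= s <= t0 -> 0 <= t <= t0 ->
      enorm (xlim t - xlim s) <= (a + b * Rx) * `|t - s|].
Proof.
move=> S Xx; have [Rx Rx0 HX] := slow_bounded g ha hfab x0 y0 t0.
have n1 : \forall k \near F, forall t : R, 0 <= t <= t0 -> enorm (X k t) <= Rx.
  by apply: filterS S => k Sk; exact: HX Sk.
exists Rx; split => // [t tt|s t st tt].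
  have h1 : enorm (X k t) @[k --> F] --> enorm (xlim t).
    by apply: continuous_cvg; [exact: enorm_continuous|exact: Xx].
  apply: (ler_cvg_to h1 (cvg_cst Rx)).
  by apply: filterS n1 => k; apply.
have h1 : enorm (X k t - X k s) @[k --> F] --> enorm (xlim t - xlim s).
  apply: continuous_cvg; first exact: enorm_continuous.
  by apply: cvgB; exact: Xx.
apply: (ler_cvg_to h1 (cvg_cst _)).
apply: filterS2 S n1 => k Sk Hk; exact: (slow_lipschitz hb hfab Sk Hk).
Qed.

Lemma pullback_close (t0 r delta : R) (e_ : nat -> R) (X : nat -> R -> 'rV[R]_n) Y xlim :
  0 < t0 -> 0 < r -> 0 < delta -> (forall k, 0 < e_ k) -> e_ @ \oo --> 0 ->
  (\forall k \near \oo, sol (e_ k) t0 (X k) (Y k)) ->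
  {uniform `[0, t0]%classic, X k @[k --> \oo] --> xlim} ->
  let K0 := [set x : 'rV[R]_n | exists (t : R) (u : 'rV[R]_n),
                    [/\ t \in `[0, t0], enorm u <= r & x = xlim t + u]] in
  exists (T del : R) (k0 : nat),
    [/\ 0 < T, 0 < del <= delta, (0 < k0)%N, 1 + 2 * T < t0 / e_ k0 &
    forall (k : nat) (s l : R) h, (k0 <= k)%N -> 0 <= s -> T <= l <= 2 * T ->
      e_ k * (s + l) <= t0 -> omega_limit g h -> d (tshift g s) h < del ->
      (semidist (@eudist R m) [set Y k (e_ k * (s + l))%R]
         (inflated_fiber g d K0 delta (tshift h l) (xlim (e_ k * (s + l))%R)) <= delta%:E)%E].
Proof.
move=> t00 r0 delta0 ek0 e_0 S /uniform_enormP Xu K0.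
have Xx (t : R) : 0 <= t <= t0 -> X k t @[k --> \oo] --> xlim t.
  move=> tt; apply/enorm_cvgP => e e0; apply: filterS (Xu e e0) => k; apply.
  by rewrite /= in_itv.
have [Rx [Rx0 XR xR xL]] := limit_lipschitz S Xx.
have [Ry [eps1 [Ry0 eps10 HY]]] :=
  fast_bounded hd ha hb hfab hadm hlip hglob hbound x0 y0 t0.
have cK0 : compact K0.
  have -> : K0 = (fun p => p.1 + p.2) @` ((xlim @` `[0, t0]) `*` [set u | enorm u <= r]).
    apply/seteqP; split=> [x [t [u [tt ur ->]]]|_ [[x u] /= [[t tt <-] ur] <-]].
      by exists (xlim t, u) => //; split => //; exists t.
    by exists t, u.
  apply: continuous_compact.
    apply: continuous_subspaceT => p; apply: cvgD; [exact: cvg_fst|exact: cvg_snd].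
  apply: compact_setX; last exact: enorm_ball0_compact.
  apply: continuous_compact; last exact: segment_compact.
  apply/subspace_continuousP => t; rewrite /= in_itv/= => tt.
  apply/enorm_cvgP => e e0; apply/near_withinP.
  have c0 : 0 < a + b * Rx + 1 by rewrite addr_gt0 ?addr_gt0 ?mulr_gt0.
  exists (e / (a + b * Rx + 1)); first by rewrite divr_gt0.
  move=> s; rewrite /= in_itv/= => ss; rewrite ltr_pdivlMr// => H.
  by apply: le_lt_trans (xL _ _ tt ss) _; have := normr_ge0 (s - t); lra.
have K0n : K0 !=set0.
  by exists (xlim 0), 0, 0; rewrite in_itv/= lexx (ltW t00) enorm0 (ltW r0) addr0.
have [AP _ _ _ Aatt] := semiflow_attractor hd hadm hlip hglob hbound cK0 K0n.
have bD : bounded_set [set y : 'rV[R]_m | enorm y <= Ry] by apply: (bounded_enorm (M := Ry)).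
have e2 : 0 < delta / 2 by lra.
have [T0 HT0] := (semidist_cvg0 _ _ _).1 (Aatt _ bD) _ e2.
pose T := Num.max T0 0 + 1.
have T1 : T0 <= T by rewrite /T; have : T0 <= Num.max T0 0 by [rewrite le_max lexx]; lra.
have Tp : 0 < T by rewrite /T; have : 0 <= Num.max T0 0 by [rewrite le_max lexx orbT]; lra.
have T2 : 0 <= 2 * T by lra.
have [M [del [M0 del0 Htr]]] :=
  slow_fast_track f hd hadm hlip hglob x0 y0 (Num.max Rx Ry) T2 e2.
have [del1 del10 Hd] := metric_box_close M (2 * T) del0.
(* Slow drift over a block of fast length at most [2 * T], per unit of [e_ k]; the summand 1 makes
   the bounds strict. *)
pose L := (a + b * Rx) * (2 * T) + 1.
have L0 : 0 < L by rewrite ltr_wpDl// mulr_ge0// addr_ge0 ?mulr_ge0// ltW.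
have del2 : 0 < del / 2 by lra.
have small (e : R) : 0 < e -> \forall k \near \oo, e_ k < e.
  move=> e0; have /cvgrPdist_lt /(_ _ e0) := e_0.
  by apply: filterS => k; rewrite sub0r normrN gtr0_norm.
have ev : \forall k \near \oo, [/\ e_ k < eps1, e_ k < del / 2 / L, e_ k < t0 / (1 + 2 * T),
    sol (e_ k) t0 (X k) (Y k) &
    (forall t, `[0, t0]%classic t -> enorm (X k t - xlim t) < del / 2) /\
    (forall t : R, 0 <= t <= t0 -> enorm (X k t) <= Rx)].
  near=> k; split; [near: k; apply: small| near: k; apply: small|near: k; apply: small|near: k|
    split; near: k] => //; try exact: Xu; try exact: divr_gt0.
  by rewrite divr_gt0//; lra.
have [k1 _ Hk1] := ev.
exists T, (Num.min del1 delta), k1.+1; split => //.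
- by rewrite lt_min del10 delta0 ge_min lexx orbT.
- have [_ _ + _ _] := Hk1 k1.+1 (leqnSn _).
  by rewrite !ltr_pdivlMr ?ek0//; [rewrite mulrC|lra].
move=> k s l h k1k s0 /andP[Tl l2T] slt oh; rewrite lt_min => /andP[dsh _].
have [k_eps k_L _ Sk [Xk Xr]] := Hk1 k (ltnW k1k).
have e0 := ek0 k.
have l0 : 0 <= l by lra.
have es0 : 0 <= e_ k * s by rewrite mulr_ge0// ltW.
have est : e_ k * s <= t0 by apply: le_trans slt; rewrite ler_pM2l// lerDl.
have esl0 : 0 <= e_ k * (s + l) by rewrite mulr_ge0 ?addr_ge0// ltW.
set x := xlim _.
have xr : enorm x <= Rx by apply: xR; rewrite esl0.
have yr : enorm (Y k (e_ k * s)) <= Ry.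
  by apply: (HY (e_ k) t0 _ _ _ _ Sk); rewrite ?e0 ?es0.
have Kx : K0 x.
  by exists (e_ k * (s + l)), 0; rewrite in_itv/= esl0 slt enorm0 (ltW r0) addr0.
have Hg : hull g (tshift g s) by apply: (Hplus_hull (g := g)); exact: Hplus_orbit.
have [||||||||| _ Yf] := Htr (e_ k) t0 s l (X k) (Y k) h x (Y k (e_ k * s)) Sk e0 s0 _ slt _ _ _ _ _ _ _ l.
- by rewrite l0.
- by move=> t tt; apply: le_trans (Xr t tt) _; rewrite le_max lexx.
- exact: (omega_Hplus hadm hd oh).
- by apply: le_trans xr _; rewrite le_max lexx.
- by apply: le_trans yr _; rewrite le_max lexx orbT.
- by move=> p Bp; exact: Hd.
(* The slow variable is frozen at its limit value at the end of the block, where the fibre is taken.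
   The drift and the uniform distance to [xlim] are each below [del / 2]. *)
- move=> t /andP[t0' tl].
  have h1 : 0 <= e_ k * (t + s) <= t0.
    rewrite mulr_ge0 ?addr_ge0 ?(ltW e0)//=; apply: le_trans slt.
    by rewrite ler_pM2l// addrC lerD2l.
  have h2 : 0 <= e_ k * (s + l) <= t0 by rewrite esl0.
  have := slow_lipschitz hb hfab Sk Xr h2 h1.
  have := Xk (e_ k * (s + l)); rewrite /= in_itv/= => /(_ h2) h3.
  have h4 : (a + b * Rx) * `|e_ k * (t + s) - e_ k * (s + l)| <= e_ k * ((a + b * Rx) * (2 * T)).
    rewrite -mulrBr (addrC t) opprD addrACA subrr add0r normrM (gtr0_norm e0) mulrCA.
    rewrite ler_pM2l// ler_pM2l ?addr_gt0 ?mulr_gt0// distrC ger0_norm ?subr_ge0//; lra.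
  have h5 : e_ k * L < del / 2 by rewrite -ltr_pdivlMr.
  have h6 : e_ k * ((a + b * Rx) * (2 * T)) <= e_ k * L by rewrite ler_pM2l// /L lerDl.
  have := enormB (X k (e_ k * (t + s))) (X k (e_ k * (s + l))) x.
  rewrite -/x in h3; elra.
- by rewrite subrr enorm0 ltW.
- by rewrite l0 lexx.
rewrite (addrC l) in Yf.
apply: semidist_le; first exact: ltW.
move=> _ ->.
(* The attractor point lies over a base point within [delta / 2], which the inflation absorbs; in
   the fast variable, attraction and tracking contribute half of [delta] each. *)
have [||[[h' x'] y'] Aq] := HT0 l _ (tshift h l, x, flow h x (Y k (e_ k * s)) l).
- exact: le_trans T1 Tl.
- by exists (h, x, Y k (e_ k * s)); [split|].
rewrite /prod_dist /= !gt_max => /andP[/andP[d1 d2] d3].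
have [/= [oh' Kx'] _] := AP _ Aq.
exists y'.
  exists (h', x') => //; split; first by split.
  by rewrite /= ge_max; apply/andP; split; lra.
move: d3; rewrite /eudist => d3.
by have := enormB (Y k (e_ k * (s + l))) (flow h x (Y k (e_ k * s)) l) y'; elra.
Unshelve. all: by end_near. Qed.

End PullbackClose.

(** * Borel maps and truncated distances *)

Section TruncatedDistance.
Context {R : realType} {T : ptopologicalType} (H : set T) (dT : T -> T -> R).
Hypothesis mT : metrizes H dT.
Implicit Types (Z : set T) (z w : T).

(* The singleton [1] keeps the infimum meaningful when [Z] misses [H]. *)
Definition trdist Z z : R :=
  inf ([set 1] `|` [set Num.min 1 (dT z w) | w in Z `&` H]).

Let trdist_lb Z z : H z ->
  lbound ([set 1] `|` [set Num.min 1 (dT z w) | w in Z `&` H]) (0 : R).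
Proof.
move=> Hz _ [->|[w [_ Hw] <-]]; first exact: ler01.
by case: mT => /(_ z w Hz Hw)[d0 _] _ _ _; rewrite le_min ler01.
Qed.

Let trdist_n0 Z z : ([set 1] `|` [set Num.min 1 (dT z w) | w in Z `&` H]) !=set0.
Proof. by exists 1; left. Qed.

Lemma trdist_ge0 Z z : H z -> 0 <= trdist Z z.
Proof. by move=> Hz; apply: lb_le_inf; [exact: trdist_n0|exact: trdist_lb]. Qed.

Lemma trdist_le1 Z z : H z -> trdist Z z <= 1.
Proof. by move=> Hz; apply: ge_inf; [exists 0; exact: trdist_lb|left]. Qed.

Lemma trdist_le Z z w : H z -> Z w -> H w -> trdist Z z <= dT z w.
Proof.
move=> Hz Zw Hw; apply: (@le_trans _ _ (Num.min 1 (dT z w))).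
  by apply: ge_inf; [exists 0; exact: trdist_lb|right; exists w].
by rewrite ge_min lexx orbT.
Qed.

Lemma trdist_lip Z z z' : H z -> H z' -> trdist Z z <= trdist Z z' + dT z z'.
Proof.
move=> Hz Hz'; have [d0 _ tri _] := mT; have [dzz _] := d0 z z' Hz Hz'.
rewrite -lerBlDr; apply: lb_le_inf; first exact: trdist_n0.
move=> _ [->|[w [Zw Hw] <-]]; first by have := trdist_le1 Z Hz; lra.
have := trdist_le1 Z Hz; have := trdist_le Hz Zw Hw; have := tri z z' w Hz Hz' Hw.
by rewrite le_min => *; apply/andP; split; lra.
Qed.

Lemma trdist_self Z z : H z -> Z z -> trdist Z z = 0.
Proof.
move=> Hz Zz; apply/eqP; rewrite eq_le trdist_ge0// andbT.
by rewrite -(metrizes_self mT Hz) trdist_le.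
Qed.

Lemma trdist_closed Z z : closed Z -> H z -> trdist Z z = 0 -> Z z.
Proof.
move=> cZ Hz; apply: contraPP => nZz.
have [_ _ _ N] := mT.
have [e e0 He] : exists2 e : R, 0 < e & forall k, H k -> dT z k < e -> (~` Z) k.
  apply: (N z Hz (~` Z)).1.
  have : nbhs z (~` Z) by apply: open_nbhs_nbhs; split => //; exact: closed_openC.
  by apply: filterS.
suff h : Num.min 1 e <= trdist Z z.
  move=> E; rewrite E in h; move: h; apply/negP; rewrite -ltNge lt_min e0.
  by rewrite ltr01.
apply: lb_le_inf; first exact: trdist_n0.
move=> _ [->|[w [Zw Hw] <-]]; first by rewrite ge_min lexx.
rewrite le_min !ge_min lexx/= orbC; case: leP => //= ew.
by have := He w Hw ew.
Qed.

Lemma trdist_uniform Z (e : R) : 0 < e -> exists2 del : R, 0 < del &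
  forall z w, H z -> H w -> dT z w < del -> `|trdist Z z - trdist Z w| <= e.
Proof.
move=> e0; exists e => // z w Hz Hw zw; have [_ dC _ _] := mT.
have := trdist_lip Z Hz Hw; have := trdist_lip Z Hw Hz; rewrite (dC w z)//.
by rewrite ler_norml => *; apply/andP; split; lra.
Qed.

Lemma trdist_norm_le1 Z z : H z -> `|trdist Z z| <= 1.
Proof. by move=> Hz; rewrite ger0_norm ?trdist_ge0 ?trdist_le1. Qed.

(** Uniformly continuous functions on [H] that decrease to the indicator of [Z] when [Z] is
    closed. *)
Definition trbump (k : nat) Z z : R := Num.max 0 (1 - k%:R * trdist Z z).

Lemma trbump_le1 k Z z : H z -> `|trbump k Z z| <= 1.
Proof.
move=> Hz; rewrite /trbump ger0_norm ?le_max ?lexx// ge_max ler01/=.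
by rewrite lerBlDr lerDl mulr_ge0// trdist_ge0.
Qed.

Lemma trbump_uniform k Z (e : R) : 0 < e -> exists2 del : R, 0 < del &
  forall z w, H z -> H w -> dT z w < del -> `|trbump k Z z - trbump k Z w| <= e.
Proof.
move=> e0; have k0 : 0 < k%:R + 1 :> R by rewrite ltr_wpDl.
have [del del0 Hd] := trdist_uniform Z (divr_gt0 e0 k0).
exists del => // z w Hz Hw zw; have := Hd z w Hz Hw zw.
rewrite ler_pdivlMr// => h.
have : `|k%:R * trdist Z z - k%:R * trdist Z w| <= e.
  rewrite -mulrBr normrM (ger0_norm (ler0n _ _)) mulrC; apply: le_trans h.
  by rewrite ler_wpM2l// lerDl.
rewrite /trbump; set p := k%:R * trdist Z z; set q := k%:R * trdist Z w.
rewrite !ler_norml => /andP[h1 h2].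
rewrite /Order.max; case: ifPn; case: ifPn; rewrite -?leNgt => h3 h4; apply/andP; split; lra.
Qed.

Lemma trbump_cvg Z z : closed Z -> H z -> trbump k Z z @[k --> \oo] --> (\1_Z z : R).
Proof.
move=> cZ Hz; rewrite indicE; have [Zz|Zz] := pselect (Z z).
  rewrite mem_set// (_ : (fun k => _) = cst 1); first exact: cvg_cst.
  by apply/funext => k; rewrite /trbump trdist_self// mulr0 subr0 max_r// ler01.
rewrite memNset//; apply: cvg_near_cst.
have t0 : 0 < trdist Z z.
  rewrite lt_neqAle trdist_ge0// andbT; apply/eqP => E.
  by apply: Zz; apply: trdist_closed => //; rewrite -E.
near=> k; rewrite /trbump max_l// subr_le0 -ler_pdivrMr// div1r.
by near: k; exact: nbhs_infty_ger.
Unshelve. all: by end_near. Qed.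

Context d (Om : measurableType d) (P : probability Om R).
Implicit Types phi psi : Om -> T.

(** The preimage of an open set is where the truncated distance to its complement does not vanish
    along [phi], so measurability of these real functions suffices. *)
Lemma measurable_borel_map phi : (forall u, H (phi u)) ->
  (forall Z, closed Z -> measurable_fun setT (trdist Z \o phi)) ->
  measurable_fun setT (phi : Om -> borel T).
Proof.
move=> Hphi mphi; apply: (@measurability _ _ Om (borel T) setT phi (@open T)) => //.
move=> _ [V oV <-].
rewrite setTI.
have -> : phi @^-1` V = ~` ((trdist (~` V) \o phi) @^-1` [set 0]).
  apply/seteqP; split=> u /=; first by move=> Vu /(trdist_closed (open_closedC oV) (Hphi u)).
  by move=> h; apply: contrapT => Vu; apply: h; exact: trdist_self.
apply: measurableC; rewrite -[X in measurable X]setTI.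
by apply: mphi; [exact: open_closedC oV|exact: measurableT|exact: measurable_set1].
Qed.

Lemma probability_closed_cvg phi Z : closed Z -> (forall u, H (phi u)) ->
  (forall Z, closed Z -> measurable_fun setT (trdist Z \o phi)) ->
  (\int[P]_u (trbump k Z (phi u)))%:E @[k --> \oo] --> P (phi @^-1` Z).
Proof.
move=> cZ Hphi mphi.
have mb k : measurable_fun setT (fun u => trbump k Z (phi u)).
  apply: measurable_maxr; first exact: measurable_cst.
  by apply: measurable_funB => //; apply: measurable_funM => //; exact: mphi.
have mZ : measurable (phi @^-1` Z).
  have mZ' : measurable (Z : set (borel T)).
    by rewrite -(setCK Z); apply: measurableC; apply: sub_sigma_algebra; exact: closed_openC.
  by have := measurable_borel_map Hphi mphi measurableT mZ'; rewrite setTI.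
have ib k : P.-integrable setT (EFin \o (fun u => trbump k Z (phi u))).
  apply: measurable_bounded_integrable => //; first exact: fin_num_fun_lty (fin_num_measure P).
  exists 1; split; first exact: num_real.
  by move=> x x1 u _; apply: le_trans (trbump_le1 _ _ _) (ltW x1).
have -> : P (phi @^-1` Z) = (\int[P]_u (\1_(phi @^-1` Z) u)%:E)%E.
  by rewrite integral_indic// setIT.
rewrite (_ : (fun k => _) = (fun k => \int[P]_u (trbump k Z (phi u))%:E)%E); last first.
  by apply/funext => k; rewrite /Rintegral fineK//; exact: (integrable_fin_num measurableT (ib k)).
apply: (@dominated_cvg _ _ _ _ _ _ _ _ (cst 1%E)) => //.
- by move=> k; apply/measurable_EFinP.
- by move=> u _; apply: cvg_EFin; [exact: nearW|exact: trbump_cvg].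
- by apply: finite_measure_integrable_cst.
- by move=> k u _; rewrite /= lee_fin trbump_le1.
Qed.

(** Equal integrals of the bumps give equal laws on closed sets, hence on open sets by complement;
    the open sets are stable under intersection and generate the Borel sets. *)
Lemma borel_map_unique phi psi :
  (forall u, H (phi u)) -> (forall u, H (psi u)) ->
  (forall Z, closed Z -> measurable_fun setT (trdist Z \o phi)) ->
  (forall Z, closed Z -> measurable_fun setT (trdist Z \o psi)) ->
  (forall Z k, closed Z -> \int[P]_u (trbump k Z (phi u)) = \int[P]_u (trbump k Z (psi u))) ->
  forall B : set (borel T), measurable B -> P (phi @^-1` B) = P (psi @^-1` B).
Proof.
move=> Hphi Hpsi mphi mpsi E B mB.
have mphi' := measurable_borel_map Hphi mphi; have mpsi' := measurable_borel_map Hpsi mpsi.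
have Ecl Z : closed Z -> P (phi @^-1` Z) = P (psi @^-1` Z).
  move=> cZ; have h1 := probability_closed_cvg cZ Hphi mphi.
  have := probability_closed_cvg cZ Hpsi mpsi.
  under eq_fun do rewrite -E//.
  by move=> h2; exact: (cvg_unique _ h1 h2).
pose m1 : {measure set (borel T) -> \bar R} := pushforward P (phi : Om -> borel T).
pose m2 : {measure set (borel T) -> \bar R} := pushforward P (psi : Om -> borel T).
apply: (@measure_unique _ R (borel T) (@open T) (fun=> setT) _ _ _ _ (m1 mphi') (m2 mpsi')) => //.
- exact: openI.
- by move=> _; exact: openT.
- by rewrite bigcup_const.
- move=> O oO; rewrite /m1 /m2 /= /pushforward.
  have mO : measurable (O : set (borel T)) by exact: sub_sigma_algebra.
  have m1O := mphi' measurableT _ mO; have m2O := mpsi' measurableT _ mO.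
  rewrite !setTI in m1O m2O.
  have compl (chi : Om -> T) : measurable (chi @^-1` O) ->
      P (chi @^-1` O) = (1 - P (chi @^-1` (~` O)))%E.
    move=> mchi; rewrite preimage_setC.
    by have := probability_setC P (measurableC mchi); rewrite setCK.
  by rewrite !compl// Ecl//; exact: open_closedC.
- by move=> _; rewrite /m1 /= /pushforward preimage_setT probability_setT ltry.
Qed.

End TruncatedDistance.

Section CompactMetrizable.
Context {R : realType} {T : topologicalType} (K : set T) (dT : T -> T -> R).
Hypotheses (mT : metrizes K dT) (cK : compact K).

(** Continuity is relative to [K], since the semiflow is continuous only on a part of the ambient
    space. *)
Lemma metrizes_heine_cantor (V : normedModType R) (F : T -> V) :
  (forall z, K z -> F w @[w --> within K (nbhs z)] --> F z) ->
  forall e : R, 0 < e -> exists2 del : R, 0 < del &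
    forall z w, K z -> K w -> dT z w < del -> `|F z - F w| <= e.
Proof.
move=> cF e e0; apply: contrapT => Hn.
have [U [UU sU]] := ultraFilterLemma (@eventually_filter : ProperFilter \oo).
have H (j : nat) : exists w : T * T,
    [/\ K w.1, K w.2, dT w.1 w.2 < j.+1%:R^-1 & e < `|F w.1 - F w.2|].
  apply: contrapT => Hj; apply: Hn; exists j.+1%:R^-1; first by rewrite invr_gt0.
  move=> z w Kz Kw zw; rewrite leNgt; apply/negP => pe.
  by apply: Hj; exists (z, w).
have [w Hw] := choice H.
have [|h Kh wh] := @ultra_compact_cvg _ _ U (fun j => (w j).1) _ UU cK.
  by apply: filterE => j; have [] := Hw j.
have e2 : 0 < e / 2 by lra.
have [_ dC dtri dN] := mT.
have [e1 e10 HB] : exists2 e1 : R, 0 < e1 &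
    forall k, K k -> dT h k < e1 -> `|F h - F k| < e / 2.
  apply: (dN h Kh [set k | `|F h - F k| < e / 2]).1.
  by have /cvgrPdist_lt /(_ _ e2) := cF h Kh.
have e12 : 0 < e1 / 2 by lra.
have n1 : U (fun j => K (w j).1 -> dT h (w j).1 < e1 / 2).
  exact: (wh _ (metrizes_nbhs mT Kh e12)).
have n2 : \forall j \near U, j.+1%:R^-1 < e1 / 2.
  by apply: sU; exact: (near_infty_natSinv_lt (PosNum e12)).
have [j [/= j1 j2]] := filter_ex (filterI n1 n2).
have [K1 K2 dj Fj] := Hw j; have {}dj := lt_trans dj j2; clear j2.
have {}j1 := j1 K1; have := dtri h _ _ Kh K1 K2.
move=> d2; have := HB _ K1; have := HB _ K2.
move=> /(_ ltac:(lra)) h2 /(_ ltac:(lra)) h1.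
have := ler_normB (F h - F (w j).2) (F h - F (w j).1).
rewrite opprB addrC addrA subrK => h3.
by have := lt_le_trans Fj h3; lra.
Qed.

End CompactMetrizable.

(** * Invariant measures carried by asymptotically invariant averages *)

(** After the shift by [k], only the last [k] terms of [p] and the first [k] of [q] are left
    unmatched. This is the Krylov-Bogoliubov estimate, with [p] the values of a function after the
    flow and [q] those before it. *)
Lemma shifted_sum_le (R : realType) (p q : nat -> R) (B w : R) (N k : nat) :
  0 <= w -> 0 <= B ->
  (forall i, (i < N)%N -> `|p i| <= B) -> (forall i, (i < N)%N -> `|q i| <= B) ->
  (forall i, (i + k < N)%N -> `|p i - q (i + k)%N| <= w) ->
  `|\sum_(i < N) p i - \sum_(i < N) q i| <= N%:R * w + 2 * k%:R * B.
Proof.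
move=> w0 B0 pB qB pq.
have sumB (u : nat -> R) (c : R) s t : (forall i, (s <= i < t)%N -> `|u i| <= c) ->
    `|\sum_(s <= i < t) u i| <= (t - s)%:R * c.
  move=> uB; apply: le_trans (ler_norm_sum _ _ _) _.
  by rewrite mulr_natl -sumr_const_nat; exact: ler_sum_nat.
rewrite -!(big_mkord xpredT).
have Nw : 0 <= N%:R * w by rewrite mulr_ge0.
have [kN|Nk] := leqP k N; last first.
  have h1 := sumB p B 0%N N (fun i => pB i); have h2 := sumB q B 0%N N (fun i => qB i).
  have h3 : N%:R * B <= k%:R * B by rewrite ler_wpM2r// ler_nat ltnW.
  have := ler_normB (\sum_(0 <= i < N) p i) (\sum_(0 <= i < N) q i).
  rewrite subn0 in h1 h2; lra.
rewrite (big_cat_nat (n := (N - k)%N) (F := p))//=; last exact: leq_subr.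
rewrite (big_cat_nat (n := k) (F := q))//=.
rewrite -{2}(add0n k) (big_addn 0 N k xpredT q).
have h1 : `|\sum_(N - k <= i < N) p i| <= k%:R * B.
  have -> : k%:R = (N - (N - k))%:R :> R by rewrite subKn.
  by apply: sumB => i /andP[_ iN]; exact: pB.
have h2 : `|\sum_(0 <= i < k) q i| <= k%:R * B.
  have -> : k%:R = (k - 0)%:R :> R by rewrite subn0.
  apply: sumB => i /andP[_ ik]; apply: qB.
  exact: leq_trans ik kN.
have h3 : `|\sum_(0 <= i < N - k) p i - \sum_(0 <= i < N - k) q (i + k)%N| <= N%:R * w.
  rewrite -sumrB; apply: (@le_trans _ _ ((N - k - 0)%:R * w)).
    by apply: sumB => i /andP[_ ik]; apply: pq; move: ik; rewrite ltn_subRL addnC.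
  by rewrite ler_wpM2r// ler_nat subn0 leq_subr.
set s1 := \sum_(0 <= i < N - k) p i in h3 *; set s2 := \sum_(N - k <= i < N) p i in h1 *.
set s3 := \sum_(0 <= i < k) q i in h2 *; set s4 := \sum_(0 <= i < N - k) q _ in h3 *.
move: h1 h2 h3; rewrite !ler_norml => /andP[? ?] /andP[? ?] /andP[? ?].
by apply/andP; split; lra.
Qed.

Lemma unif01_Rintegral_bounds (R : realType) (F : R -> R) (lo hi : R) :
  measurable_fun [set: measurableTypeR R] F -> (forall u, lo <= F u <= hi) ->
  lo <= \int[unif01]_u F u <= hi.
Proof.
move=> mF Fb.
have cstE (c : R) : \int[@unif01 R]_u c = c.
  rewrite Rintegral_cst// (_ : fine _ = 1) ?mulr1//.
  by rewrite -[RHS]/(fine 1%E); congr fine; exact: (probability_setT (@unif01 R)).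
have iF : (@unif01 R).-integrable setT (EFin \o F).
  apply: (@unif01_integrable R F (`|lo| + `|hi|)) => // u.
  have /andP[h1 h2] := Fb u; have := ler_norm hi; have := ler_norm (- lo).
  by rewrite normrN ler_norml; have := normr_ge0 lo; have := normr_ge0 hi;
    move=> *; apply/andP; split; lra.
have ic (c : R) : (@unif01 R).-integrable setT (EFin \o (fun=> c)).
  by apply: (@unif01_integrable R (fun=> c) `|c|) => //; exact: measurable_cst.
apply/andP; split; [rewrite -[leLHS]cstE|rewrite -[leRHS]cstE].
  by apply: le_Rintegral => // u _; have /andP[] := Fb u.
by apply: le_Rintegral => // u _; have /andP[] := Fb u.
Qed.

Lemma continuous_measurable_borel (R : realType) (T : ptopologicalType) (q : T -> R) :
  continuous q -> measurable_fun [set: borel T] (q : borel T -> R).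
Proof.
move=> cq; apply: (measurability (@RGenOpens.G R)).
  exact: RGenOpens.measurableE.
move=> _ [_ [s [t ->]] <-]; rewrite setTI; apply: sub_sigma_algebra.
by move/continuousP : cq; apply; exact: interval_open.
Qed.

Section Averaging.
Context {R : realType} {n m : nat}.
Context (f : 'rV[R]_n * 'rV[R]_m -> 'rV[R]_n) (g : vfield R n m).
Context (d : vfield R n m -> vfield R n m -> R).
Hypotheses (hd : metrizes (hull g) d) (hf : continuous f).
Context (a b : R).
Hypotheses (ha : 0 < a) (hb : 0 < b).
Hypothesis hfab : forall x y, enorm (f (x, y)) <= a + b * enorm x.
Hypotheses (hadm : admissible g) (hlip : lipschitz_in_y g).
Hypothesis hglob : forall h : vfield R n m,
  (exists2 tau0 : R, 0 <= tau0 & h = tshift g tau0) \/ omega_limit g h ->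
  forall (x : 'rV[R]_n) (y : 'rV[R]_m), exists phi, fast_solution h x 0 y phi.
Hypothesis hbound : forall K0 : set 'rV[R]_n, compact K0 -> ultimately_bounded g K0.

Local Notation W := (vfield R n m * 'rV[R]_m)%type.
Local Notation dW := (prod_dist d (@eudist R m)).

(** Serves to round a flow time to the time grid of the empirical measures, uniformly over
    [Hplus]. *)
Lemma tshift_uniform (e : R) : 0 < e -> exists2 del : R, 0 < del &
  forall h s, Hplus g h -> 0 <= s < del -> d (tshift h s) h < e.
Proof.
move=> e0; apply: contrapT => Hn.
have [U [UU sU]] := ultraFilterLemma (@eventually_filter : ProperFilter \oo).
have H (j : nat) : exists w : vfield R n m * R,
    [/\ Hplus g w.1, 0 <= w.2 < j.+1%:R^-1 & e <= d (tshift w.1 w.2) w.1].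
  apply: contrapT => Hj; apply: Hn; exists j.+1%:R^-1; first by rewrite invr_gt0.
  move=> h s Hh s0; rewrite ltNge; apply/negP => pe.
  by apply: Hj; exists (h, s).
have [w Hw] := choice H.
have [|h Hh wh] := @ultra_compact_cvg _ _ U (fun j => (w j).1) _ UU (Hplus_compact hadm).
  by apply: filterE => j; have [] := Hw j.
have w0 : (w j).2 @[j --> U] --> (0 : R).
  apply/cvgrPdist_lt => e1 e10.
  have n2 : \forall j \near U, j.+1%:R^-1 < e1.
    by apply: sU; exact: (near_infty_natSinv_lt (PosNum e10)).
  apply: filterS n2 => j je; have [_ /andP[w1 w2] _] := Hw j.
  by rewrite sub0r normrN ger0_norm//; exact: lt_trans je.
have Hg := Hplus_hull Hh.
have whs : tshift (w j).1 (w j).2 @[j --> U] --> h.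
  by rewrite -[X in _ --> X]tshift0; apply: (tshift_cvg hadm).
have e2 : 0 < e / 2 by lra.
have n1 : U (fun j => hull g (w j).1 -> d h (w j).1 < e / 2).
  exact: (wh _ (metrizes_nbhs hd Hg e2)).
have n2 : U (fun j => hull g (tshift (w j).1 (w j).2) -> d h (tshift (w j).1 (w j).2) < e / 2).
  exact: (whs _ (metrizes_nbhs hd Hg e2)).
have [j [/= j1 j2]] := filter_ex (filterI n1 n2).
have [H1 /andP[w1 _]] := Hw j.
have H2 := Hplus_tshift hadm H1 w1.
have H1' := Hplus_hull H1; have H2' := Hplus_hull H2.
have {}j1 := j1 H1'; have {}j2 := j2 H2'.
have [_ dC dtri _] := hd.
have := dtri _ h _ H2' Hg H1'; rewrite (dC _ h)// => d1.
by apply/negP; rewrite -ltNge; lra.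
Qed.

Theorem averaged_field_of_averages (x : 'rV[R]_n) (Ry : R) (v : 'rV[R]_n)
    (U : set_system nat) (cnt : nat -> nat) (gam : nat -> nat -> W) :
  UltraFilter U -> (forall j, (0 < cnt j)%N) ->
  (forall l : nat, \forall j \near U, forall i, (i < cnt j)%N ->
     hull_on g [set s | l%:R <= s] (gam j i).1 /\ enorm (gam j i).2 <= Ry) ->
  (forall tau : R, 0 <= tau -> exists2 k : nat -> nat,
     (k j)%:R / (cnt j)%:R @[j --> U] --> (0 : R) &
     forall e : R, 0 < e -> \forall j \near U, forall i, (i + k j < cnt j)%N ->
       dW (semiflow_at x tau (gam j i)) (gam j (i + k j)%N) < e) ->
  (forall i, avg cnt gam j (fun z => f (x, z.2) ord0 i) @[j --> U] --> v ord0 i) ->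
  averaged_field f g d x v.
Proof.
move=> UU cnt0 UC Uinv Uf.
(* Membership in all [C l] forces the first component into the omega-limit set, while over the
   compact set [C 0] the flow is already defined. *)
pose C (l : nat) : set W := hull_on g [set s | l%:R <= s] `*` [set y | enorm y <= Ry].
have cC l : compact (C l).
  by apply: compact_setX; [exact: (hull_on_compact hadm)|exact: enorm_ball0_compact].
have hW : hausdorff_space W.
  by apply: prod_hausdorff; [exact: vfield_hausdorff|exact: norm_hausdorff].
pose H : set W := hull g `*` setT.
have mW : metrizes H dW by apply: metrizes_prod => //; exact: metrizes_eudist.
have CH : C 0%N `<=` H by move=> z [/hull_on_hull].
have mC : metrizes (C 0%N) dW by exact: metrizesS mW.
have ndC l l' : (l <= l')%N -> C l' `<=` C l.
  move=> ll' z [h1 h2]; split => //; apply: hull_onS h1 => s /=.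
  by apply: le_trans; rewrite ler_nat.
have [phi [phiC phiF]] := empirical_limit (cC 0%N) (fun l => compact_closed hW (cC l)) ndC mC UU cnt0 UC.
have phiK u : C 0%N (phi u) by [].
have phiO u : omega_limit g (phi u).1.
  apply/(omega_limitP hadm hd) => N; have [h1 _] := phiC u (Num.bound `|N|).
  apply: hull_onS h1 => s /=; apply: le_trans; apply: le_trans (ler_norm N) _.
  exact/ltW/archi_boundP.
have phiR u : enorm (phi u).2 <= Ry by case: (phiC u 0%N).
have phiH u : H (phi u) by exact: CH.
pose S := @semiflow_at R n m x.
have KHp z : C 0%N z -> Hplus g z.1 by move=> [].
have SH tau z : 0 <= tau -> C 0%N z -> H (S tau z).
  move=> tau0 /KHp; case: z => h y /= Hh; split => //=.
  exact: (Hplus_hull (Hplus_tshift hadm Hh tau0)).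
have cS tau (F : W -> R) z : 0 <= tau -> C 0%N z ->
    (forall e : R, 0 < e -> exists2 del : R, 0 < del &
       forall z w, H z -> H w -> dW z w < del -> `|F z - F w| <= e) ->
    F (S tau w) @[w --> within (C 0%N) (nbhs z)] --> F (S tau z).
  move=> tau0 Kz uF; apply/cvgrPdist_le => e e0.
  have [del del0 Hd] := uF e e0.
  have QH : C 0%N `<=` Hplus g `*` setT by move=> w /KHp.
  have := semiflow_at_cvg (x := x) hd hadm hlip hglob QH tau0 Kz.
  move=> /(_ _ (metrizes_nbhs mW (SH tau z tau0 Kz) del0)) H1.
  have {}H1 : within (C 0%N) (nbhs z) (fun w => H (S tau w) -> dW (S tau z) (S tau w) < del) := H1.
  apply: filterS2 H1 (withinT _ _) => w h1 Kw.
  by apply: Hd; [exact: SH|exact: SH|apply: h1; exact: SH].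
have phiS tau (F : W -> R) (B : R) : 0 <= tau -> (forall z, H z -> `|F z| <= B) ->
    (forall e : R, 0 < e -> exists2 del : R, 0 < del &
       forall z w, H z -> H w -> dW z w < del -> `|F z - F w| <= e) ->
    measurable_fun setT (fun u => F (S tau (phi u))) /\
    forall l : R, avg cnt gam j (fun z => F (S tau z)) @[j --> U] --> l ->
      \int[unif01]_u (F (S tau (phi u))) = l.
  move=> tau0 FB uF; apply: (phiF (fun z => F (S tau z)) B) => [z Kz|].
    by apply: FB; exact: SH.
  by apply: (metrizes_heine_cantor mC (cC 0%N)) => z Kz; exact: cS.
have phi0 (F : W -> R) (B : R) : (forall z, H z -> `|F z| <= B) ->
    (forall e : R, 0 < e -> exists2 del : R, 0 < del &
       forall z w, H z -> H w -> dW z w < del -> `|F z - F w| <= e) ->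
    measurable_fun setT (fun u => F (phi u)) /\
    forall l : R, avg cnt gam j F @[j --> U] --> l -> \int[unif01]_u (F (phi u)) = l.
  move=> FB uF; apply: (phiF F B) => [z Kz|e e0]; first by apply: FB; exact: CH.
  have [del del0 Hd] := uF e e0; exists del => // z w Kz Kw.
  by apply: Hd; exact: CH.
(* Both integrals are ultralimits of averages along the empirical points, and these averages differ
   by a quantity that tends to 0, by [shifted_sum_le]. *)
have inv tau (F : W -> R) (B : R) : 0 <= tau -> (forall z, H z -> `|F z| <= B) ->
    (forall e : R, 0 < e -> exists2 del : R, 0 < del &
       forall z w, H z -> H w -> dW z w < del -> `|F z - F w| <= e) ->
    \int[unif01]_u (F (phi u)) = \int[unif01]_u (F (S tau (phi u))).
  move=> tau0 FB uF.
  have UK : \forall j \near U, forall i, (i < cnt j)%N -> C 0%N (gam j i) := UC 0%N.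
  have [l Fl] : exists l : R, avg cnt gam j F @[j --> U] --> l.
    apply: (avg_ultralimit UU cnt0 (C := B)); apply: filterS UK => j Kj i ij.
    by apply: FB; apply: CH; exact: Kj.
  rewrite ((phi0 F B FB uF).2 l Fl) ((phiS tau F B tau0 FB uF).2 l)//.
  have B0 : 0 <= B by exact: le_trans (normr_ge0 _) (FB _ (phiH 0)).
  have [k k0 Hk] := Uinv tau tau0.
  apply/cvgrPdist_lt => e e0.
  have e4 : 0 < e / 4 by lra.
  have [del del0 Hd] := uF _ e4.
  have kB : \forall j \near U, 2 * B * ((k j)%:R / (cnt j)%:R) < e / 4.
    have : 2 * B * ((k j)%:R / (cnt j)%:R) @[j --> U] --> 2 * B * (0 : R) by exact: cvgMr.
    by rewrite mulr0 => /cvgr_lt; apply.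
  have /cvgrPdist_lt /(_ _ e4) Fl' := Fl.
  apply: filterS2 (filterI UK (Hk del del0)) (filterI kB Fl') => j [Kj kj] [kBj lj].
  have N0 : 0 < (cnt j)%:R :> R by rewrite ltr0n.
  have := @shifted_sum_le R (fun i => F (S tau (gam j i))) (fun i => F (gam j i)) B (e / 4)
    (cnt j) (k j) (ltW e4) B0.
  move=> /(_ _ _ _) => Hs.
  have {}Hs : `|\sum_(i < cnt j) F (S tau (gam j i)) - \sum_(i < cnt j) F (gam j i)| <=
      (cnt j)%:R * (e / 4) + 2 * (k j)%:R * B.
    apply: Hs => i ij; [by apply: FB; apply: SH => //; exact: Kj|by apply: FB; apply: CH; exact: Kj|].
    have ij' : (i < cnt j)%N by exact: leq_ltn_trans (leq_addr _ _) ij.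
    by apply: Hd; [apply: SH => //; exact: Kj|apply: CH; exact: Kj|exact: kj].
  have : `|avg cnt gam j (fun z => F (S tau z)) - avg cnt gam j F| <= e / 4 + 2 * B * ((k j)%:R / (cnt j)%:R).
    rewrite /avg -mulrBl normrM normfV (gtr0_norm N0) ler_pdivrMr//.
    apply: le_trans Hs _; rewrite le_eqVlt; apply/orP; left; apply/eqP; field.
    by rewrite gt_eqF.
  have := ler_normB (l - avg cnt gam j F) (avg cnt gam j (fun z => F (S tau z)) - avg cnt gam j F).
  rewrite (_ : l - _ - _ = l - avg cnt gam j (fun z => F (S tau z))); last by ring.
  by lra.
have mphi Z : closed Z -> measurable_fun setT (trdist H dW Z \o phi).
  move=> _; apply: (phi0 (trdist H dW Z) 1 _ _).1.
    by move=> z Hz; exact: (trdist_norm_le1 mW).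
  by move=> e e0; exact: (trdist_uniform mW).
have mpsi tau Z : 0 <= tau -> closed Z -> measurable_fun setT (trdist H dW Z \o (S tau \o phi)).
  move=> tau0 _; apply: (phiS tau (trdist H dW Z) 1 tau0 _ _).1.
    by move=> z Hz; exact: (trdist_norm_le1 mW).
  by move=> e e0; exact: (trdist_uniform mW).
have psiH tau u : 0 <= tau -> H ((S tau \o phi) u) by move=> tau0; apply: SH.
have bumpE tau Z k : 0 <= tau -> \int[unif01]_u (trbump H dW k Z (phi u)) =
    \int[unif01]_u (trbump H dW k Z ((S tau \o phi) u)).
  move=> tau0; apply: (inv tau (trbump H dW k Z) 1 tau0).
    by move=> z Hz; exact: (trbump_le1 mW).
  by move=> e e0; exact: (trbump_uniform mW).
have mphiB : measurable_fun [set: measurableTypeR R] (phi : measurableTypeR R -> borel W).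
  exact: (measurable_borel_map (Om := measurableTypeR R) mW phiH mphi).
(* The integral of a bump of the attractor along [phi] equals that along [S tau \o phi], whose
   values are uniformly close to the attractor for large [tau]; so it is 1, and the bumps decrease
   to the indicator. *)
have phiA : unif01 (phi @^-1` attractor_at g d x) = 1%E.
  set A := attractor_at g d x.
  have [AP _ cA _ Aatt] := semiflow_at_attractor hd hadm hlip hglob hbound x.
  have clA : closed A by exact: compact_closed.
  have AH : A `<=` H by move=> z /AP[/omega_hull].
  have one k : \int[unif01]_u (trbump H dW k A (phi u)) = 1.
    have mb tau : 0 <= tau -> measurable_fun setT (fun u => trbump H dW k A (S tau (phi u))).
      move=> tau0; apply: (phiS tau (trbump H dW k A) 1 tau0 _ _).1.
        by move=> z Hz; exact: (trbump_le1 mW).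
      by move=> e e0; exact: (trbump_uniform mW).
    apply/eqP; rewrite eq_le; apply/andP; split.
      have b1 u : -1 <= trbump H dW k A (S 0 (phi u)) <= 1.
        by rewrite -ler_norml; apply: (trbump_le1 mW); exact: psiH.
      by rewrite (bumpE 0)//; have /andP[] := unif01_Rintegral_bounds (mb 0 (lexx _)) b1.
    apply/ler_addgt0Pr => e e0.
    have k0 : 0 < k%:R + 1 :> R by rewrite ltr_wpDl.
    have bD : bounded_set [set y : 'rV[R]_m | enorm y <= Ry] by apply: (bounded_enorm (M := Ry)).
    have [T0 HT0] := (semidist_cvg0 _ _ _).1 (Aatt _ bD) _ (divr_gt0 e0 k0).
    pose tau := Num.max T0 0.
    have tau0 : 0 <= tau by rewrite /tau le_max lexx orbT.
    have Ttau : T0 <= tau by rewrite /tau le_max lexx.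
    rewrite (bumpE tau)// -lerBlDr.
    suff b1 u : 1 - e <= trbump H dW k A (S tau (phi u)) <= 1.
      by have /andP[] := unif01_Rintegral_bounds (mb tau tau0) b1.
    apply/andP; split; last first.
      by apply: le_trans (ler_norm _) _; apply: (trbump_le1 mW); exact: psiH.
    have [|q Aq] := HT0 tau Ttau (S tau (phi u)).
      by exists (phi u) => //; split => //=; exact: phiO.
    rewrite /trbump le_max; move=> h; apply/orP; right; rewrite lerD2l lerN2.
    have h1 := trdist_le mW (Z := A) (psiH tau u tau0) Aq (AH _ Aq).
    apply: (@le_trans _ _ (k%:R * (e / (k%:R + 1)))).
      by rewrite ler_wpM2l//; exact: le_trans h1 (ltW h).
    rewrite mulrCA ler_piMr ?(ltW e0)// ler_pdivrMr// mul1r.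
    by rewrite lerDl.
  have := probability_closed_cvg (P := unif01) mW clA phiH mphi.
  under eq_fun do rewrite one.
  by move=> /(cvg_unique (@ereal_hausdorff R) (cvg_cst 1%E)) <-.
pose X : {mfun measurableTypeR R >-> borel W} := 
  MeasurableFun.Pack (MeasurableFun.Class (isMeasurableFun.Build _ _ _ _ _ mphiB)).
have msnd : measurable_fun [set: measurableTypeR R]
    (snd \o phi : measurableTypeR R -> borel 'rV[R]_m).
  apply: (@measurability _ _ (measurableTypeR R) (borel 'rV[R]_m) setT (snd \o phi) (@open 'rV[R]_m)) => //.
  move=> _ [V oV <-]; rewrite setTI.
  have mV : measurable ((snd @^-1` V) : set (borel W)).
    by apply: sub_sigma_algebra; apply: open_comp => // z _; exact: cvg_snd.
  by have := mphiB measurableT _ mV; rewrite setTI.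
pose Y : {mfun measurableTypeR R >-> borel 'rV[R]_m} :=
  MeasurableFun.Pack (MeasurableFun.Class (isMeasurableFun.Build _ _ _ _ _ msnd)).
exists (distribution unif01 Y).
  exists (distribution unif01 X); last first.
    move=> B mB; rewrite /distribution /= /pushforward; congr (unif01 _).
    by apply/seteqP; split => u //= -[].
  split; first exact: phiA.
  move=> tau B tau0 mB.
  have E := borel_map_unique (Om := measurableTypeR R) (P := @unif01 R) (phi := phi)
    (psi := S tau \o phi) mW phiH (fun u => psiH tau u tau0) mphi
    (fun Z => mpsi tau Z tau0) (fun Z k _ => bumpE tau Z k tau0) mB.
  transitivity (unif01 ((S tau \o phi) @^-1` B)); last exact/esym.
  rewrite /distribution /= /pushforward; congr (unif01 _).
  (* [phi] takes its values over the omega-limit set, so intersecting with the phase space changes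
     nothing. *)
  by apply/seteqP; split => u /=; [case|split].
apply/rowP => i; rewrite mxE.
pose q (y : 'rV[R]_m) := f (x, y) ord0 i.
have qB y : `|q y| <= a + b * enorm x by exact: le_trans (enorm_coord _ _) (hfab _ _).
have cq : continuous q.
  move=> y; apply: (@continuous_comp _ _ _ (fun y => f (x, y)) (fun w : 'rV[R]_n => w ord0 i)).
    apply: (@continuous_comp _ _ _ (fun y => (x, y)) f); last exact: hf.
    by apply: (@cvg_pair2 _ _ _ (nbhs y)); [exact: cvg_cst|exact: cvg_id].
  exact: coord_continuous.
have [mq iq] : measurable_fun setT (fun u => q (phi u).2) /\
    forall l : R, avg cnt gam j (fun z => q z.2) @[j --> U] --> l ->
      \int[unif01]_u (q (phi u).2) = l.
  apply: (phiF (fun z => q z.2) (a + b * enorm x)) => [z _ //|].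
  apply: (metrizes_heine_cantor mC (cC 0%N)) => z Kz; apply: cvg_within_filter.
  by apply: (@continuous_comp _ _ _ snd q); [exact: cvg_snd|exact: cq].
rewrite -(iq _ (Uf i)); congr fine; apply/esym.
apply: (integral_distribution (X := Y) (f := fun y => (q y)%:E)).
  by apply/measurable_EFinP; exact: continuous_measurable_borel.
exact: (@unif01_integrable R (fun u => q (phi u).2) (a + b * enorm x)).
Qed.

End Averaging.

(** * The slow limit *)

(** For each [j], choose [K] for the largest [L <= j] that can be satisfied; by monotonicity in [L]
    it serves all smaller satisfiable levels. *)
Lemma ultra_diagonal (U : set_system nat) (P : nat -> nat -> nat -> Prop) :
  UltraFilter U -> \oo `<=` U ->
  (forall L L' j K, (L <= L')%N -> P L' j K -> P L j K) ->
  (forall L, \forall j \near U, exists K, P L j K) ->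
  exists K_ : nat -> nat, forall L, \forall j \near U, P L j (K_ j).
Proof.
move=> UU sU Pmono PU.
have H j N : exists K, forall L, (L <= N)%N -> (exists K', P L j K') -> P L j K.
  elim: N => [|N [K HK]].
    have [[K PK]|nP] := pselect (exists K', P 0%N j K').
      by exists K => L; rewrite leqn0 => /eqP ->.
    by exists 0%N => L; rewrite leqn0 => /eqP ->.
  have [[K' PK]|nP] := pselect (exists K', P N.+1 j K').
    by exists K' => L LN _; exact: Pmono PK.
  exists K => L; rewrite leq_eqVlt => /predU1P[->//|]; rewrite ltnS; exact: HK.
have [K_ HK] := choice (fun j => H j j).
exists K_ => L; have n1 : \forall j \near U, (L <= j)%N by apply: sU; exact: nbhs_infty_ge.
by apply: filterS2 n1 (PU L) => j Lj; exact: HK.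
Qed.

Section SlowLimit.
Context {R : realType} {n m : nat}.
Context (f : 'rV[R]_n * 'rV[R]_m -> 'rV[R]_n) (g : vfield R n m).
Context (d : vfield R n m -> vfield R n m -> R).
Hypotheses (hd : metrizes (hull g) d) (hf : continuous f).
Context (a b : R).
Hypotheses (ha : 0 < a) (hb : 0 < b).
Hypothesis hfab : forall x y, enorm (f (x, y)) <= a + b * enorm x.
Hypotheses (hadm : admissible g) (hlip : lipschitz_in_y g).
Hypothesis hglob : forall h : vfield R n m,
  (exists2 tau0 : R, 0 <= tau0 & h = tshift g tau0) \/ omega_limit g h ->
  forall (x : 'rV[R]_n) (y : 'rV[R]_m), exists phi, fast_solution h x 0 y phi.
Hypothesis hbound : forall K0 : set 'rV[R]_n, compact K0 -> ultimately_bounded g K0.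
Context (x0 : 'rV[R]_n) (y0 : 'rV[R]_m).
Local Notation sol eps c := (slow_fast_solution f g x0 y0 eps `[0, c]%classic).

(** In fast time the velocity of the fast component is a value of [g] on a bounded set, so [C] does
    not depend on [eps]. *)
Lemma fast_lipschitz (r : R) : exists2 C : R, 0 < C &
  forall (eps c s l : R) X Y, sol eps c X Y -> 0 < eps -> 0 <= s -> 0 <= l ->
    eps * (s + l) <= c ->
    (forall t : R, 0 <= t <= c -> enorm (X t) <= r /\ enorm (Y t) <= r) ->
    enorm (Y (eps * (s + l)) - Y (eps * s)) <= C * l.
Proof.
have [C C0 HC] := hull_bounded hadm r; exists C => // eps c s l X Y XY e0 s0 l0 slc XYr.
have := @mean_value_le _ _ (fun t => Y (eps * (t + s))) _ 0 l 0 C l0 (fun t => fast_deriv XY e0 s0 slc (t := t)).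
rewrite scaler0 !subr0 add0r (addrC l); apply=> t /andP[t0 tl].
rewrite subr0; have [] := XYr (eps * (t + s)).
  rewrite mulr_ge0 ?addr_ge0 ?(ltW e0)//=; apply: le_trans slc.
  by rewrite ler_pM2l// addrC lerD2l.
move=> Xr Yr; have := HC (tshift g (t + s)) (X (eps * (t + s))) (Y (eps * (t + s))) 0.
rewrite /tshift /= add0r; apply => //.
have ts : 0 <= t + s by rewrite addr_ge0.
exact: (Hplus_hull (Hplus_orbit hadm ts)).
Qed.

(** [mean_value_le] summed over consecutive intervals of length [c], each with its own reference
    velocity: the increment of [X] against a Riemann sum. *)
Lemma slow_telescope (eps t0 t c eta : R) X Y (w : nat -> 'rV[R]_n) (N : nat) :
  sol eps t0 X Y -> 0 <= t -> 0 <= c -> t + N%:R * c <= t0 ->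
  (forall i, (i < N)%N -> forall r : R, t + i%:R * c <= r <= t + i.+1%:R * c ->
     enorm (f (X r, Y r) - w i) <= eta) ->
  enorm (X (t + N%:R * c) - X t - c *: \sum_(i < N) w i) <= N%:R * c * eta.
Proof.
move=> [_ _ XY] t0' c0; elim: N => [|N IH] tN H.
  by rewrite big_ord0 scaler0 mul0r addr0 subrr subr0 enorm0 mul0r.
have Nc : 0 <= N%:R * c by rewrite mulr_ge0.
have SE : N.+1%:R * c = N%:R * c + c by rewrite -natr1 mulrDl mul1r.
have tN' : t + N%:R * c <= t0 by apply: le_trans tN; rewrite lerD2l SE lerDl.
have {}IH := IH tN' (fun i iN => H i (ltnW iN)).
have st : t + N%:R * c <= t + N.+1%:R * c by rewrite lerD2l SE lerDl.
have := @mean_value_le _ _ X (fun s => f (X s, Y s)) _ _ (w N) eta st.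
have -> : t + N.+1%:R * c - (t + N%:R * c) = c by rewrite SE; ring.
move=> H1; have {}H1 : enorm (X (t + N.+1%:R * c) - X (t + N%:R * c) - c *: w N) <= eta * c.
  apply: H1 => r rr; last exact: H.
  have /andP[r1 r2] := rr.
  have [dX _] := XY r ltac:(by rewrite /= in_itv/= (le_trans r2 tN) andbT; lra).
  apply: deriv_withinS dX => u; rewrite /= !in_itv/= => /andP[u1 u2].
  by rewrite (le_trans u2 tN) andbT; lra.
rewrite big_ord_recr/= scalerDr.
have -> : X (t + N.+1%:R * c) - X t - (c *: \sum_(i < N) w i + c *: w N)
  = (X (t + N%:R * c) - X t - c *: \sum_(i < N) w i)
    + (X (t + N.+1%:R * c) - X (t + N%:R * c) - c *: w N).
  by rewrite [RHS]addrC; apply/rowP => i; rewrite !mxE; ring.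
apply: le_trans (enormD _ _) _.
rewrite [leRHS](_ : _ = N%:R * c * eta + eta * c); last by rewrite SE; ring.
exact: lerD.
Qed.

Theorem slow_limit_velocity (t0 t : R) (v : 'rV[R]_n) (U : set_system nat) (e_ : nat -> R)
    (X : nat -> R -> 'rV[R]_n) (Y : nat -> R -> 'rV[R]_m) (xlim : R -> 'rV[R]_n) :
  UltraFilter U -> \oo `<=` U -> (forall j, 0 < e_ j) -> e_ @ U --> 0 ->
  (\forall j \near U, sol (e_ j) t0 (X j) (Y j)) ->
  (forall e : R, 0 < e -> \forall j \near U, forall t : R, 0 <= t <= t0 ->
     enorm (X j t - xlim t) < e) ->
  0 < t < t0 -> deriv_within `[0, t0]%classic xlim t v ->
  averaged_field f g d (xlim t) v.
Proof.
move=> UU sU e0 e_0 S Xu /andP[t_gt0 tt0] dv.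
have esmall (e : R) : 0 < e -> \forall j \near U, e_ j < e.
  by move=> ep; have /cvgrPdist_lt /(_ _ ep) := e_0; apply: filterS => j;
    rewrite sub0r normrN gtr0_norm.
have Xpt (s : R) : 0 <= s <= t0 -> X j s @[j --> U] --> xlim s.
  by move=> st; apply/enorm_cvgP => e ep; apply: filterS (Xu e ep) => j; apply.
have [Rx [Rx0 XR xR xL]] := limit_lipschitz ha hb hfab S Xpt.
have [Ry [eps1 [Ry0 eps10 HY]]] :=
  fast_bounded hd ha hb hfab hadm hlip hglob hbound x0 y0 t0.
(* The averaging window starts at [t] and has fast length [K_ j]: long in fast time,
   short in slow time, and long compared with the distance from [X j] to [xlim]. *)
pose P L j K := [/\ e_ j * K%:R < L.+1%:R^-1, (L < K)%N &
  forall s : R, 0 <= s <= t0 -> enorm (X j s - xlim s) <= e_ j * K%:R / L.+1%:R].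
have [K_ HK] : exists K_ : nat -> nat, forall L, \forall j \near U, P L j (K_ j).
  apply: ultra_diagonal => // [L L' j K LL' [p1 p2 p3]|L].
    have LR : (L.+1%:R : R) <= L'.+1%:R by rewrite ler_nat.
    split; first by apply: lt_le_trans p1 _; rewrite lef_pV2 ?posrE.
      exact: leq_ltn_trans p2.
    move=> s st; apply: le_trans (p3 s st) _; rewrite ler_wpM2l//.
      by rewrite mulr_ge0// ltW.
    by rewrite lef_pV2 ?posrE.
  have L0 : 0 < L.+1%:R :> R by [].
  (* With [K] the integer part of [c / e_ j], the slow length of the window lies between [c / 2] and
     [c]: short enough for [L], and long enough to dominate the distance to [xlim]. *)
  pose c : R := L.+1%:R^-1 / 2.
  have c0 : 0 < c by rewrite divr_gt0 ?invr_gt0.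
  have n1 := esmall _ (divr_gt0 c0 (ltr0Sn R L.+1)).
  have n2 := Xu _ (divr_gt0 c0 (mulr_gt0 (ltr0Sn R 1) L0)).
  apply: filterS2 n1 n2 => j; rewrite ltr_pdivlMr// => j1 j2.
  exists (Num.truncn (c / e_ j)); set K := Num.truncn _.
  have /andP[k1 k2] : (K%:R : R) <= c / e_ j < K.+1%:R.
    by apply: truncn_itv; rewrite divr_ge0// ltW.
  rewrite ler_pdivlMr// mulrC in k1; rewrite ltr_pdivrMr// in k2.
  have cE : c * 2 = L.+1%:R^-1 by rewrite /c divfK.
  split.
  - by apply: le_lt_trans k1 _; rewrite -cE; lra.
  - have : (L.+2%:R : R) < K.+1%:R by rewrite -(ltr_pM2l (e0 j)) (lt_trans j1)// mulrC.
    by rewrite ltr_nat ltnS; exact: ltn_trans.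
  - move=> s st; apply: le_trans (ltW (j2 s st)) _.
    rewrite invfM mulrA ler_wpM2r ?invr_ge0//.
    have ee : e_ j <= e_ j * L.+2%:R / 2.
      by rewrite ler_pdivlMr// ler_pM2l// ler_nat.
    rewrite -natr1 mulrDl mul1r mulrC in k2; lra.
have {K_ HK} [K_ K0 HK] : exists2 K_ : nat -> nat, forall j, (0 < K_ j)%N &
    forall L, \forall j \near U, P L j (K_ j).
  exists (fun j => (K_ j).-1.+1) => // L; apply: filterS (HK L) => j.
  by move=> [p1 p2 p3]; rewrite prednK//; exact: leq_ltn_trans p2.
set x := xlim t.
have t_ge0 := ltW t_gt0.
have ssmall (e : R) : 0 < e -> \forall j \near U, e_ j * (K_ j)%:R < e.
  move=> ep; have [L _ HL] := near_infty_natSinv_lt (PosNum ep).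
  apply: filterS (HK L) => j [p1 _ _]; apply: lt_trans p1 _; exact: HL (leqnn L).
have hsmall (e : R) : 0 < e -> \forall j \near U, j.+1%:R^-1 < e.
  by move=> ep; apply: sU; exact: (near_infty_natSinv_lt (PosNum ep)).
have Klarge (M : R) : \forall j \near U, M < (K_ j)%:R.
  apply: filterS (HK (Num.bound `|M|)) => j [_ + _]; rewrite -(ltr_nat R) => h.
  by apply: le_lt_trans (ler_norm M) (lt_trans (archi_boundP (normr_ge0 M)) h).
have tfit : \forall j \near U, t + e_ j * (K_ j)%:R <= t0.
  have := ssmall (t0 - t); rewrite subr_gt0 => /(_ tt0).
  by apply: filterS => j jt; lra.
have L0 : 0 <= a + b * Rx by rewrite addr_ge0 ?mulr_ge0// ltW.
have Xx (del : R) : 0 < del -> \forall j \near U, forall r : R,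
    t <= r <= t + e_ j * (K_ j)%:R -> enorm (X j r - x) < del.
  move=> dp; have d2 : 0 < del / 2 by lra.
  have L1 : 0 < a + b * Rx + 1 by lra.
  apply: filterS2 (filterI tfit (Xu _ d2)) (ssmall _ (divr_gt0 d2 L1)) => j [j1 j2].
  rewrite ltr_pdivlMr// => j3 r /andP[r1 r2].
  have r0 : 0 <= r <= t0 by rewrite (le_trans t_ge0 r1) (le_trans r2 j1).
  have tb : 0 <= t <= t0 by rewrite t_ge0 ltW.
  have := xL t r tb r0; have := j2 r r0; have := enormB (X j r) (xlim r) x.
  have : (a + b * Rx) * `|r - t| <= (a + b * Rx) * (e_ j * (K_ j)%:R).
    by rewrite ler_wpM2l// ger0_norm ?subr_ge0//; lra.
  have : 0 <= e_ j * (K_ j)%:R by rewrite mulr_ge0// ltW.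
  rewrite -/x; elra.
have YR : \forall j \near U, forall s : R, 0 <= s <= t0 -> enorm (Y j s) <= Ry.
  apply: filterS2 S (esmall _ eps10) => j Sj je.
  by apply: HY Sj; rewrite ?e0.
pose r := Num.max Rx Ry.
have rX : Rx <= r by rewrite /r le_max lexx.
have rY : Ry <= r by rewrite /r le_max lexx orbT.
have XYr : \forall j \near U, forall s : R, 0 <= s <= t0 -> enorm (X j s) <= r /\ enorm (Y j s) <= r.
  apply: filterS2 XR YR => j h1 h2 s st.
  by split; [exact: le_trans (h1 s st) rX|exact: le_trans (h2 s st) rY].
have [C C0 HC] := fast_lipschitz r.
(* A grid in fast time whose mesh [1 / (j + 1)] tends to 0; [cnt j] steps cover the fast length
   [K_ j] of the window. *)
pose time j (i : nat) : R := t / e_ j + i%:R / j.+1%:R.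
pose cnt j := (K_ j * j.+1)%N.
pose gam j i : vfield R n m * 'rV[R]_m := (tshift g (time j i), Y j (e_ j * time j i)).
have timeE j i : e_ j * time j i = t + i%:R * (e_ j / j.+1%:R).
  rewrite /time mulrDr (mulrC (e_ j) (t / _)) divfK ?gt_eqF//; congr (_ + _).
  by rewrite mulrCA.
have time0 j i : 0 <= time j i by rewrite addr_ge0// divr_ge0// ltW.
have cntE j : (cnt j)%:R * (e_ j / j.+1%:R) = e_ j * (K_ j)%:R.
  by rewrite /cnt natrM; field; rewrite nat1r pnatr_eq0.
have step0 j : 0 <= e_ j / j.+1%:R by rewrite divr_ge0// ltW.
have timeb j i : (i <= cnt j)%N -> t <= e_ j * time j i <= t + e_ j * (K_ j)%:R.
  move=> ij; rewrite timeE lerDl mulr_ge0//= lerD2l -cntE.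
  by rewrite ler_wpM2r// ler_nat.
apply: (averaged_field_of_averages hd hf hfab hadm hlip hglob hbound (Ry := Ry)
  (cnt := cnt) (gam := gam) UU).
- by move=> j; rewrite /cnt muln_gt0 K0.
- move=> l; have n1 : \forall j \near U, e_ j < t / (l%:R + 1).
    by apply: esmall; rewrite divr_gt0// ltr_wpDl.
  apply: filterS2 (filterI tfit YR) n1 => j [j1 j2]; rewrite ltr_pdivlMr ?ltr_wpDl// => j3 i ij.
  split => /=.
    apply: (hull_on_tshift hadm); rewrite /= /time.
    apply: (@le_trans _ _ (t / e_ j)); last by rewrite lerDl divr_ge0.
    by rewrite ler_pdivlMr// mulrC; have := e0 j; lra.
  have /andP[b1 b2] := timeb j i (ltnW ij).
  by apply: j2; rewrite (le_trans t_ge0 b1) (le_trans b2 j1).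
(* A flow of duration [tau] is [k] grid steps up to a remainder [rho] below the mesh. The ratio of
   [k] to [cnt j] is at most [tau / K_ j], which tends to 0. *)
- move=> tau tau0; exists (fun j => Num.truncn (tau * j.+1%:R)).
    apply/cvgrPdist_lt => e ep; apply: filterS (Klarge (tau / e)) => j.
    rewrite ltr_pdivrMr// => jK.
    have /andP[k1 _] : ((Num.truncn (tau * j.+1%:R))%:R : R) <= tau * j.+1%:R < (Num.truncn (tau * j.+1%:R)).+1%:R.
      by apply: truncn_itv; rewrite mulr_ge0.
    rewrite sub0r normrN ger0_norm ?divr_ge0//.
    have cp : 0 < (cnt j)%:R :> R by rewrite ltr0n muln_gt0 K0.
    rewrite ltr_pdivrMr//; apply: le_lt_trans k1 _.
    by rewrite /cnt natrM mulrA ltr_pM2r// mulrC.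
  move=> e ep; have e3 : 0 < e / 3 by lra.
  have [M [del [M0 del0 Htr]]] := slow_fast_track f hd hadm hlip hglob x0 y0 r tau0 e3.
  have [del2 del20 Hdel2] := tshift_uniform hd hadm ep.
  apply: filterS2 (filterI (filterI S XYr) (filterI tfit (Xx del del0)))
    (filterI (hsmall _ del20) (hsmall _ (divr_gt0 e3 C0))).
  move=> j [[Sj XYj] [tj Xj]] [h1]; rewrite ltr_pdivlMr// => h2 i.
  set k := Num.truncn _ => ik.
  have jp : 0 < j.+1%:R :> R by [].
  have /andP[k1 k2] : (k%:R : R) <= tau * j.+1%:R < k.+1%:R.
    by apply: truncn_itv; rewrite mulr_ge0.
  have kE : time j (i + k)%N = time j i + k%:R / j.+1%:R.
    by rewrite /time natrD mulrDl addrA.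
  have kS : time j (i + k).+1 = time j (i + k)%N + j.+1%:R^-1.
    by rewrite /time -natr1 mulrDl mul1r addrA.
  pose rho := tau - k%:R / j.+1%:R.
  have rho0 : 0 <= rho by rewrite subr_ge0 ler_pdivrMr.
  have rho1 : rho < j.+1%:R^-1.
    by rewrite ltrBlDr -[X in X + _]mul1r -mulrDl ltr_pdivlMr// nat1r.
  have rhoE : time j (i + k)%N + rho = time j i + tau by rewrite kE /rho; ring.
  (* [i + k < cnt j] leaves room for one more grid step, so [time j i + tau], slightly beyond grid
     point [i + k], is still in the window. *)
  have /andP[b1 b2] := timeb j (i + k).+1 ik.
  have ub : e_ j * (time j i + tau) <= t + e_ j * (K_ j)%:R.
    by apply: le_trans b2; rewrite ler_pM2l// -rhoE kS lerD2l ltW.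
  have ij : (i <= cnt j)%N by rewrite (leq_trans (leq_addr k i))// ltnW.
  have /andP[b3 b4] := timeb j i ij.
  have [XYi1 XYi2] : enorm (X j (e_ j * time j i)) <= r /\ enorm (Y j (e_ j * time j i)) <= r.
    by apply: XYj; rewrite (le_trans t_ge0 b3) (le_trans b4 tj).
  have xr : enorm x <= r by apply: le_trans rX; apply: xR; rewrite t_ge0 ltW.
  rewrite /prod_dist /= gt_max; apply/andP; split.
    rewrite tshiftD -rhoE -tshiftD; apply: Hdel2; first exact: Hplus_orbit.
    by rewrite rho0 (lt_trans rho1).
  have tt : 0 <= tau <= tau by rewrite tau0 lexx.
  have [] := Htr (e_ j) t0 (time j i) tau (X j) (Y j) (tshift g (time j i)) x
    (Y j (e_ j * time j i)) Sj (e0 j) (time0 j i) tt (le_trans ub tj)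
    (fun s st => (XYj s st).1) (Hplus_orbit hadm (time0 j i)) xr XYi2 _ _ _ tau tt.
  - by move=> p _; rewrite subrr enorm0 ltW.
  - move=> s /andP[s0 st]; apply: Xj; apply/andP; split.
      by apply: le_trans b3 _; rewrite ler_pM2l// lerDr.
    by apply: le_trans ub; rewrite ler_pM2l// addrC lerD2l.
  - by rewrite subrr enorm0 ltW.
  move=> _ h3.
  have := HC (e_ j) t0 (time j (i + k)%N) rho (X j) (Y j) Sj (e0 j) (time0 j _) rho0 _ XYj.
  rewrite rhoE => /(_ (le_trans ub tj)) h4.
  have h5 : C * rho < e / 3 by apply: le_lt_trans h2; rewrite mulrC ler_wpM2r// ltW.
  rewrite /eudist -/(flow _ _ _ tau); rewrite (addrC tau) in h3.
  set fl := flow _ _ _ _ in h3 *; set u := Y j (e_ j * time j (i + k)%N) in h4 *.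
  by have := enormB fl (Y j (e_ j * (time j i + tau))) u; rewrite enorm_distC in h3; elra.
- move=> i; apply/cvgrPdist_le => e ep.
  have e4 : 0 < e / 4 by lra.
  pose KF : set ('rV[R]_n * 'rV[R]_m) := [set u | enorm u <= r] `*` [set u | enorm u <= r].
  have cKF : compact KF by apply: compact_setX; exact: enorm_ball0_compact.
  have mKF : metrizes KF (prod_dist (@eudist R n) (@eudist R m)).
    by apply: metrizes_prod; exact: metrizes_eudist.
  have [del del0 Hf] : exists2 del : R, 0 < del & forall z w, KF z -> KF w ->
      prod_dist (@eudist R n) (@eudist R m) z w < del -> enorm (f z - f w) <= e / 4.
    have n1 : 0 < n%:R + 1 :> R by rewrite ltr_wpDl.
    have cF z : KF z -> f w @[w --> within KF (nbhs z)] --> f z.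
      by move=> _; apply: cvg_within_filter; exact: hf.
    have [del del0 Hd] := metrizes_heine_cantor mKF cKF cF (divr_gt0 e4 n1).
    exists del => // z w Kz Kw zw; apply: le_trans (enorm_le_norm _) _.
    have := Hd z w Kz Kw zw; rewrite ler_pdivlMr// mulrC; apply: le_trans.
    by rewrite ler_wpM2r// lerDl.
  have [del2 del20 Hd2] := (deriv_withinP _ _ _ _).1 dv _ e4.
  have e8 : 0 < e / 8 by lra.
  have [L _ HL] := near_infty_natSinv_lt (PosNum e8).
  have {}HL : L.+1%:R^-1 < e / 8 := HL L (leqnn L).
  apply: filterS2 (filterI (filterI (filterI S XYr) (filterI tfit (Xx del del0))) (HK L))
    (filterI (hsmall _ (divr_gt0 del0 C0)) (ssmall _ del20)).
  move=> j [[[Sj XYj] [tj Xj]] [_ _ XL]] [+ h2]; rewrite ltr_pdivlMr// => h1.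
  set sj := e_ j * (K_ j)%:R in tj Xj XL h2.
  have sj0 : 0 < sj by rewrite mulr_gt0// ltr0n K0.
  have xr : enorm x <= r by apply: le_trans rX; apply: xR; rewrite t_ge0 ltW.
  pose w i' := f (x, Y j (e_ j * time j i')).
  have tc : t + (cnt j)%:R * (e_ j / j.+1%:R) <= t0 by rewrite cntE.
  have := @slow_telescope (e_ j) t0 t (e_ j / j.+1%:R) (e / 4) (X j) (Y j) w (cnt j) Sj t_ge0 (step0 j) tc.
  rewrite cntE -/sj => HA; have {}HA : enorm (X j (t + sj) - X j t -
      (e_ j / j.+1%:R) *: \sum_(i < cnt j) w i) <= sj * (e / 4).
    apply: HA => i' ij s /andP[]; rewrite -!timeE => s1 s2.
    have /andP[b1 _] := timeb j i' (ltnW ij); have /andP[_ b2] := timeb j i'.+1 ij.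
    have st : t <= s <= t + sj by rewrite (le_trans b1 s1) (le_trans s2 b2).
    have [st1 st2] := andP st.
    have s0t : 0 <= s <= t0 by rewrite (le_trans t_ge0 st1) (le_trans st2 tj).
    have g0t : 0 <= e_ j * time j i' <= t0.
      by rewrite (le_trans t_ge0 b1) (le_trans s1)//; have /andP[] := s0t.
    apply: Hf.
    - by have [] := XYj s s0t.
    - by split => //=; have [] := XYj _ g0t.
    rewrite /prod_dist /= gt_max /eudist Xj//=.
    pose l := s / e_ j - time j i'.
    have lE : e_ j * (time j i' + l) = s.
      by rewrite /l addrCA subrr addr0 mulrC divfK ?gt_eqF.
    have l0 : 0 <= l by rewrite subr_ge0 ler_pdivlMr// mulrC.
    have l1 : l <= j.+1%:R^-1.
      rewrite /l lerBlDr ler_pdivrMr// mulrC; apply: le_trans s2 _.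
      by rewrite ler_pM2l// /time -natr1 mulrDl mul1r addrA addrC.
    have slt : e_ j * (time j i' + l) <= t0 by rewrite lE; have /andP[] := s0t.
    have := HC (e_ j) t0 (time j i') l (X j) (Y j) Sj (e0 j) (time0 j i') l0 slt XYj.
    rewrite lE => /le_lt_trans; apply; apply: le_lt_trans h1.
    by rewrite mulrC ler_wpM2r// ltW.
  have t0b : 0 <= t <= t0 by rewrite t_ge0 ltW.
  have tsb : 0 <= t + sj <= t0 by rewrite tj addr_ge0// ltW.
  (* The distances to [xlim] at the two ends of the window contribute [sj * (e / 8)] each, the
     derivative of [xlim] at [t] contributes [sj * (e / 4)]. *)
  have HB : enorm (X j (t + sj) - X j t - sj *: v) <= sj * (e / 2).
    have q1 := XL t t0b; have q2 := XL _ tsb; rewrite enorm_distC in q1.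
    have q3 : sj / L.+1%:R <= sj * (e / 8) by rewrite ler_wpM2l ?ltW.
    have := Hd2 (t + sj); rewrite /= in_itv/= tsb => /(_ isT).
    rewrite addrAC subrr add0r gtr0_norm// => /(_ h2) q4.
    have -> : X j (t + sj) - X j t - sj *: v = (X j (t + sj) - xlim (t + sj)) +
        ((xlim (t + sj) - xlim t - sj *: v) + (xlim t - X j t)).
      by apply/rowP => ?; rewrite !mxE; ring.
    have := enormD (X j (t + sj) - xlim (t + sj))
        ((xlim (t + sj) - xlim t - sj *: v) + (xlim t - X j t)).
    have := enormD (xlim (t + sj) - xlim t - sj *: v) (xlim t - X j t).
    have {}q1 := le_trans q1 q3; have {}q2 := le_trans q2 q3; elra.
  have HAB : enorm (sj *: v - (e_ j / j.+1%:R) *: \sum_(i < cnt j) w i) <= sj * e.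
    have := enormB (sj *: v) (X j (t + sj) - X j t) ((e_ j / j.+1%:R) *: \sum_(i < cnt j) w i).
    rewrite (enorm_distC (sj *: v) (X j (t + sj) - X j t)) => q.
    have : sj * (e / 4) + sj * (e / 2) <= sj * e by rewrite -mulrDr ler_wpM2l ?ltW//; lra.
    by apply: le_trans; apply: le_trans q _; rewrite addrC lerD.
  have := enorm_coord (sj *: v - (e_ j / j.+1%:R) *: \sum_(i < cnt j) w i) i.
  rewrite !mxE summxE => q; rewrite -(ler_pM2l sj0); apply: le_trans HAB.
  apply: le_trans q; rewrite -{1}(gtr0_norm sj0) -normrM /avg /=.
  rewrite mulrBr (_ : sj * (_ / _) = e_ j / j.+1%:R * \sum_(k < cnt j) w k ord0 i)//.
  rewrite /sj -cntE; field.
  apply/andP; split; first by rewrite nat1r pnatr_eq0.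
  by rewrite pnatr_eq0 -lt0n muln_gt0 K0.
Qed.

End SlowLimit.

(** * Lipschitz curves on a compact interval *)

Section LipschitzCurves.
Context {R : realType} {k : nat}.
Implicit Types u : R -> 'rV[R]_k.

Lemma deriv_within_coords (I : set R) u t (v : 'rV[R]_k) :
  (forall i, h^-1 *: (u (h *: (1 : R) + t) ord0 i - u t ord0 i) @[h --> 0^'] --> v ord0 i) ->
  deriv_within I u t v.
Proof.
move=> D; apply/enorm_cvgP => e e0.
have k0 : 0 < k%:R + 1 :> R by rewrite ltr_wpDl.
have ek := divr_gt0 e0 k0.
have : \forall h \near (0 : R)^', forall i,
    `|v ord0 i - h^-1 *: (u (h *: (1 : R) + t) ord0 i - u t ord0 i)| < e / (k%:R + 1).
  by apply: filter_forall => i; have /cvgrPdist_lt /(_ _ ek) := D i.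
move=> /nbhs_ballP[del /= del0 H]; apply/nbhs_ballP; exists del => // s.
rewrite /ball/= => ts st _.
have tsb : ball (0 : R) del (s - t) by rewrite /ball/= sub0r normrN distrC.
have st0 : s - t != 0 by rewrite subr_eq0.
have {}H := H _ tsb st0.
have E : (s - t) *: (1 : R) + t = s by rewrite /GRing.scale/= mulr1 subrK.
apply: le_lt_trans (enorm_le_sum _) _.
apply: (@le_lt_trans _ _ (\sum_(i < k) e / (k%:R + 1))).
  by apply: ler_sum => i _; have := H i; rewrite E !mxE distrC => /ltW.
rewrite sumr_const card_ord -[X in X < _]mulr_natl mulrCA gtr_pMr// ltr_pdivrMr//.
by rewrite mul1r ltrDl.
Qed.

Lemma lipschitz_ae_deriv_within (t0 L : R) u : 0 < t0 -> 0 <= L ->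
  (forall s t : R, 0 <= s <= t0 -> 0 <= t <= t0 -> enorm (u t - u s) <= L * `|t - s|) ->
  {ae @lebesgue_measure R, forall t : R, 0 < t < t0 ->
     exists v, deriv_within `[0, t0]%classic u t v}.
Proof.
move=> t00 L0 uL.
(* The curve is extended by constants to a Lipschitz curve on the line, whose coordinates are
   derivable almost everywhere. *)
pose clamp (t : R) : R := Num.min t0 (Num.max 0 t).
have cl0 (t : R) : 0 <= clamp t <= t0.
  by rewrite /clamp le_min ge_min le_max (ltW t00) !lexx.
have clE (t : R) : 0 <= t <= t0 -> clamp t = t.
  by move=> /andP[h1 h2]; rewrite /clamp max_r// min_r.
have clL (s t : R) : `|clamp s - clamp t| <= `|s - t|.
  have := ler_norm (s - t); have := ler_norm (- (s - t)); rewrite normrN => h1 h2.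
  rewrite /clamp /Order.min /Order.max ler_norml.
  by case: (ltP 0 s) => ?; case: (ltP 0 t) => ?; case: ltP => ?; case: ltP => ?;
    apply/andP; split; lra.
have D (i : 'I_k) : {ae @lebesgue_measure R,
    forall t, derivable (fun t => u (clamp t) ord0 i) t 1}.
  apply: (@lipschitz_ae_derivable R _ L) => s t.
  have := enorm_coord (u (clamp s) - u (clamp t)) i; rewrite !mxE.
  move=> h; apply: le_trans h _; apply: le_trans (uL _ _ (cl0 _) (cl0 _)) _.
  by rewrite ler_wpM2l.
have := filter_forall (ae_filter_ringOfSetsType (@lebesgue_measure R)) D.
apply: filterS => t Dt /andP[t1 t2].
pose v : 'rV[R]_k := \row_i 'D_1 (fun t => u (clamp t) ord0 i) t.
exists v.
have W : deriv_within `[0, t0]%classic (u \o clamp) t v.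
  by apply: deriv_within_coords => i; rewrite mxE; exact: Dt.
apply: deriv_within_local ltr01 _ _ W => /=; first by rewrite clE// ltW// ltW.
by move=> s _; rewrite in_itv/= => st; rewrite clE.
Qed.

Lemma lipschitz_absolutely_continuous (t0 L : R) u : 0 <= L ->
  (forall s t : R, 0 <= s <= t0 -> 0 <= t <= t0 -> enorm (u t - u s) <= L * `|t - s|) ->
  absolutely_continuous t0 u.
Proof.
move=> L0 uL e e0; have L1 : 0 < L + 1 by rewrite ltr_wpDl.
exists (e / (L + 1)); first by rewrite divr_gt0.
move=> N l r lr _; rewrite ltr_pdivlMr//; apply: le_lt_trans.
rewrite mulr_suml; apply: ler_sum => i _; have [l0 [lri rt]] := lr i.
apply: le_trans (uL _ _ _ _) _; rewrite ?l0 ?rt ?(le_trans l0 lri) ?(le_trans lri rt)//.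
by rewrite ger0_norm ?subr_ge0// mulrC ler_wpM2l ?subr_ge0// lerDl.
Qed.

End LipschitzCurves.

(** * Extraction of the limit curve *)

Section SlowLimitExists.
Context {R : realType} {n m : nat}.
Context (f : 'rV[R]_n * 'rV[R]_m -> 'rV[R]_n) (g : vfield R n m).
Context (d : vfield R n m -> vfield R n m -> R).
Hypotheses (hd : metrizes (hull g) d) (hf : continuous f).
Context (a b : R).
Hypotheses (ha : 0 < a) (hb : 0 < b).
Hypothesis hfab : forall x y, enorm (f (x, y)) <= a + b * enorm x.
Hypotheses (hadm : admissible g) (hlip : lipschitz_in_y g).
Hypothesis hglob : forall h : vfield R n m,
  (exists2 tau0 : R, 0 <= tau0 & h = tshift g tau0) \/ omega_limit g h ->
  forall (x : 'rV[R]_n) (y : 'rV[R]_m), exists phi, fast_solution h x 0 y phi.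
Hypothesis hbound : forall K0 : set 'rV[R]_n, compact K0 -> ultimately_bounded g K0.
Context (x0 : 'rV[R]_n) (y0 : 'rV[R]_m).
Local Notation sol eps c := (slow_fast_solution f g x0 y0 eps `[0, c]%classic).

Theorem slow_limit_exists (t0 : R) (e_ : nat -> R) (X : R -> R -> 'rV[R]_n) Y :
  0 < t0 -> (forall j, 0 < e_ j) -> e_ @ \oo --> 0 ->
  (\forall j \near \oo, sol (e_ j) t0 (X (e_ j)) (Y (e_ j))) ->
  exists2 sigma : nat -> nat, increasing_seq sigma &
    exists xlim, slow_limit f g d x0 t0 X (e_ \o sigma) xlim.
Proof.
move=> t00 e0 e_0 S.
have [U [UU sU]] := ultraFilterLemma (@eventually_filter : ProperFilter \oo).
have {}S' : \forall j \near U, sol (e_ j) t0 (X (e_ j)) (Y (e_ j)) by exact: sU.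
have e_U : e_ @ U --> 0 by apply: cvg_trans e_0; exact: cvg_app.
have [Rx0 Rx00 HX] := slow_bounded g ha hfab x0 y0 t0.
have [xlim Xx] : exists xlim : R -> 'rV[R]_n, forall t : R, 0 <= t <= t0 ->
    X (e_ j) t @[j --> U] --> xlim t.
  suff H (t : R) : exists l : 'rV[R]_n, 0 <= t <= t0 -> X (e_ j) t @[j --> U] --> l.
    by exists (fun t => projT1 (cid (H t))) => t; case: cid.
  have [tt|tt] := boolP (0 <= t <= t0); last by exists 0.
  have [|l _ Hl] := @ultra_compact_cvg _ _ U (fun j => X (e_ j) t) _ UU (@enorm_ball0_compact R n Rx0).
    by apply: filterS S' => j Sj /=; apply: (HX _ _ _ _ (lexx t0) Sj).
  by exists l.
have [Rx [Rx_gt0 XR xR xL]] := limit_lipschitz ha hb hfab S' Xx.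
pose L := a + b * Rx.
have L0 : 0 <= L by rewrite addr_ge0 ?mulr_ge0// ltW.
have Xu (e : R) : 0 < e -> \forall j \near U, forall t : R, 0 <= t <= t0 ->
    enorm (X (e_ j) t - xlim t) < e.
  move=> ep; have [//|nX] := in_ultra_setVsetC
    [set j | forall t : R, 0 <= t <= t0 -> enorm (X (e_ j) t - xlim t) < e] UU.
  exfalso.
  (* [s j] is a time at which the bound fails, if there is one. Along [U] these times converge to
     some [t], where pointwise convergence and the common Lipschitz bound exclude failure. *)
  have H j : exists t : R, 0 <= t <= t0 /\
      ((exists2 t : R, 0 <= t <= t0 & e <= enorm (X (e_ j) t - xlim t)) ->
       e <= enorm (X (e_ j) t - xlim t)).
    have [[t tt te]|nt] := pselect (exists2 t : R, 0 <= t <= t0 & e <= enorm (X (e_ j) t - xlim t)).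
      by exists t.
    by exists 0; rewrite lexx ltW.
  have [s Hs] := choice H.
  have [|t tt st] := @ultra_compact_cvg _ _ U s _ UU (@segment_compact R 0 t0).
    by apply: filterE => j; have [] := Hs j; rewrite /= in_itv.
  rewrite /= in_itv/= in tt.
  have L1 : 0 < L + 1 by rewrite ltr_wpDl.
  have e4 : 0 < e / 4 by lra.
  have /cvgrPdist_lt /(_ _ (divr_gt0 e4 L1)) n1 := st.
  have /enorm_cvgP /(_ _ e4) n2 := Xx t tt.
  have [j [[nj Sj] [[j1 j2] j3]]] := filter_ex (filterI (filterI nX S') (filterI (filterI n1 n2) XR)).
  have [stt Hsj] := Hs j.
  have {}Hsj : e <= enorm (X (e_ j) (s j) - xlim (s j)).
    apply: Hsj; apply: contrapT => hn; apply: nj => t' tt'.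
    by rewrite ltNge; apply/negP => te; apply: hn; exists t'.
  rewrite ltr_pdivlMr// distrC in j1.
  have k1 := slow_lipschitz hb hfab Sj j3 tt stt.
  have k2 := xL _ _ stt tt.
  rewrite -/L distrC in k2; rewrite -/L in k1.
  have := enormB3 (X (e_ j) (s j)) (X (e_ j) t) (xlim t) (xlim (s j)).
  have : L * `|s j - t| <= `|s j - t| * (L + 1).
    by rewrite mulrC ler_wpM2l// lerDl.
  by elra.
(* Sets of [U] are nonempty, so from any index one can move to a later one with smaller [e_] and a
   closer curve; iterating also yields the monotonicity asked for in [slow_limit]. *)
have next k j0 : exists j, [/\ (j0 < j)%N, e_ j < e_ j0 &
    forall t : R, 0 <= t <= t0 -> enorm (X (e_ j) t - xlim t) < k.+1%:R^-1].
  have kp : 0 < k.+1%:R^-1 :> R by rewrite invr_gt0.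
  have n1 : \forall j \near U, (j0 < j)%N by apply: sU; exact: nbhs_infty_gt.
  have n2 : \forall j \near U, e_ j < e_ j0.
    have /cvgrPdist_lt /(_ _ (e0 j0)) := e_U.
    by apply: filterS => j; rewrite sub0r normrN gtr0_norm.
  by have [j [[j1 j2] j3]] := filter_ex (filterI (filterI n1 n2) (Xu _ kp)); exists j.
pose sigma := fix sigma k := if k is k'.+1 then projT1 (cid (next k' (sigma k'))) else 0%N.
have sigP k : [/\ (sigma k < sigma k.+1)%N, e_ (sigma k.+1) < e_ (sigma k) &
    forall t : R, 0 <= t <= t0 -> enorm (X (e_ (sigma k.+1)) t - xlim t) < k.+1%:R^-1].
  by rewrite /=; case: cid.
have sig_ge k : (k <= sigma k)%N.
  by elim: k => // k IH; apply: leq_ltn_trans IH _; have [] := sigP k.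
exists sigma; first by apply/increasing_seqP => k; have [] := sigP k.
exists xlim; split.
- by move=> k; exact: e0.
- by apply/decreasing_seqP => k; have [] := sigP k.
- apply: cvg_comp e_0; apply/cvgnyPge => N; near=> k.
  by apply: leq_trans (sig_ge k); near: k; exact: nbhs_infty_ge.
- apply/uniform_enormP => e ep.
  have [N _ HN] := near_infty_natSinv_lt (PosNum ep).
  exists N.+1 => // -[//|k] /= kN t; rewrite in_itv/= => tt.
  have [_ _ H] := sigP k; apply: lt_trans (H t tt) _.
  exact: HN.
split.
  have t0b : (0 : R) <= 0 <= t0 by rewrite lexx ltW.
  apply: (cvg_unique (@norm_hausdorff _ _) (Xx 0 t0b)).
  by apply: cvg_near_cst; apply: filterS S' => j [-> _ _].
split; first exact: lipschitz_absolutely_continuous L0 xL.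
(* Used to discard the endpoints, as the velocity is identified at interior times. *)
have ne (c : R) : {ae @lebesgue_measure R, forall t : R, t != c}.
  exists [set c]; split; [exact: measurable_set1|exact: lebesgue_measure_set1|].
  by move=> t /= /negP; rewrite negbK => /eqP.
have D := lipschitz_ae_deriv_within t00 L0 xL.
have F := ae_filter_ringOfSetsType (@lebesgue_measure R).
apply: filterS (filterI D (filterI (ne 0) (ne t0))) => t [Dt [t1 t2]].
rewrite in_itv/= => /andP[t3 t4].
have tt : 0 < t < t0 by rewrite !lt_neqAle t3 t4 eq_sym t1 t2.
have [v dv] := Dt tt; exists v => //.
exact: (slow_limit_velocity hd hf ha hb hfab hadm hlip hglob hbound UU sU e0 e_U S' Xu tt dv).
Unshelve. all: by end_near. Qed.

End SlowLimitExists.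

Theorem theorem5p9 (R : realType) (n m : nat)
  (f : 'rV[R]_n * 'rV[R]_m -> 'rV[R]_n) (g : vfield R n m)
  (d : vfield R n m -> vfield R n m -> R)
  (hd : metrizes (hull g) d)
  (hf : continuous f)
  (a b : R) (ha : 0 < a) (hb : 0 < b)
  (hfab : forall x y, enorm (f (x, y)) <= a + b * enorm x)
  (hadm : admissible g) (hlip : lipschitz_in_y g)
  (hglob : forall h : vfield R n m,
     ((exists2 tau0 : R, 0 <= tau0 & h = tshift g tau0) \/ omega_limit g h) ->
     forall (x : 'rV[R]_n) (y : 'rV[R]_m), exists phi, fast_solution h x 0 y phi)
  (hbound : forall K0 : set 'rV[R]_n, compact K0 -> ultimately_bounded g K0)
  (x0 : 'rV[R]_n) (y0 : 'rV[R]_m)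
  (I : R -> set R) (X : R -> R -> 'rV[R]_n) (Y : R -> R -> 'rV[R]_m)
  (hI : forall eps : R, 0 < eps ->
     [/\ is_interval (I eps), I eps 0, I eps `<=` [set t : R | 0 <= t] &
         exists2 t : R, 0 < t & I eps t])
  (hXY : forall eps : R, 0 < eps ->
     slow_fast_solution f g x0 y0 eps (I eps) (X eps) (Y eps))
  (t0 : R) (ht0 : 0 < t0) :
  (\forall eps \near 0^'+, exists X' Y',
     extends_to f g x0 y0 t0 eps (I eps) (X eps) (Y eps) X' Y') /\
  forall (X' : R -> R -> 'rV[R]_n) (Y' : R -> R -> 'rV[R]_m),
    (\forall eps \near 0^'+,
       extends_to f g x0 y0 t0 eps (I eps) (X eps) (Y eps)
         (X' eps) (Y' eps)) ->
    (forall e_ : nat -> R, (forall j, 0 < e_ j) -> e_ @ \oo --> 0 ->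
       exists2 sigma : nat -> nat, increasing_seq sigma &
         exists xlim, slow_limit f g d x0 t0 X' (e_ \o sigma) xlim) /\
    (forall (e_ : nat -> R) (xlim : R -> 'rV[R]_n),
       slow_limit f g d x0 t0 X' e_ xlim ->
       forall r : R, 0 < r ->
       let K0 := [set x : 'rV[R]_n | exists (t : R) (u : 'rV[R]_n),
                    [/\ t \in `[0, t0], enorm u <= r & x = xlim t + u]] in
       forall delta : R, 0 < delta ->
       exists (T tau0 delta' : R) (k0 : nat),
         [/\ 0 < T, 0 < tau0, 0 < delta' <= delta, (0 < k0)%N &
             tau0 + 2 * T < t0 / e_ k0] /\
         forall h_ : nat -> vfield R n m,
           (forall i, omega_limit g (h_ i)) ->
           (forall i, d (tshift g (tau0 + i%:R * T)) (h_ i) < delta') ->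
           forall (k : nat) (i : nat) (tau : R), (k0 <= k)%N ->
             tau0 + i.+1%:R * T <= tau <= tau0 + i.+2%:R * T ->
             tau0 + T <= tau <= t0 / e_ k ->
             (semidist (@eudist R m) [set Y' (e_ k) (e_ k * tau)%R]
                (inflated_fiber g d K0 delta
                   (tshift (h_ i) (tau - tau0 - i%:R * T)%R)
                   (xlim (e_ k * tau)%R))
              <= delta%:E)%E).
Proof.
have [eps1 eps10 Hext] :=
  slow_fast_extends hd hf ha hb hfab hadm hlip hglob hbound x0 y0 ht0.
split.
  near=> eps; have e0 : 0 < eps by near: eps; exact: nbhs_right_gt.
  have e1 : eps < eps1 by near: eps; exact: nbhs_right_lt.
  have [itvI I0 Ige _] := hI _ e0.
  by apply: Hext (hXY _ e0); rewrite ?e0.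
move=> X' Y' hX'.
have S (e_ : nat -> R) : (forall j, 0 < e_ j) -> e_ @ \oo --> 0 ->
    \forall j \near \oo,
      slow_fast_solution f g x0 y0 (e_ j) `[0, t0]%classic (X' (e_ j)) (Y' (e_ j)).
  move=> e0 e_0; have H : \forall j \near \oo, 0 < e_ j ->
      extends_to f g x0 y0 t0 (e_ j) (I (e_ j)) (X (e_ j)) (Y (e_ j))
        (X' (e_ j)) (Y' (e_ j)) := e_0 _ hX'.
  by apply: filterS H => j /(_ (e0 j)) [].
split=> [e_ e0 e_0|e_ xlim [e0 _ e_0 Xu _] r r0 K0 delta delta0].
  exact: (slow_limit_exists hd hf ha hb hfab hadm hlip hglob hbound ht0 e0 e_0 (S e_ e0 e_0)).
have [T [del [k0 [T0 deld k00 Tk0 H]]]] :=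
  pullback_close hd ha hb hfab hadm hlip hglob hbound ht0 r0 delta0 e0 e_0 (S e_ e0 e_0) Xu.
(* The value 1 for [tau0] is the summand in the bound [1 + 2 * T < t0 / e_ k0] of
   [pullback_close]. *)
exists T, 1, del, k0; split; first by split => //; exact: ltr01.
move=> h_ oh dh k i tau k0k /andP[tau1 tau2] /andP[_ tau3].
(* The fast component is restarted at [1 + i T], and the elapsed time lies in [[T, 2 T]]. *)
have tauE : tau = 1 + i%:R * T + (tau - 1 - i%:R * T) by ring.
have ekk := e0 k.
have iS : i.+1%:R * T = i%:R * T + T by rewrite -natr1 mulrDl mul1r.
have iSS : i.+2%:R * T = i%:R * T + 2 * T by rewrite -!natr1; ring.
rewrite {1 3}tauE; apply: (H k (1 + i%:R * T) (tau - 1 - i%:R * T) (h_ i)) => //.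
- by rewrite addr_ge0// mulr_ge0// ltW.
- by apply/andP; split; lra.
- by rewrite -tauE mulrC -ler_pdivlMr.
Unshelve. all: by end_near. Qed.
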